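(* A schematic finite space $X$ is semi-separated if and only if the diagonal morphism $\delta\colon X\to X\times X$ is affine.
   Context: All rings are commutative with unit. A ringed finite space is a ringed space $(X,\mathcal O)$ with $X$ a finite topological space; morphisms are morphisms of ringed spaces. For $p\in X$, $U_p$ is the smallest open subset containing $p$; $p\le q$ means $q\in U_p$. The stalk is $\mathcal O_p=\mathcal O(U_p)$, with restriction morphisms $\mathcal O_p\to\mathcal O_q$ for $p\le q$. A finite space is a ringed finite space all of whose restriction morphisms are flat. An $\mathcal O$-module is quasi-coherent if it is locally a cokernel of a morphism between free modules of arbitrary rank. All spaces and morphisms are over a fixed commutative base ring $k$ (i.e. over the one-point ringed space $( *,k)$; $k=\mathbb Z$ imposes no restriction). $X\times Y=X\times_kY$ is the product topological space with $\mathcal O_{(x,y)}=\mathcal O_x\otimes_k\mathcal O_y$. A finite space $X$ is schematic if $R^i\delta_*\mathcal O$ is quasi-coherent for all $i\ge0$; it is semi-separated if $\delta_*\mathcal O$ is quasi-coherent and $R^i\delta_*\mathcal O=0$ for $i>0$. A morphism $f\colon X\to Y$ of finite spaces is schematic if $R^i\Gamma_*\mathcal O_X$ is quasi-coherent for all $i\ge0$, where $\Gamma\colon X\to X\times Y$ is the graph of $f$; if $X$ is schematic then $X\times X$ and $\delta$ are schematic. A finite space $X$ with $A=\mathcal O(X)$ is affine if $H^i(X,\mathcal O)=0$ for $i>0$ and the global sections functor is an equivalence from quasi-coherent $\mathcal O$-modules to $A$-modules. A schematic morphism $f\colon X\to Y$ between schematic finite spaces is affine if $f^{-1}(U_y)$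 is affine for every $y\in Y$. *)

(* Defs.v *)
From HB Require Import structures.
From mathcomp Require Import all_boot all_algebra finmap all_classical.
From mathcomp Require Import topology_structure product_topology subtype_topology.

Set Implicit Arguments.
Unset Strict Implicit.
Unset Printing Implicit Defensive.

Import GRing.Theory.
Local Open Scope ring_scope.
Local Open Scope classical_set_scope.
Local Open Scope quotient_scope.

(* Rings are [comPzRingType]s because zero rings do occur: O(U) for U empty,
   tensor products. *)

Definition rscal (A B : comPzRingType) (f : {rmorphism A -> B})
  (M : lmodType B) : Type := M.

Section RestrictScalars.
Variables (A B : comPzRingType) (f : {rmorphism A -> B}) (M : lmodType B).

HB.instance Definition _ := GRing.Zmodule.copy (rscal f M) M.

Definition rscal_scale (a : A) (m : rscal f M) : rscal f M := f a *: (m : M).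

Fact rscal_scaleA a b m :
  rscal_scale a (rscal_scale b m) = rscal_scale (a * b) m.
Proof. by rewrite /rscal_scale rmorphM scalerA. Qed.

Fact rscal_scale1 : left_id 1 rscal_scale.
Proof. by move=> m; rewrite /rscal_scale rmorph1 scale1r. Qed.

Fact rscal_scaleDr : right_distributive rscal_scale +%R.
Proof. by move=> a m n; rewrite /rscal_scale scalerDr. Qed.

Fact rscal_scaleDl m : {morph rscal_scale^~ m : a b / a + b}.
Proof. by move=> a b; rewrite /rscal_scale rmorphD scalerDl. Qed.

HB.instance Definition _ := GRing.Zmodule_isLmodule.Build A (rscal f M)
  rscal_scaleA rscal_scale1 rscal_scaleDr rscal_scaleDl.

End RestrictScalars.

(* M (x)_k N is the quotient of the free commutative monoid on M * N by the
   congruence generated by bilinearity; a list stands for the sum of its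
   entries. *)
Section Tensor.
Variables (k : comPzRingType) (M N : lmodType k).

Inductive tens_rel : seq (M * N) -> seq (M * N) -> Prop :=
| tens_refl s : tens_rel s s
| tens_sym s t : tens_rel s t -> tens_rel t s
| tens_trans s t u : tens_rel s t -> tens_rel t u -> tens_rel s u
| tens_cat s s' t t' :
    tens_rel s s' -> tens_rel t t' -> tens_rel (s ++ t) (s' ++ t')
| tens_comm s t : tens_rel (s ++ t) (t ++ s)
| tens_addl m m' n : tens_rel [:: (m + m', n)] [:: (m, n); (m', n)]
| tens_addr m n n' : tens_rel [:: (m, n + n')] [:: (m, n); (m, n')]
| tens_zero n : tens_rel [:: (0, n)] [::]
| tens_scal c m n : tens_rel [:: (c *: m, n)] [:: (m, c *: n)].

Definition tens_relb : rel (seq (M * N)) := fun s t => `[< tens_rel s t >].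

Fact tens_relb_refl : reflexive tens_relb.
Proof. by move=> s; apply/asboolP; exact: tens_refl. Qed.

Fact tens_relb_sym : symmetric tens_relb.
Proof. by move=> s t; apply/asboolP/asboolP; exact: tens_sym. Qed.

Fact tens_relb_trans : transitive tens_relb.
Proof. by move=> t s u /asboolP st /asboolP tu; apply/asboolP; exact: tens_trans tu. Qed.

Canonical tens_equiv :=
  EquivRel tens_relb tens_relb_refl tens_relb_sym tens_relb_trans.

Definition tensor := {eq_quot tens_equiv}.

HB.instance Definition _ := Choice.on tensor.

Definition tens_of (s : seq (M * N)) : tensor := \pi_(tensor) s.

Lemma tens_ofP s t : tens_of s = tens_of t <-> tens_rel s t.
Proof. by split=> [/eqmodP/asboolP|h] //; apply/eqmodP/asboolP. Qed.

Lemma tens_of_repr (x : tensor) : tens_of (repr x) = x.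
Proof. exact: reprK. Qed.

Definition tens_add (x y : tensor) : tensor := tens_of (repr x ++ repr y).
Definition tens_opp (x : tensor) : tensor :=
  tens_of [seq (- p.1, p.2) | p <- repr x].

Lemma tens_add_of s t : tens_add (tens_of s) (tens_of t) = tens_of (s ++ t).
Proof. by apply/tens_ofP/tens_cat; apply/tens_ofP; rewrite tens_of_repr. Qed.

Fact tens_addA : associative tens_add.
Proof.
move=> x y z; rewrite -(tens_of_repr x) -(tens_of_repr y) -(tens_of_repr z).
by rewrite !tens_add_of catA.
Qed.

Fact tens_addC : commutative tens_add.
Proof.
move=> x y; rewrite -(tens_of_repr x) -(tens_of_repr y) !tens_add_of.
by apply/tens_ofP/tens_comm.
Qed.

Fact tens_add0 : left_id (tens_of [::]) tens_add.
Proof. by move=> x; rewrite -(tens_of_repr x) tens_add_of. Qed.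

Fact tens_addN : left_inverse (tens_of [::]) tens_opp tens_add.
Proof.
move=> x; rewrite -{2}(tens_of_repr x) /tens_opp.
elim: (repr x) => [|[m n] s IHs] /=; first by rewrite tens_add_of.
have -> t : tens_of ((- m, n) :: t) = tens_add (tens_of [:: (- m, n)]) (tens_of t).
  by rewrite tens_add_of.
have -> t : tens_of ((m, n) :: t) = tens_add (tens_of [:: (m, n)]) (tens_of t).
  by rewrite tens_add_of.
rewrite tens_addA -(tens_addA (tens_of [:: (- m, n)])).
rewrite (tens_addC (tens_of (map _ _))) tens_addA -tens_addA IHs tens_add_of.
rewrite tens_addC tens_add0; apply/tens_ofP.
apply: tens_trans (tens_sym (tens_addl _ _ _)) _.
by rewrite addNr; exact: tens_zero.
Qed.

HB.instance Definition _ :=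
  GRing.isZmodule.Build tensor tens_addA tens_addC tens_add0 tens_addN.

Definition tens (m : M) (n : N) : tensor := tens_of [:: (m, n)].

Lemma tensDl m m' n : tens (m + m') n = tens m n + tens m' n.
Proof. by rewrite [RHS]tens_add_of; apply/tens_ofP/tens_addl. Qed.

Lemma tensDr m n n' : tens m (n + n') = tens m n + tens m n'.
Proof. by rewrite [RHS]tens_add_of; apply/tens_ofP/tens_addr. Qed.

Lemma tensZ c m n : tens (c *: m) n = tens m (c *: n).
Proof. exact/tens_ofP/tens_scal. Qed.

Lemma tens_ofE s : tens_of s = \sum_(p <- s) tens p.1 p.2.
Proof.
elim: s => [|[m n] s IHs]; first by rewrite big_nil.
by rewrite big_cons -IHs [RHS]tens_add_of.
Qed.

Lemma tens_ind (P : tensor -> Prop) :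
  P 0 -> (forall x y, P x -> P y -> P (x + y)) ->
  (forall m n, P (tens m n)) -> forall x, P x.
Proof.
move=> P0 PD Pt x; rewrite -(tens_of_repr x) tens_ofE.
by elim/big_ind: _ => // p _; exact: Pt.
Qed.

(* the additive map induced by b, meaningful when b is bilinear *)
Definition tens_lift (Z : zmodType) (b : M -> N -> Z) (x : tensor) : Z :=
  \sum_(p <- repr x) b p.1 p.2.

Section Lift.
Variables (Z : zmodType) (b : M -> N -> Z).
Hypotheses (bDl : forall n, {morph b^~ n : x y / x + y})
  (bDr : forall m, {morph b m : x y / x + y})
  (bZ : forall c m n, b (c *: m) n = b m (c *: n)).

Lemma tens_lift_of s : tens_lift b (tens_of s) = \sum_(p <- s) b p.1 p.2.
Proof.
have /tens_ofP : tens_of (repr (tens_of s)) = tens_of s by rewrite tens_of_repr.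
rewrite /tens_lift; move: (repr _) => s' h.
elim: h => {s s'} //.
- by move=> s t u _ -> _ ->.
- by move=> s s' t t' _ IHs _ IHt; rewrite !big_cat /= IHs IHt.
- by move=> s t; rewrite !big_cat /= addrC.
- by move=> m m' n; rewrite !big_cons !big_nil !addr0 /= bDl.
- by move=> m n n'; rewrite !big_cons !big_nil !addr0 /= bDr.
- move=> n; rewrite big_cons !big_nil addr0 /=.
  by apply: (addrI (b 0 n)); rewrite -bDl !addr0.
- by move=> c m n; rewrite !big_cons !big_nil bZ.
Qed.

Lemma tens_liftE m n : tens_lift b (tens m n) = b m n.
Proof. by rewrite tens_lift_of big_seq1. Qed.

Lemma tens_liftD : {morph tens_lift b : x y / x + y}.
Proof.
move=> x y; rewrite -(tens_of_repr x) -(tens_of_repr y) [_ + _]tens_add_of.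
by rewrite !tens_lift_of big_cat.
Qed.

Lemma tens_lift0 : tens_lift b 0 = 0.
Proof. by rewrite [0]/(tens_of [::]) tens_lift_of big_nil. Qed.

End Lift.
End Tensor.

Definition tens_mapr (k : comPzRingType) (M N N' : lmodType k)
    (u : {linear N -> N'}) : tensor M N -> tensor M N' :=
  tens_lift (fun m n => tens m (u n)).

Definition flat_rmorphism (A B : comPzRingType) (f : {rmorphism A -> B}) :=
  forall (M N : lmodType A) (u : {linear M -> N}),
    injective u -> injective (tens_mapr (M := rscal f B^o) u).

Section TensorAlgebra.
Variables (k A B : comPzRingType).
Variables (iA : {rmorphism k -> A}) (iB : {rmorphism k -> B}).

Definition tensor_alg : Type := tensor (rscal iA A^o) (rscal iB B^o).

HB.instance Definition _ := GRing.Zmodule.on tensor_alg.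

Definition tpure (a : A) (b : B) : tensor_alg :=
  @tens k (rscal iA A^o) (rscal iB B^o) a b.

Lemma tpureDl a a' b : tpure (a + a') b = tpure a b + tpure a' b.
Proof. exact: tensDl. Qed.

Lemma tpureDr a b b' : tpure a (b + b') = tpure a b + tpure a b'.
Proof. exact: tensDr. Qed.

Lemma tpureZ c a b : tpure (iA c * a) b = tpure a (iB c * b).
Proof. exact: (@tensZ k (rscal iA A^o) (rscal iB B^o)). Qed.

Lemma tpure_ind (P : tensor_alg -> Prop) :
  P 0 -> (forall x y, P x -> P y -> P (x + y)) ->
  (forall a b, P (tpure a b)) -> forall x, P x.
Proof. exact: tens_ind. Qed.

Definition tlift (Z : zmodType) (b : A -> B -> Z) (x : tensor_alg) : Z :=
  @tens_lift k (rscal iA A^o) (rscal iB B^o) Z b x.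

Section TLift.
Variables (Z : zmodType) (b : A -> B -> Z).
Hypotheses (bDl : forall y, {morph b^~ y : x x' / x + x'})
  (bDr : forall x, {morph b x : y y' / y + y'})
  (bZ : forall c x y, b (iA c * x) y = b x (iB c * y)).

Lemma tliftE x y : tlift b (tpure x y) = b x y.
Proof. exact: tens_liftE. Qed.

Lemma tliftD : {morph tlift b : x y / x + y}.
Proof. exact: tens_liftD. Qed.

Lemma tlift0 : tlift b 0 = 0.
Proof. exact: tens_lift0. Qed.
End TLift.

Definition tmull (a : A) (b : B) : tensor_alg -> tensor_alg :=
  tlift (fun a' b' => tpure (a * a') (b * b')).

Definition tmul (x y : tensor_alg) : tensor_alg :=
  tlift (fun a b => tmull a b y) x.

Fact tmull_bDl a b b' :
  {morph (fun a' => tpure (a * a') (b * b')) : x y / x + y}.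
Proof. by move=> x y; rewrite mulrDr tpureDl. Qed.

Fact tmull_bDr a b a' :
  {morph (fun b' => tpure (a * a') (b * b')) : x y / x + y}.
Proof. by move=> x y; rewrite mulrDr tpureDr. Qed.

Fact tmull_bZ a b c a' b' :
  tpure (a * (iA c * a')) (b * b') = tpure (a * a') (b * (iB c * b')).
Proof. by rewrite mulrCA tpureZ mulrCA. Qed.

Lemma tmullE a b a' b' : tmull a b (tpure a' b') = tpure (a * a') (b * b').
Proof. by rewrite /tmull tliftE //; [exact: tmull_bDl|exact: tmull_bDr|exact: tmull_bZ]. Qed.

Lemma tmullD a b : {morph tmull a b : x y / x + y}.
Proof. by apply: tliftD; [exact: tmull_bDl|exact: tmull_bDr|exact: tmull_bZ]. Qed.

Lemma tmull0 a b : tmull a b 0 = 0.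
Proof. by apply: tlift0; [exact: tmull_bDl|exact: tmull_bDr|exact: tmull_bZ]. Qed.

Fact tmul_bDl y b : {morph (fun a => tmull a b y) : x x' / x + x'}.
Proof.
move=> a a' /=; elim/tpure_ind: y => [|x y IHx IHy|a2 b2].
- by rewrite !tmull0 addr0.
- by rewrite !tmullD IHx IHy addrACA.
- by rewrite !tmullE mulrDl tpureDl.
Qed.

Fact tmul_bDr y a : {morph (fun b => tmull a b y) : x x' / x + x'}.
Proof.
move=> b b' /=; elim/tpure_ind: y => [|x y IHx IHy|a2 b2].
- by rewrite !tmull0 addr0.
- by rewrite !tmullD IHx IHy addrACA.
- by rewrite !tmullE mulrDl tpureDr.
Qed.

Fact tmul_bZ y c a b : tmull (iA c * a) b y = tmull a (iB c * b) y.
Proof.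
elim/tpure_ind: y => [|x y IHx IHy|a2 b2].
- by rewrite !tmull0.
- by rewrite !tmullD IHx IHy.
- by rewrite !tmullE -!mulrA tpureZ.
Qed.

Lemma tmulpE a b y : tmul (tpure a b) y = tmull a b y.
Proof. by rewrite /tmul tliftE //; [exact: tmul_bDl|exact: tmul_bDr|exact: tmul_bZ]. Qed.

Lemma tmul0t y : tmul 0 y = 0.
Proof. by apply: tlift0; [exact: tmul_bDl|exact: tmul_bDr|exact: tmul_bZ]. Qed.

Fact tmulDl : left_distributive tmul +%R.
Proof. by move=> x x' y; apply: tliftD; [exact: tmul_bDl|exact: tmul_bDr|exact: tmul_bZ]. Qed.

Fact tmulDr : right_distributive tmul +%R.
Proof.
move=> x y z; elim/tpure_ind: x => [|x x' IHx IHx'|a b].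
- by rewrite !tmul0t addr0.
- by rewrite !tmulDl IHx IHx' addrACA.
- by rewrite !tmulpE tmullD.
Qed.

Lemma tmult0 x : tmul x 0 = 0.
Proof. by apply: (addrI (tmul x 0)); rewrite -tmulDr !addr0. Qed.

Lemma tmulE a b a' b' : tmul (tpure a b) (tpure a' b') = tpure (a * a') (b * b').
Proof. by rewrite tmulpE tmullE. Qed.

Fact tmulC : commutative tmul.
Proof.
move=> x y; elim/tpure_ind: x => [|x x' IHx IHx'|a b].
- by rewrite tmul0t tmult0.
- by rewrite tmulDl tmulDr IHx IHx'.
elim/tpure_ind: y => [|y y' IHy IHy'|a' b'].
- by rewrite tmul0t tmult0.
- by rewrite tmulDl tmulDr IHy IHy'.
- by rewrite !tmulE mulrC (mulrC b).
Qed.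

Fact tmulA : associative tmul.
Proof.
move=> x y z; elim/tpure_ind: x => [|x x' IHx IHx'|a b].
- by rewrite !tmul0t.
- by rewrite !tmulDl IHx IHx'.
elim/tpure_ind: y => [|y y' IHy IHy'|a' b'].
- by rewrite tmult0 !tmul0t tmult0.
- by rewrite tmulDr !tmulDl tmulDr IHy IHy'.
elim/tpure_ind: z => [|z z' IHz IHz'|a2 b2].
- by rewrite !tmult0.
- by rewrite !tmulDr IHz IHz'.
- by rewrite !tmulE !mulrA.
Qed.

Fact tmul1 : left_id (tpure 1 1) tmul.
Proof.
elim/tpure_ind=> [|x x' IHx IHx'|a b]; first exact: tmult0.
- by rewrite tmulDr IHx IHx'.
- by rewrite tmulE !mul1r.
Qed.

HB.instance Definition _ := GRing.Zmodule_isComPzRing.Build tensor_alg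
  tmulA tmulC tmul1 tmulDl.

Lemma tpureM a b a' b' : tpure a b * tpure a' b' = tpure (a * a') (b * b').
Proof. exact: tmulE. Qed.

Definition tinl (a : A) : tensor_alg := tpure a 1.
Definition tinr (b : B) : tensor_alg := tpure 1 b.

Fact tinl_is_additive : zmod_morphism tinl.
Proof.
move=> x y; rewrite /tinl; apply: (addIr (tpure y 1)).
by rewrite -tpureDl addrNK -addrA addNr addr0.
Qed.
Fact tinl_is_multiplicative : monoid_morphism tinl.
Proof. by split=> // x y; rewrite /tinl tpureM mulr1. Qed.
HB.instance Definition _ := GRing.isZmodMorphism.Build A tensor_alg tinl
  tinl_is_additive.
HB.instance Definition _ := GRing.isMonoidMorphism.Build A tensor_alg tinl
  tinl_is_multiplicative.

Fact tinr_is_additive : zmod_morphism tinr.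
Proof.
move=> x y; rewrite /tinr; apply: (addIr (tpure 1 y)).
by rewrite -tpureDr addrNK -addrA addNr addr0.
Qed.
Fact tinr_is_multiplicative : monoid_morphism tinr.
Proof. by split=> // x y; rewrite /tinr tpureM mulr1. Qed.
HB.instance Definition _ := GRing.isZmodMorphism.Build B tensor_alg tinr
  tinr_is_additive.
HB.instance Definition _ := GRing.isMonoidMorphism.Build B tensor_alg tinr
  tinr_is_multiplicative.

Lemma tin_scal c : tinl (iA c) = tinr (iB c).
Proof. by have := tpureZ c 1 1; rewrite !mulr1. Qed.

Section Copair.
Variables (C : comPzRingType) (f : {rmorphism A -> C}) (g : {rmorphism B -> C}).
Hypothesis fg : forall c, f (iA c) = g (iB c).

Definition tcopair of (forall c, f (iA c) = g (iB c)) :=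
  tlift (fun a b => f a * g b).

Local Notation h := (tcopair fg).

Fact copair_bDl b : {morph (fun a => f a * g b) : x y / x + y}.
Proof. by move=> x y; rewrite rmorphD mulrDl. Qed.
Fact copair_bDr a : {morph (fun b => f a * g b) : x y / x + y}.
Proof. by move=> x y; rewrite rmorphD mulrDr. Qed.
Fact copair_bZ c a b : f (iA c * a) * g b = f a * g (iB c * b).
Proof. by rewrite !rmorphM fg mulrCA mulrA. Qed.

Lemma tcopairE a b : h (tpure a b) = f a * g b.
Proof. by rewrite /tcopair tliftE //; [exact: copair_bDl|exact: copair_bDr|exact: copair_bZ]. Qed.
Lemma tcopairD : {morph h : x y / x + y}.
Proof. by apply: tliftD; [exact: copair_bDl|exact: copair_bDr|exact: copair_bZ]. Qed.
Lemma tcopair0 : h 0 = 0.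
Proof. by apply: tlift0; [exact: copair_bDl|exact: copair_bDr|exact: copair_bZ]. Qed.

Fact tcopair_is_additive : zmod_morphism h.
Proof.
by move=> x y; apply: (addIr (h y)); rewrite -tcopairD addrNK -addrA addNr addr0.
Qed.

Fact tcopair_is_multiplicative : monoid_morphism h.
Proof.
split=> [|x y]; first by rewrite [1]/(tpure 1 1) tcopairE !rmorph1 mulr1.
elim/tpure_ind: x => [|x x' IHx IHx'|a b].
- by rewrite mul0r tcopair0 mul0r.
- by rewrite mulrDl !tcopairD IHx IHx' mulrDl.
elim/tpure_ind: y => [|y y' IHy IHy'|a' b'].
- by rewrite mulr0 tcopair0 mulr0.
- by rewrite mulrDr !tcopairD IHy IHy' mulrDr.
- by rewrite tpureM !tcopairE !rmorphM mulrACA.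
Qed.

HB.instance Definition _ := GRing.isZmodMorphism.Build tensor_alg C h
  tcopair_is_additive.
HB.instance Definition _ := GRing.isMonoidMorphism.Build tensor_alg C h
  tcopair_is_multiplicative.

End Copair.
End TensorAlgebra.

Record finsupp (I : Type) (R : comPzRingType) := FinSupp {
  fs_val :> I -> R;
  fs_finite : finite_set [set i | fs_val i != 0] }.

Section FinSupp.
Variables (I : Type) (R : comPzRingType).
Implicit Types f g : finsupp I R.

Lemma finsuppP f g : (forall i, f i = g i) -> f = g.
Proof.
case: f g => [f hf] [g hg] /= /funext fg; subst g.
by congr FinSupp; exact: Prop_irrelevance.
Qed.

HB.instance Definition _ := gen_eqMixin (finsupp I R).
HB.instance Definition _ := gen_choiceMixin (finsupp I R).

Fact fs_zero_finite : finite_set [set i : I | (0 : R) != 0].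
Proof. by rewrite eqxx (_ : [set _ | _] = set0) // -subset0. Qed.
Definition fs_zero := FinSupp fs_zero_finite.

Fact fs_opp_finite f : finite_set [set i | - f i != 0].
Proof. by apply: sub_finite_set (fs_finite f) => i /=; rewrite oppr_eq0. Qed.
Definition fs_opp f := FinSupp (fs_opp_finite f).

Fact fs_add_finite f g : finite_set [set i | f i + g i != 0].
Proof.
have hU : finite_set ([set i | f i != 0] `|` [set i | g i != 0]).
  by rewrite finite_setU; split; exact: fs_finite.
apply: sub_finite_set hU => i /= fg.
by have [f0|] := eqVneq (f i) 0; [right; rewrite f0 add0r in fg|left].
Qed.
Definition fs_add f g := FinSupp (fs_add_finite f g).

Fact fs_scale_finite a f : finite_set [set i | a * f i != 0].
Proof.
by apply: sub_finite_set (fs_finite f) => i /=; apply: contra => /eqP->; rewrite mulr0.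
Qed.
Definition fs_scale a f := FinSupp (fs_scale_finite a f).

Fact fs_addA : associative fs_add.
Proof. by move=> f g h; apply: finsuppP => i /=; rewrite addrA. Qed.
Fact fs_addC : commutative fs_add.
Proof. by move=> f g; apply: finsuppP => i /=; rewrite addrC. Qed.
Fact fs_add0 : left_id fs_zero fs_add.
Proof. by move=> f; apply: finsuppP => i /=; rewrite add0r. Qed.
Fact fs_addN : left_inverse fs_zero fs_opp fs_add.
Proof. by move=> f; apply: finsuppP => i /=; rewrite addNr. Qed.
HB.instance Definition _ :=
  GRing.isZmodule.Build (finsupp I R) fs_addA fs_addC fs_add0 fs_addN.

Fact fs_scaleA a b f : fs_scale a (fs_scale b f) = fs_scale (a * b) f.
Proof. by apply: finsuppP => i /=; rewrite mulrA. Qed.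
Fact fs_scale1 : left_id 1 fs_scale.
Proof. by move=> f; apply: finsuppP => i /=; rewrite mul1r. Qed.
Fact fs_scaleDr : right_distributive fs_scale +%R.
Proof. by move=> a f g; apply: finsuppP => i /=; rewrite mulrDr. Qed.
Fact fs_scaleDl f : {morph fs_scale^~ f : a b / a + b}.
Proof. by move=> a b; apply: finsuppP => i /=; rewrite mulrDl. Qed.
HB.instance Definition _ := GRing.Zmodule_isLmodule.Build R (finsupp I R)
  fs_scaleA fs_scale1 fs_scaleDr fs_scaleDl.
End FinSupp.

Section FinSuppMap.
Variables (I : Type) (R S : comPzRingType) (h : {rmorphism R -> S}).

Fact fs_map_finite (f : finsupp I R) : finite_set [set i | h (f i) != 0].
Proof.
by apply: sub_finite_set (fs_finite f) => i /=; apply: contra => /eqP->; rewrite rmorph0.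
Qed.
Definition fs_map f := FinSupp (fs_map_finite f).

Fact fs_map_is_additive : zmod_morphism fs_map.
Proof. by move=> f g; apply: finsuppP => i /=; rewrite rmorphB. Qed.
HB.instance Definition _ := GRing.isZmodMorphism.Build (finsupp I R)
  (finsupp I S) fs_map fs_map_is_additive.
Fact fs_map_is_scalable : scalable_for (h \; *:%R) fs_map.
Proof. by move=> a f; apply: finsuppP => i /=; rewrite rmorphM. Qed.
HB.instance Definition _ := GRing.isScalable.Build R (finsupp I R)
  (finsupp I S) (h \; *:%R) fs_map fs_map_is_scalable.
End FinSuppMap.

Record lsubmod (R : comPzRingType) (V : lmodType R) := LSubmod {
  lsub_set :> V -> Prop;
  lsub0 : lsub_set 0;
  lsubD : forall v w, lsub_set v -> lsub_set w -> lsub_set (v + w);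
  lsubZ : forall a v, lsub_set v -> lsub_set (a *: v) }.

(* the quotient Z / B, whose elements are the cosets z + B with z in Z *)
Record subquot (R : comPzRingType) (V : lmodType R) (Z B : lsubmod V) := SubQuot {
  sq_set : set V;
  sq_setP : exists2 z, Z z & sq_set = [set v | B (v - z)] }.

Section SubQuot.
Variables (R : comPzRingType) (V : lmodType R) (Z B : lsubmod V).
Local Notation Q := (subquot Z B).

Lemma lsubN (S : lsubmod V) v : S v -> S (- v).
Proof. by move=> Sv; rewrite -scaleN1r; exact: lsubZ. Qed.

Definition sq_class (z : V) (Zz : Z z) : Q :=
  SubQuot (ex_intro2 (fun z => Z z) (fun z => _ = [set v | B (v - z)]) z Zz erefl).

Definition sq_repr (c : Q) : V := sval (cid2 (sq_setP c)).

Lemma sq_reprP c : Z (sq_repr c).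
Proof. by rewrite /sq_repr; case: cid2. Qed.

Lemma subquot_inj (c d : Q) : sq_set c = sq_set d -> c = d.
Proof.
case: c d => [c cP] [d dP] /= cd; subst d.
by rewrite (Prop_irrelevance cP dP).
Qed.

Lemma sq_eqP (c d : Q) : c = d <-> B (sq_repr c - sq_repr d).
Proof.
split=> [->|]; first by rewrite subrr; exact: lsub0.
rewrite /sq_repr; case: cid2 => /= z Zz cE; case: cid2 => /= w Zw dE Bzw.
apply: subquot_inj; rewrite cE dE; apply/seteqP; split=> v /= Bv.
  by rewrite -[v](subrK z) -addrA; exact: lsubD.
by rewrite -[v](subrK w) -addrA; apply: lsubD => //; rewrite -opprB; exact: lsubN.
Qed.

Lemma sq_repr_class z (Zz : Z z) : B (sq_repr (sq_class Zz) - z).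
Proof.
rewrite /sq_repr; case: cid2 => /= w _ /seteqP[_ /(_ w)] /=; apply.
by rewrite subrr; exact: lsub0.
Qed.

Lemma sq_classP z w (Zz : Z z) (Zw : Z w) :
  sq_class Zz = sq_class Zw <-> B (z - w).
Proof.
rewrite sq_eqP; have Bz := sq_repr_class Zz; have Bw := sq_repr_class Zw.
set z' := sq_repr _ in Bz *; set w' := sq_repr _ in Bw *; split=> h.
  have -> : z - w = (z' - w') - (z' - z) + (w' - w).
    by rewrite opprB [_ + (z - z')]addrC !subrKA.
  by do ![apply: lsubD => //]; exact: lsubN.
have -> : z' - w' = (z - w) + (z' - z) - (w' - w).
  by rewrite opprB [z - w + _]addrC !subrKA.
by do ![apply: lsubD => //]; exact: lsubN.
Qed.

Lemma sq_classK c : sq_class (sq_reprP c) = c.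
Proof. by apply/sq_eqP; exact: sq_repr_class. Qed.

HB.instance Definition _ := gen_eqMixin Q.
HB.instance Definition _ := gen_choiceMixin Q.

Definition sq_zero : Q := sq_class (lsub0 Z).
Definition sq_add (c d : Q) : Q := sq_class (lsubD (sq_reprP c) (sq_reprP d)).
Definition sq_opp (c : Q) : Q := sq_class (lsubN (sq_reprP c)).
Definition sq_scale (a : R) (c : Q) : Q := sq_class (lsubZ a (sq_reprP c)).

Lemma sq_add_class z w (Zz : Z z) (Zw : Z w) :
  sq_add (sq_class Zz) (sq_class Zw) = sq_class (lsubD Zz Zw).
Proof.
apply/sq_classP; rewrite opprD addrACA.
by apply: lsubD; exact: sq_repr_class.
Qed.
Lemma sq_opp_class z (Zz : Z z) : sq_opp (sq_class Zz) = sq_class (lsubN Zz).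
Proof. by apply/sq_classP; rewrite -opprD; apply: lsubN; exact: sq_repr_class. Qed.
Lemma sq_scale_class a z (Zz : Z z) :
  sq_scale a (sq_class Zz) = sq_class (lsubZ a Zz).
Proof. by apply/sq_classP; rewrite -scalerBr; apply: lsubZ; exact: sq_repr_class. Qed.

Lemma sq_ind (P : Q -> Prop) : (forall z Zz, P (@sq_class z Zz)) -> forall c, P c.
Proof. by move=> h c; rewrite -(sq_classK c). Qed.

Lemma sq_class_eq z w (Zz : Z z) (Zw : Z w) : z = w -> sq_class Zz = sq_class Zw.
Proof. by move=> e; apply/sq_classP; rewrite e subrr; exact: lsub0. Qed.

Fact sq_addA : associative sq_add.
Proof.
elim/sq_ind=> x Zx; elim/sq_ind=> y Zy; elim/sq_ind=> z Zz.
by rewrite !sq_add_class; apply: sq_class_eq; rewrite addrA.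
Qed.
Fact sq_addC : commutative sq_add.
Proof.
elim/sq_ind=> x Zx; elim/sq_ind=> y Zy.
by rewrite !sq_add_class; apply: sq_class_eq; rewrite addrC.
Qed.
Fact sq_add0 : left_id sq_zero sq_add.
Proof. by elim/sq_ind=> x Zx; rewrite sq_add_class; apply: sq_class_eq; rewrite add0r. Qed.
Fact sq_addN : left_inverse sq_zero sq_opp sq_add.
Proof.
elim/sq_ind=> x Zx; rewrite sq_opp_class sq_add_class.
by apply: sq_class_eq; rewrite addNr.
Qed.
HB.instance Definition _ := GRing.isZmodule.Build Q sq_addA sq_addC sq_add0 sq_addN.

Fact sq_scaleA a b c : sq_scale a (sq_scale b c) = sq_scale (a * b) c.
Proof.
by elim/sq_ind: c => x Zx; rewrite !sq_scale_class; apply: sq_class_eq; rewrite scalerA.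
Qed.
Fact sq_scale1 : left_id 1 sq_scale.
Proof. by elim/sq_ind=> x Zx; rewrite sq_scale_class; apply: sq_class_eq; rewrite scale1r. Qed.
Fact sq_scaleDr : right_distributive sq_scale +%R.
Proof.
move=> a; elim/sq_ind=> x Zx; elim/sq_ind=> y Zy.
rewrite [_ + _]sq_add_class !sq_scale_class [RHS]sq_add_class.
by apply: sq_class_eq; rewrite scalerDr.
Qed.
Fact sq_scaleDl c : {morph sq_scale^~ c : a b / a + b}.
Proof.
move=> a b /=; elim/sq_ind: c => x Zx.
by rewrite !sq_scale_class [RHS]sq_add_class; apply: sq_class_eq; rewrite scalerDl.
Qed.
HB.instance Definition _ := GRing.Zmodule_isLmodule.Build R Q
  sq_scaleA sq_scale1 sq_scaleDr sq_scaleDl.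
End SubQuot.

Section SubQuotTheory.
Variables (R : comPzRingType) (V : lmodType R) (Z B : lsubmod V).

Lemma sq_classD z w (Zz : Z z) (Zw : Z w) :
  sq_class B Zz + sq_class B Zw = sq_class B (lsubD Zz Zw).
Proof. exact: sq_add_class. Qed.

Lemma sq_classN z (Zz : Z z) : - sq_class B Zz = sq_class B (lsubN Zz).
Proof. exact: sq_opp_class. Qed.

Lemma sq_classZ a z (Zz : Z z) : a *: sq_class B Zz = sq_class B (lsubZ a Zz).
Proof. exact: sq_scale_class. Qed.
End SubQuotTheory.

Section SubQuotMap.
Variables (R S : comPzRingType) (h : {rmorphism R -> S}).
Variables (V : lmodType R) (W : lmodType S) (u : {linear V -> W | h \; *:%R}).
Variables (Z B : lsubmod V) (Z' B' : lsubmod W).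
Hypotheses (uZ : forall v, Z v -> Z' (u v)) (uB : forall v, B v -> B' (u v)).

Definition sq_map of (forall v, B v -> B' (u v)) :=
  fun c : subquot Z B => sq_class B' (uZ (sq_reprP c)).
Local Notation f := (sq_map uB).

Lemma sq_map_class z (Zz : Z z) : f (sq_class B Zz) = sq_class B' (uZ Zz).
Proof. by apply/sq_classP; rewrite -raddfB; apply: uB; exact: sq_repr_class. Qed.

Fact sq_map_is_additive : zmod_morphism f.
Proof.
elim/sq_ind=> x Zx; elim/sq_ind=> y Zy.
rewrite sq_classN sq_classD !sq_map_class sq_classN sq_classD.
by apply: sq_class_eq; rewrite raddfB.
Qed.
HB.instance Definition _ := GRing.isZmodMorphism.Build (subquot Z B)
  (subquot Z' B') f sq_map_is_additive.

Fact sq_map_is_scalable : scalable_for (h \; *:%R) f.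
Proof.
move=> a; elim/sq_ind=> x Zx /=.
rewrite sq_classZ !sq_map_class sq_classZ.
by apply: sq_class_eq; rewrite linearZ.
Qed.
HB.instance Definition _ := GRing.isScalable.Build R (subquot Z B)
  (subquot Z' B') (h \; *:%R) f sq_map_is_scalable.
End SubQuotMap.

Record lcomplex (R : comPzRingType) := LComplex {
  lc_obj :> nat -> lmodType R;
  lc_d : forall n, {linear lc_obj n -> lc_obj n.+1};
  lc_dd : forall n v, lc_d n.+1 (lc_d n v) = 0 }.

Section LCohomology.
Variables (R : comPzRingType) (C : lcomplex R).

Definition is_cocycle n (v : C n) : Prop := lc_d C n v = 0.

Definition is_coboundary n : C n -> Prop :=
  match n return C n -> Prop with
  | 0 => fun v => v = 0
  | m.+1 => fun v => exists w, lc_d C m w = v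
  end.

Fact is_cocycle0 n : is_cocycle (0 : C n).
Proof. exact: raddf0. Qed.
Fact is_cocycleD n (v w : C n) : is_cocycle v -> is_cocycle w -> is_cocycle (v + w).
Proof. by rewrite /is_cocycle linearD => -> ->; rewrite addr0. Qed.
Fact is_cocycleZ n a (v : C n) : is_cocycle v -> is_cocycle (a *: v).
Proof. by rewrite /is_cocycle linearZ /= => ->; rewrite scaler0. Qed.

Fact is_coboundary0 n : is_coboundary (0 : C n).
Proof. by case: n => //= n; exists 0; rewrite raddf0. Qed.
Fact is_coboundaryD n (v w : C n) :
  is_coboundary v -> is_coboundary w -> is_coboundary (v + w).
Proof.
case: n v w => [|n] v w /=; first by move=> -> ->; rewrite addr0.
by move=> [x <-] [y <-]; exists (x + y); rewrite raddfD.
Qed.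
Fact is_coboundaryZ n a (v : C n) : is_coboundary v -> is_coboundary (a *: v).
Proof.
case: n v => [|n] v /=; first by move=> ->; rewrite scaler0.
by move=> [x <-]; exists (a *: x); rewrite linearZ.
Qed.

Definition cocycles n : lsubmod (C n) :=
  LSubmod (@is_cocycle0 n) (@is_cocycleD n) (@is_cocycleZ n).
Definition coboundaries n : lsubmod (C n) :=
  LSubmod (@is_coboundary0 n) (@is_coboundaryD n) (@is_coboundaryZ n).

Definition lcohomology n : lmodType R := subquot (cocycles n) (coboundaries n).
End LCohomology.

Section LCohomologyMap.
Variables (R S : comPzRingType) (h : {rmorphism R -> S}).
Variables (C : lcomplex R) (D : lcomplex S).
Variable u : forall n, {linear C n -> D n | h \; *:%R}.
Hypothesis ud : forall n v, u n.+1 (lc_d C n v) = lc_d D n (u n v).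

Fact cocycles_map n v : cocycles C n v -> cocycles D n (u n v).
Proof. by rewrite /= /is_cocycle -ud => ->; rewrite raddf0. Qed.

Fact coboundaries_map n v : coboundaries C n v -> coboundaries D n (u n v).
Proof.
case: n v => [|n] v /=; first by move=> ->; rewrite raddf0.
by move=> [w <-]; exists (u n w); rewrite ud.
Qed.

Definition lcohomology_map n :
    {linear lcohomology C n -> lcohomology D n | h \; *:%R} :=
  sq_map (@cocycles_map n) (@coboundaries_map n).

Lemma lcohomology_map_class n z (Zz : cocycles C n z) :
  lcohomology_map n (sq_class _ Zz) = sq_class _ (cocycles_map Zz).
Proof. exact: sq_map_class. Qed.
End LCohomologyMap.

Definition minopen (T : topologicalType) (p : T) : set T :=
  \bigcap_(U in [set U | open U /\ U p]) U.

Definition sple (T : topologicalType) (p q : T) : Prop := minopen p q.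

Section Specialization.
Variable T : topologicalType.
Implicit Types p q r : T.

Lemma sple_refl p : sple p p.
Proof. by move=> U []. Qed.

Lemma sple_trans p q r : sple p q -> sple q r -> sple p r.
Proof. by move=> pq qr U [oU Up]; apply: qr; split => //; exact: pq. Qed.

Lemma sple_open (U : set T) p q : open U -> U p -> sple p q -> U q.
Proof. by move=> oU Up; apply. Qed.

Lemma minopen_open p : finite_set [set: T] -> open (minopen p).
Proof.
move=> finT.
pose V q := if pselect (exists U, [/\ open U, U p & ~ U q]) is left h
            then sval (cid h) else setT.
have VP q : open (V q) /\ V q p.
  rewrite /V; case: pselect => [h|_]; last by split=> //; exact: openT.
  by case: (cid h) => /= U [].
have -> : minopen p = \bigcap_(q in [set` fset_set [set: T]]) V q.
  apply/seteqP; split=> [r pr q _|r Vr U [oU Up]].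
    by have [oV Vp] := VP q; exact: (sple_open oV Vp pr).
  apply: contrapT => nUr.
  have : V r r by apply: Vr; rewrite /= in_fset_set // inE.
  rewrite /V; case: pselect => [h|[]]; last by exists U.
  by case: (cid h) => /= W [].
rewrite openE => r Vr; apply: filter_bigI => q qT.
by apply: open_nbhs_nbhs; split; [exact: (VP q).1|exact: Vr].
Qed.
End Specialization.

Lemma sple_continuous (S T : topologicalType) (f : S -> T) p q :
  continuous f -> sple p q -> sple (f p) (f q).
Proof.
move=> /continuousP cf pq U [oU Ufp].
exact: (sple_open (cf U oU) Ufp pq).
Qed.

(* A sheaf F on a finite space is the same thing as the stalks F_p = F(U_p)
   with functorial restriction maps F_p -> F_q for p <= q; its sections on an
   open U are the families (s_p in F_p) for p in U compatible with
   the restrictions.  Sheaves of k-algebras and of modules are given in this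
   form. *)
Record rfspace (k : comPzRingType) := RFSpace {
  rf_pt :> topologicalType;
  rf_finite : finite_set [set: rf_pt];
  ostalk : rf_pt -> comPzRingType;
  ores : forall p q, sple p q -> {rmorphism ostalk p -> ostalk q};
  ores_id : forall p (h : sple p p) a, ores h a = a;
  ores_comp : forall p q r (pq : sple p q) (qr : sple q r) (pr : sple p r) a,
    ores qr (ores pq a) = ores pr a;
  ostr : forall p, {rmorphism k -> ostalk p};
  ores_str : forall p q (h : sple p q) c, ores h (ostr p c) = ostr q c }.

Lemma ores_irr (k : comPzRingType) (X : rfspace k) (p q : X) (h h' : sple p q) a :
  ores h a = ores h' a.
Proof. by rewrite (Prop_irrelevance h h'). Qed.

Record rfmor (k : comPzRingType) (X Y : rfspace k) := RFMor {
  rf_fun :> X -> Y;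
  rf_cont : continuous rf_fun;
  rf_sharp : forall x, {rmorphism ostalk (rf_fun x) -> ostalk x};
  rf_sharp_res : forall x x' (h : sple x x') a,
    rf_sharp x' (ores (sple_continuous rf_cont h) a) = ores h (rf_sharp x a);
  rf_sharp_str : forall x c, rf_sharp x (ostr (rf_fun x) c) = ostr x c }.

Definition finite_space (k : comPzRingType) (X : rfspace k) : Prop :=
  forall (p q : X) (h : sple p q), flat_rmorphism (ores h).

Section OpenSubspace.
Variables (k : comPzRingType) (X : rfspace k) (U : set X).

Fact osub_finite : finite_set [set: set_type U].
Proof.
have := @finite_preimage _ _ [set: X] (fun x : set_type U => \val x).
by rewrite preimage_setT; apply; [move=> ? ? _ _; exact: val_inj|exact: rf_finite].
Qed.

Fact osub_sple (p q : set_type U) : sple p q -> sple (\val p) (\val q).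
Proof.
move=> pq V [oV Vp]; apply: (pq ((fun x : set_type U => \val x) @^-1` V)).
by split=> //; exists V.
Qed.

Definition osub_res p q (h : sple p q) := ores (osub_sple h).

Fact osub_res_id p (h : sple p p) a : osub_res h a = a.
Proof. exact: ores_id. Qed.
Fact osub_res_comp p q r (pq : sple p q) (qr : sple q r) (pr : sple p r) a :
  osub_res qr (osub_res pq a) = osub_res pr a.
Proof. exact: ores_comp. Qed.
Fact osub_res_str p q (h : sple p q) c :
  osub_res h (ostr (\val p) c) = ostr (\val q) c.
Proof. exact: ores_str. Qed.

(* the openness of U is what makes the stalks of O|U those of O *)
Definition open_subspace of open U : rfspace k :=
  RFSpace osub_finite osub_res_id osub_res_comp osub_res_str.
End OpenSubspace.

Section Product.
Variables (k : comPzRingType) (X Y : rfspace k).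

Fact prod_finite : finite_set [set: X * Y].
Proof. by rewrite -setXTT; apply: finite_setX; exact: rf_finite. Qed.

Fact sple_fst (p q : X * Y) : sple p q -> sple p.1 q.1.
Proof. by apply: sple_continuous; move=> x; exact: cvg_fst. Qed.
Fact sple_snd (p q : X * Y) : sple p q -> sple p.2 q.2.
Proof. by apply: sple_continuous; move=> x; exact: cvg_snd. Qed.

Definition prod_stalk (p : X * Y) : comPzRingType :=
  tensor_alg (ostr p.1) (ostr p.2).

Section Res.
Variables (p q : X * Y) (h : sple p q).

Definition prod_res_l : {rmorphism ostalk p.1 -> prod_stalk q} :=
  @tinl _ _ _ (ostr q.1) (ostr q.2) \o ores (sple_fst h).
Definition prod_res_r : {rmorphism ostalk p.2 -> prod_stalk q} :=
  @tinr _ _ _ (ostr q.1) (ostr q.2) \o ores (sple_snd h).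

Fact prod_res_lr c : prod_res_l (ostr p.1 c) = prod_res_r (ostr p.2 c).
Proof. by rewrite /= !ores_str tin_scal. Qed.

Definition prod_res : {rmorphism prod_stalk p -> prod_stalk q} :=
  tcopair prod_res_lr.

Lemma prod_resE a b :
  prod_res (tpure _ _ a b) = tpure _ _ (ores (sple_fst h) a) (ores (sple_snd h) b).
Proof.
by rewrite [LHS]tcopairE /= [LHS]tpureM mulr1 mul1r.
Qed.
End Res.

Fact prod_res_id p (h : sple p p) a : prod_res h a = a.
Proof.
elim/tpure_ind: a => [|x y IHx IHy|a b]; first exact: rmorph0.
  by rewrite rmorphD IHx IHy.
by rewrite prod_resE !ores_id.
Qed.

Fact prod_res_comp p q r (pq : sple p q) (qr : sple q r) (pr : sple p r) a :
  prod_res qr (prod_res pq a) = prod_res pr a.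
Proof.
elim/tpure_ind: a => [|x y IHx IHy|a b]; first by rewrite !rmorph0.
  by rewrite !rmorphD IHx IHy.
by rewrite !prod_resE !(ores_comp _ _ (sple_fst pr), ores_comp _ _ (sple_snd pr)).
Qed.

Definition prod_str (p : X * Y) : {rmorphism k -> prod_stalk p} :=
  @tinl _ _ _ (ostr p.1) (ostr p.2) \o ostr p.1.

Fact prod_res_str p q (h : sple p q) c : prod_res h (prod_str p c) = prod_str q c.
Proof. by rewrite /= /tinl prod_resE ores_str rmorph1. Qed.

Definition rfprod : rfspace k :=
  @RFSpace k (X * Y)%type prod_finite prod_stalk prod_res prod_res_id
    prod_res_comp prod_str prod_res_str.
End Product.

Section Diagonal.
Variables (k : comPzRingType) (X : rfspace k).

Definition diag_fun (x : X) : rfprod X X := (x, x).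

Fact diag_cont : continuous diag_fun.
Proof. by move=> x; apply: cvg_pair; exact: cvg_id. Qed.

Fact diag_sharp_lr (x : X) c :
  (idfun : {rmorphism ostalk x -> ostalk x}) (ostr x c) =
  (idfun : {rmorphism ostalk x -> ostalk x}) (ostr x c).
Proof. by []. Qed.

Definition diag_sharp (x : X) : {rmorphism ostalk (diag_fun x) -> ostalk x} :=
  tcopair (@diag_sharp_lr x).

Fact diag_sharpE x a b : diag_sharp x (tpure _ _ a b) = a * b.
Proof. exact: tcopairE. Qed.

Fact diag_sharp_res x x' (h : sple x x') a :
  diag_sharp x' (ores (sple_continuous diag_cont h) a) = ores h (diag_sharp x a).
Proof.
elim/tpure_ind: a => [|y z IHy IHz|a b]; first by rewrite !rmorph0.
  by rewrite !rmorphD IHy IHz.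
rewrite [X in diag_sharp x' X]prod_resE !diag_sharpE rmorphM.
exact: (f_equal2 *%R (ores_irr _ h a) (ores_irr _ h b)).
Qed.

Fact diag_sharp_str x c : diag_sharp x (ostr (diag_fun x) c) = ostr x c.
Proof. by rewrite [LHS]diag_sharpE mulr1. Qed.

Definition diagonal_mor : rfmor X (rfprod X X) :=
  RFMor diag_sharp_res diag_sharp_str.
End Diagonal.

Record omodule (k : comPzRingType) (X : rfspace k) := OModule {
  mstalk : forall p : X, lmodType (ostalk p);
  mres : forall (p q : X) (h : sple p q),
    {linear mstalk p -> mstalk q | ores h \; *:%R};
  mres_id : forall p (h : sple p p) v, mres h v = v;
  mres_comp : forall p q r (pq : sple p q) (qr : sple q r) (pr : sple p r) v,
    mres qr (mres pq v) = mres pr v }.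

Record omor (k : comPzRingType) (X : rfspace k) (M N : omodule X) := OMor {
  om_fun :> forall p : X, {linear mstalk M p -> mstalk N p};
  om_res : forall p q (h : sple p q) v,
    om_fun q (mres M h v) = mres N h (om_fun p v) }.

Section StructureModule.
Variables (k : comPzRingType) (X : rfspace k).

Section Res.
Variables (p q : X) (h : sple p q).
Definition struct_res (a : (ostalk p)^o) : (ostalk q)^o := ores h a.
Fact struct_res_is_additive : zmod_morphism struct_res.
Proof. exact: rmorphB. Qed.
HB.instance Definition _ := GRing.isZmodMorphism.Build (ostalk p)^o (ostalk q)^o
  struct_res struct_res_is_additive.
Fact struct_res_is_scalable : scalable_for (ores h \; *:%R) struct_res.
Proof. exact: rmorphM. Qed.
HB.instance Definition _ := GRing.isScalable.Build (ostalk p) (ostalk p)^o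
  (ostalk q)^o (ores h \; *:%R) struct_res struct_res_is_scalable.
End Res.

Definition struct_module : omodule X :=
  @OModule k X (fun p => (ostalk p)^o) (fun p q h => struct_res h)
    (@ores_id k X) (@ores_comp k X).
End StructureModule.

Section FreeModule.
Variables (k : comPzRingType) (X : rfspace k) (I : Type).

Definition free_res (p q : X) (h : sple p q) :
  {linear finsupp I (ostalk p) -> finsupp I (ostalk q) | ores h \; *:%R} :=
  fs_map (ores h).

Fact free_res_id (p : X) (h : sple p p) v : free_res h v = v.
Proof. by apply: finsuppP => i; exact: ores_id. Qed.
Fact free_res_comp (p q r : X) (pq : sple p q) (qr : sple q r) (pr : sple p r) v :
  free_res qr (free_res pq v) = free_res pr v.
Proof. by apply: finsuppP => i; exact: ores_comp. Qed.

Definition free_module : omodule X := OModule free_res_id free_res_comp.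
End FreeModule.

Section RestrictModule.
Variables (k : comPzRingType) (X : rfspace k) (M : omodule X) (U : set X).
Variable oU : open U.
Local Notation XU := (open_subspace oU).

Definition mrestr_res (p q : XU) (h : sple p q) :
    {linear mstalk M (\val p) -> mstalk M (\val q) | ores h \; *:%R} :=
  mres M (osub_sple h).

Fact mrestr_res_id (p : XU) (h : sple p p) v : mrestr_res h v = v.
Proof. exact: mres_id. Qed.
Fact mrestr_res_comp (p q r : XU) (pq : sple p q) (qr : sple q r)
    (pr : sple p r) v :
  mrestr_res qr (mrestr_res pq v) = mrestr_res pr v.
Proof. exact: mres_comp. Qed.

Definition mrestr : omodule XU :=
  @OModule k XU (fun p => mstalk M (\val p)) mrestr_res mrestr_res_id mrestr_res_comp.
End RestrictModule.

Definition is_cokernel (k : comPzRingType) (X : rfspace k) (M L N : omodule X)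
    (u : omor M L) (v : omor L N) : Prop :=
  forall p, (forall z, exists y, v p y = z) /\
    (forall y, v p y = 0 <-> exists x, u p x = y).

Definition quasi_coherent (k : comPzRingType) (X : rfspace k) (M : omodule X) :
    Prop :=
  forall p : X, exists (U : set X) (oU : open U), U p /\
    exists (I J : Type)
      (u : omor (free_module (open_subspace oU) I) (free_module (open_subspace oU) J))
      (v : omor (free_module (open_subspace oU) J) (mrestr M oU)),
      is_cokernel u v.

(* Only meaningful for U open, where it is O(U); likewise [msect] below. *)
Record osect (k : comPzRingType) (X : rfspace k) (U : set X) := OSect {
  os_val :> forall p : X, U p -> ostalk p;
  os_res : forall p q (up : U p) (uq : U q) (h : sple p q),
    ores h (os_val up) = os_val uq }.

Section SectionRing.
Variables (k : comPzRingType) (X : rfspace k) (U : set X).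
Implicit Types s t : osect U.

Lemma osectP s t : (forall p (up : U p), s p up = t p up) -> s = t.
Proof.
case: s t => [s hs] [t ht] /= e.
have st : s = t by apply: functional_extensionality_dep => p; apply/funext=> up.
by subst t; rewrite (Prop_irrelevance hs ht).
Qed.

HB.instance Definition _ := gen_eqMixin (osect U).
HB.instance Definition _ := gen_choiceMixin (osect U).

Definition os_zero : osect U.
Proof. by exists (fun p _ => 0) => p q *; rewrite rmorph0. Defined.
Definition os_one : osect U.
Proof. by exists (fun p _ => 1) => p q *; rewrite rmorph1. Defined.
Definition os_opp s : osect U.
Proof.
by exists (fun p up => - s p up) => p q up uq h; rewrite rmorphN (os_res s up uq).
Defined.
Definition os_add s t : osect U.
Proof.
exists (fun p up => s p up + t p up) => p q up uq h.
by rewrite rmorphD (os_res s up uq) (os_res t up uq).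
Defined.
Definition os_mul s t : osect U.
Proof.
exists (fun p up => s p up * t p up) => p q up uq h.
by rewrite rmorphM (os_res s up uq) (os_res t up uq).
Defined.

Fact os_addA : associative os_add.
Proof. by move=> s t u; apply: osectP => p up /=; rewrite addrA. Qed.
Fact os_addC : commutative os_add.
Proof. by move=> s t; apply: osectP => p up /=; rewrite addrC. Qed.
Fact os_add0 : left_id os_zero os_add.
Proof. by move=> s; apply: osectP => p up /=; rewrite add0r. Qed.
Fact os_addN : left_inverse os_zero os_opp os_add.
Proof. by move=> s; apply: osectP => p up /=; rewrite addNr. Qed.
HB.instance Definition _ :=
  GRing.isZmodule.Build (osect U) os_addA os_addC os_add0 os_addN.

Fact os_mulA : associative os_mul.
Proof. by move=> s t u; apply: osectP => p up /=; rewrite mulrA. Qed.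
Fact os_mulC : commutative os_mul.
Proof. by move=> s t; apply: osectP => p up /=; rewrite mulrC. Qed.
Fact os_mul1 : left_id os_one os_mul.
Proof. by move=> s; apply: osectP => p up /=; rewrite mul1r. Qed.
Fact os_mulDl : left_distributive os_mul +%R.
Proof. by move=> s t u; apply: osectP => p up /=; rewrite mulrDl. Qed.
HB.instance Definition _ := GRing.Zmodule_isComPzRing.Build (osect U)
  os_mulA os_mulC os_mul1 os_mulDl.
End SectionRing.

Record msect (k : comPzRingType) (X : rfspace k) (M : omodule X) (U : set X) :=
  MSect {
  ms_val :> forall p : X, U p -> mstalk M p;
  ms_res : forall p q (up : U p) (uq : U q) (h : sple p q),
    mres M h (ms_val up) = ms_val uq }.

Section SectionModule.
Variables (k : comPzRingType) (X : rfspace k) (M : omodule X) (U : set X).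
Implicit Types s t : msect M U.

Lemma msectP s t : (forall p (up : U p), s p up = t p up) -> s = t.
Proof.
case: s t => [s hs] [t ht] /= e.
have st : s = t by apply: functional_extensionality_dep => p; apply/funext=> up.
by subst t; rewrite (Prop_irrelevance hs ht).
Qed.

HB.instance Definition _ := gen_eqMixin (msect M U).
HB.instance Definition _ := gen_choiceMixin (msect M U).

Definition ms_zero : msect M U.
Proof. by exists (fun p _ => 0) => p q *; rewrite raddf0. Defined.
Definition ms_opp s : msect M U.
Proof.
by exists (fun p up => - s p up) => p q up uq h; rewrite linearN /= (ms_res s up uq).
Defined.
Definition ms_add s t : msect M U.
Proof.
exists (fun p up => s p up + t p up) => p q up uq h.
by rewrite linearD /= (ms_res s up uq) (ms_res t up uq).
Defined.
Definition ms_scale (a : osect U) s : msect M U.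
Proof.
exists (fun p up => a p up *: s p up) => p q up uq h.
by rewrite linearZ /= (ms_res s up uq) (os_res a up uq).
Defined.

Fact ms_addA : associative ms_add.
Proof. by move=> s t u; apply: msectP => p up /=; rewrite addrA. Qed.
Fact ms_addC : commutative ms_add.
Proof. by move=> s t; apply: msectP => p up /=; rewrite addrC. Qed.
Fact ms_add0 : left_id ms_zero ms_add.
Proof. by move=> s; apply: msectP => p up /=; rewrite add0r. Qed.
Fact ms_addN : left_inverse ms_zero ms_opp ms_add.
Proof. by move=> s; apply: msectP => p up /=; rewrite addNr. Qed.
HB.instance Definition _ :=
  GRing.isZmodule.Build (msect M U) ms_addA ms_addC ms_add0 ms_addN.

Fact ms_scaleA a b s : ms_scale a (ms_scale b s) = ms_scale (a * b) s.
Proof. by apply: msectP => p up /=; rewrite scalerA. Qed.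
Fact ms_scale1 : left_id 1 ms_scale.
Proof. by move=> s; apply: msectP => p up /=; rewrite scale1r. Qed.
Fact ms_scaleDr : right_distributive ms_scale +%R.
Proof. by move=> a s t; apply: msectP => p up /=; rewrite scalerDr. Qed.
Fact ms_scaleDl s : {morph ms_scale^~ s : a b / a + b}.
Proof. by move=> a b; apply: msectP => p up /=; rewrite scalerDl. Qed.
HB.instance Definition _ := GRing.Zmodule_isLmodule.Build (osect U) (msect M U)
  ms_scaleA ms_scale1 ms_scaleDr ms_scaleDl.
End SectionModule.

Section SectionMap.
Variables (k : comPzRingType) (X : rfspace k) (M N : omodule X) (u : omor M N).
Variable U : set X.

Definition msect_map (s : msect M U) : msect N U.
Proof.
exists (fun p up => u p (s p up)) => p q up uq h.
by rewrite -om_res (ms_res s up uq).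
Defined.

Fact msect_map_is_additive : zmod_morphism msect_map.
Proof. by move=> s t; apply: msectP => p up /=; rewrite raddfB. Qed.
HB.instance Definition _ := GRing.isZmodMorphism.Build (msect M U) (msect N U)
  msect_map msect_map_is_additive.
Fact msect_map_is_scalable : scalable msect_map.
Proof. by move=> a s; apply: msectP => p up /=; rewrite linearZ. Qed.
HB.instance Definition _ := GRing.isScalable.Build (osect U) (msect M U)
  (msect N U) *:%R msect_map msect_map_is_scalable.
End SectionMap.

Section DirectImage.
Variables (k : comPzRingType) (X Y : rfspace k) (f : rfmor X Y).

Definition fiber_open (y : Y) : set X := f @^-1` minopen y.

Lemma fiber_open_open y : open (fiber_open y).
Proof.
by have /continuousP := @rf_cont _ _ _ f; apply; apply: minopen_open; exact: rf_finite.
Qed.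

Section Scalars.
Variable y : Y.

Definition pull_sect (a : ostalk y) : osect (fiber_open y).
Proof.
exists (fun x (yx : sple y (f x)) => rf_sharp f x (ores yx a)) => x x' yx yx' h.
by rewrite -rf_sharp_res (ores_comp _ _ yx').
Defined.

Fact pull_sect_is_additive : zmod_morphism pull_sect.
Proof. by move=> a b; apply: osectP => x yx /=; rewrite !rmorphB. Qed.
HB.instance Definition _ := GRing.isZmodMorphism.Build (ostalk y)
  (osect (fiber_open y)) pull_sect pull_sect_is_additive.
Fact pull_sect_is_multiplicative : monoid_morphism pull_sect.
Proof.
split=> [|a b]; apply: osectP => x yx /=; first by rewrite !rmorph1.
by rewrite !rmorphM.
Qed.
HB.instance Definition _ := GRing.isMonoidMorphism.Build (ostalk y)
  (osect (fiber_open y)) pull_sect pull_sect_is_multiplicative.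
End Scalars.

Section Module.
Variable M : omodule X.

Definition dimage_stalk (y : Y) : lmodType (ostalk y) :=
  rscal (@pull_sect y) (msect M (fiber_open y)).

Section Res.
Variables (y y' : Y) (h : sple y y').

Definition dimage_res (s : dimage_stalk y) : dimage_stalk y'.
Proof.
exists (fun x (yx : sple y' (f x)) => ms_val s (sple_trans h yx)) => x x' yx yx' hx.
exact: ms_res.
Defined.

Fact dimage_res_is_additive : zmod_morphism dimage_res.
Proof. by move=> s t; apply: msectP. Qed.
HB.instance Definition _ := GRing.isZmodMorphism.Build (dimage_stalk y)
  (dimage_stalk y') dimage_res dimage_res_is_additive.
Fact dimage_res_is_scalable : scalable_for (ores h \; *:%R) dimage_res.
Proof.
move=> a s; apply: msectP => x yx /=.
by rewrite (ores_comp _ _ (sple_trans h yx)).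
Qed.
HB.instance Definition _ := GRing.isScalable.Build (ostalk y) (dimage_stalk y)
  (dimage_stalk y') (ores h \; *:%R) dimage_res dimage_res_is_scalable.
End Res.

Fact dimage_res_id y (h : sple y y) s : dimage_res h s = s.
Proof.
apply: msectP => x yx /=; congr (ms_val s _); exact: Prop_irrelevance.
Qed.
Fact dimage_res_comp y y' y2 (h : sple y y') (h' : sple y' y2) (h2 : sple y y2) s :
  dimage_res h' (dimage_res h s) = dimage_res h2 s.
Proof.
apply: msectP => x yx /=; congr (ms_val s _); exact: Prop_irrelevance.
Qed.

Definition dimage : omodule Y := OModule dimage_res_id dimage_res_comp.
End Module.

Section Map.
Variables (M N : omodule X) (u : omor M N).

Definition dimage_map_fun (y : Y) : mstalk (dimage M) y -> mstalk (dimage N) y :=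
  msect_map u (U := fiber_open y).

Fact dimage_map_is_additive y : zmod_morphism (dimage_map_fun (y := y)).
Proof. exact: (raddfB (msect_map u (U := fiber_open y))). Qed.
HB.instance Definition _ y := GRing.isZmodMorphism.Build (mstalk (dimage M) y)
  (mstalk (dimage N) y) (@dimage_map_fun y) (@dimage_map_is_additive y).
Fact dimage_map_is_scalable y : scalable (dimage_map_fun (y := y)).
Proof. by move=> a s; apply: msectP => x yx /=; rewrite linearZ. Qed.
HB.instance Definition _ y := GRing.isScalable.Build (ostalk y)
  (mstalk (dimage M) y) (mstalk (dimage N) y) *:%R (@dimage_map_fun y)
  (@dimage_map_is_scalable y).

Definition dimage_map : omor (dimage M) (dimage N).
Proof.
exists (fun y => (@dimage_map_fun y : {linear _ -> _})) => y y' h s.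
exact: msectP.
Defined.
End Map.
End DirectImage.

Record ocomplex (k : comPzRingType) (X : rfspace k) := OComplex {
  oc_obj :> nat -> omodule X;
  oc_d : forall n, omor (oc_obj n) (oc_obj n.+1);
  oc_dd : forall n p v, oc_d n.+1 p (oc_d n p v) = 0 }.

Definition stalk_complex (k : comPzRingType) (X : rfspace k) (C : ocomplex X)
    (p : X) : lcomplex (ostalk p) :=
  @LComplex _ (fun n => mstalk (C n) p) (fun n => oc_d C n p)
    (fun n => @oc_dd _ _ C n p).

Section CohomologyModule.
Variables (k : comPzRingType) (X : rfspace k) (C : ocomplex X) (n : nat).

Definition ocoh_res (p q : X) (h : sple p q) :
    {linear lcohomology (stalk_complex C p) n -> lcohomology (stalk_complex C q) n
      | ores h \; *:%R} :=
  @lcohomology_map _ _ (ores h) (stalk_complex C p) (stalk_complex C q)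
    (fun n => mres (C n) h) (fun n v => esym (om_res (oc_d C n) h v)) n.

Fact ocoh_res_id p (h : sple p p) v : ocoh_res h v = v.
Proof.
elim/sq_ind: v => z Zz; rewrite [LHS]lcohomology_map_class.
by apply: sq_class_eq; rewrite mres_id.
Qed.
Fact ocoh_res_comp p q r (pq : sple p q) (qr : sple q r) (pr : sple p r) v :
  ocoh_res qr (ocoh_res pq v) = ocoh_res pr v.
Proof.
elim/sq_ind: v => z Zz; rewrite /ocoh_res !lcohomology_map_class.
by apply: sq_class_eq; rewrite (mres_comp _ _ pr).
Qed.

Definition ocohomology : omodule X := OModule ocoh_res_id ocoh_res_comp.
End CohomologyModule.

Section SectComplex.
Variables (k : comPzRingType) (X : rfspace k) (C : ocomplex X) (U : set X).

Fact sect_complex_dd n (s : msect (C n) U) :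
  msect_map (oc_d C n.+1) (msect_map (oc_d C n) s) = 0.
Proof. by apply: msectP => p up /=; rewrite oc_dd. Qed.

Definition sect_complex : lcomplex (osect U) :=
  @LComplex _ (fun n => msect (C n) U)
    (fun n => (msect_map (oc_d C n) (U := U) : {linear _ -> _})) sect_complex_dd.
End SectComplex.

Section DimageComplex.
Variables (k : comPzRingType) (X Y : rfspace k) (f : rfmor X Y) (C : ocomplex X).

Fact dimage_complex_dd n y (s : mstalk (dimage f (C n)) y) :
  dimage_map f (oc_d C n.+1) y (dimage_map f (oc_d C n) y s) = 0.
Proof. exact: sect_complex_dd. Qed.

Definition dimage_complex : ocomplex Y :=
  @OComplex _ Y (fun n => dimage f (C n)) (fun n => dimage_map f (oc_d C n))
    dimage_complex_dd.
End DimageComplex.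

Definition omono (k : comPzRingType) (X : rfspace k) (M N : omodule X)
  (u : omor M N) : Prop := forall p, injective (u p).

Definition injective_omodule (k : comPzRingType) (X : rfspace k) (E : omodule X) :
    Prop :=
  forall (M N : omodule X) (u : omor M N) (g : omor M E), omono u ->
    exists h : omor N E, forall p v, h p (u p v) = g p v.

Record injective_resolution (k : comPzRingType) (X : rfspace k) (F : omodule X) :=
  InjRes {
  ir_cpx :> ocomplex X;
  ir_inj : forall n, injective_omodule (ir_cpx n);
  ir_aug : omor F (ir_cpx 0);
  ir_aug_mono : omono ir_aug;
  ir_exact0 : forall p v, oc_d ir_cpx 0 p v = 0 <-> exists w, ir_aug p w = v;
  ir_exact : forall n p v,
    oc_d ir_cpx n.+1 p v = 0 <-> exists w, oc_d ir_cpx n p w = v }.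

(* The right derived functors of Gamma(X, -) and of f_* are computed on an
   injective resolution; up to isomorphism the result does not depend on it, so
   the two predicates below say that H^n(X, F), resp. R^n f_* F, has the
   isomorphism-invariant property P. *)
Definition cohomology_has (k : comPzRingType) (X : rfspace k) (F : omodule X)
    (n : nat) (P : lmodType (osect [set: X]) -> Prop) : Prop :=
  exists I : injective_resolution F, P (lcohomology (sect_complex I [set: X]) n).

Definition higher_dimage_has (k : comPzRingType) (X Y : rfspace k)
    (f : rfmor X Y) (F : omodule X) (n : nat) (P : omodule Y -> Prop) : Prop :=
  exists I : injective_resolution F, P (ocohomology (dimage_complex f I) n).

Definition lmod_zero (R : comPzRingType) (V : lmodType R) : Prop :=
  forall v : V, v = 0.

Definition omodule_zero (k : comPzRingType) (X : rfspace k) (M : omodule X) : Prop :=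
  forall p (v : mstalk M p), v = 0.

Definition schematic (k : comPzRingType) (X : rfspace k) : Prop :=
  forall i, higher_dimage_has (diagonal_mor X) (struct_module X) i
              (@quasi_coherent k (rfprod X X)).

Definition semi_separated (k : comPzRingType) (X : rfspace k) : Prop :=
  quasi_coherent (dimage (diagonal_mor X) (struct_module X)) /\
  forall i, (0 < i)%N ->
    higher_dimage_has (diagonal_mor X) (struct_module X) i
      (@omodule_zero k (rfprod X X)).

(* Gamma(X, -) : Qcoh(X) -> Mod(A), with A = O(X), is full, faithful and
   essentially surjective. *)
Definition global_sections_equivalence (k : comPzRingType) (X : rfspace k) : Prop :=
  (forall M N : omodule X, quasi_coherent M -> quasi_coherent N ->
    forall g : {linear msect M [set: X] -> msect N [set: X]},
      (exists u : omor M N, forall s, msect_map u s = g s) /\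
      (forall u u' : omor M N, (forall s, msect_map u (U := [set: X]) s = g s) ->
        (forall s, msect_map u' (U := [set: X]) s = g s) ->
        forall p v, u p v = u' p v)) /\
  (forall N : lmodType (osect [set: X]),
    exists2 M : omodule X, quasi_coherent M &
      exists g : {linear msect M [set: X] -> N}, bijective g).

Definition affine_space (k : comPzRingType) (X : rfspace k) : Prop :=
  (forall i, (0 < i)%N ->
    cohomology_has (struct_module X) i (@lmod_zero (osect [set: X]))) /\
  global_sections_equivalence X.

(* Meaningful for a schematic morphism between schematic finite spaces, such as
   the diagonal of a schematic finite space. *)
Definition affine_morphism (k : comPzRingType) (X Y : rfspace k) (f : rfmor X Y) :
    Prop :=
  forall y : Y, affine_space (open_subspace (fiber_open_open f y)).

(* Main.v *)
Require Import Defs.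
From mathcomp Require Import all_boot all_algebra.
From HB Require Import structures.
From mathcomp Require Import all_classical.
From mathcomp Require Import topology_structure product_topology subtype_topology.

Set Implicit Arguments.
Unset Strict Implicit.
Unset Printing Implicit Defensive.

Import GRing.Theory.
Local Open Scope ring_scope.
Local Open Scope classical_set_scope.

(* For p, q in X put U = U_p n U_q and B = O(U); the fibre of the diagonal over (p, q)
   is U, so R^i delta_* O has stalk H^i(U, O) there.  If the diagonal is affine these
   groups vanish for i > 0, and delta_* O is quasi-coherent because X is schematic.

   Conversely, suppose X is semi-separated.  Quasi-coherence of delta_* O gives
   O_z (x)_(O_p) O_x = O(U_x n U_z) for x, z in U, and O_x (x)_(O_p) B = O_x.  The
   vanishing of H^i(U_x n U_z, O), transported from injective resolutions to an iterated
   flasque resolution whose terms are finite products of stalks, gives a finite exact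
   complex of flat modules resolving O(U_x n U_z); it stays exact after any tensor
   product, hence O_z (x)_(O_p) M_x = Gamma(U_x n U_z, M) for M quasi-coherent on U.
   Writing Gamma(U, M) as a finite limit of the M_x and tensoring with the flat
   O_p-algebra O_z yields O_z (x)_(O_p) Gamma(U, M) = M_z, so Gamma(U, -) is fully
   faithful.  For a B-module N the same exactness gives
   Gamma(U, O (x)_(O_p) N) = B (x)_(O_p) N, and this is N because O_p -> B is an
   epimorphism of rings. *)

(** * Tensor products *)

(** Why the base ring is O_p: the flatness hypothesis concerns the restrictions O_p -> O_w and says
    nothing directly about B -> O_w. All tensor products are therefore taken over O_p, and B-modules
    return only through the epimorphism O_p -> B. Why injective resolutions are left behind: the
    definitions supply a resolution for each degree, and on each open subspace, separately.
    Vanishing is translated into [acyc n], which mentions no resolution, so it can be carried from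
    one resolution to another. Resolutions on open subspaces are restrictions of those on X;
    injectivity survives because restriction has an exact left adjoint, extension by zero. Why
    [acyc] is built on D -> [god D] -> [cok D]: at each point the embedding splits, so [cok]
    preserves flatness, and on a finite poset the iterates of [cok] reach 0. Hence the sections of D
    are obtained from 0 by finitely many kernels of surjections between flat modules, and such
    kernels are flat. *)

Section MakeLinear.
Variables (R : pzRingType) (U : lmodType R) (V : zmodType) (s : GRing.Scale.law R V).

(** The linearity proof is kept as an argument so that the structure can be inferred from the term;
    this allows linear maps to be built inside proofs and under local hypotheses. *)
Definition mklin (f : U -> V) of linear_for s f := f.
HB.instance Definition _ f (h : linear_for s f) :=
  GRing.isLinear.Build R U V s (mklin h) h.
End MakeLinear.

Definition mkadd (U V : zmodType) (f : U -> V) of zmod_morphism f := f.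
HB.instance Definition _ U V f (h : zmod_morphism f) :=
  GRing.isZmodMorphism.Build U V (@mkadd U V f h) h.

Definition balanced (R : comPzRingType) (M N : lmodType R) (Z : zmodType)
    (b : M -> N -> Z) : Prop :=
  [/\ forall n, {morph b^~ n : x y / x + y},
      forall m, {morph b m : x y / x + y} &
      forall c m n, b (c *: m) n = b m (c *: n)].

Section TensorLift.
Variables (R : comPzRingType) (M N : lmodType R) (Z : zmodType).

Definition tbil (b : M -> N -> Z) of balanced b : tensor M N -> Z := tens_lift b.

Section One.
Variables (b : M -> N -> Z) (hb : balanced b).

Lemma tbilE m n : tbil hb (tens m n) = b m n.
Proof. by case: hb => *; exact: tens_liftE. Qed.

Fact tbil_is_additive : zmod_morphism (tbil hb).
Proof.
case: hb => hl hr hz x y; apply: (addIr (tens_lift b y)); rewrite -tens_liftD //.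
by rewrite !subrK.
Qed.
HB.instance Definition _ := GRing.isZmodMorphism.Build (tensor M N) Z (tbil hb)
  tbil_is_additive.
End One.
End TensorLift.

(** For goals additive in [x]: zero and sums are closed by additivity, and a pure tensor remains. *)
Ltac tens_elim x := elim/tens_ind: x => [|? ? + +|? ?];
  [by rewrite ?raddf0|by rewrite ?raddfD /= => -> ->; rewrite ?addr0|].

Section TensorMap.
Variable R : comPzRingType.
Implicit Types M N L : lmodType R.

Lemma tens0l M N n : tens (0 : M) (n : N) = 0.
Proof. by apply: (addIr (tens 0 n)); rewrite -tensDl !add0r. Qed.

Lemma tens0r M N m : tens (m : M) (0 : N) = 0.
Proof. by apply: (addIr (tens m 0)); rewrite -tensDr !add0r. Qed.

Lemma tensBl M N (m m' : M) (n : N) : tens (m - m') n = tens m n - tens m' n.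
Proof. by apply: (addIr (tens m' n)); rewrite -tensDl !subrK. Qed.

Lemma tensBr M N (m : M) (n n' : N) : tens m (n - n') = tens m n - tens m n'.
Proof. by apply: (addIr (tens m n')); rewrite -tensDr !subrK. Qed.

Fact tmap_balanced M M' N N' (u : {linear M -> M'}) (v : {linear N -> N'}) :
  balanced (fun m n => tens (u m) (v n)).
Proof.
split=> [n x y|m x y|c m n] /=; first by rewrite linearD tensDl.
  by rewrite linearD tensDr.
by rewrite !linearZ /= tensZ.
Qed.

Definition tmap M M' N N' (u : {linear M -> M'}) (v : {linear N -> N'}) :
  tensor M N -> tensor M' N' := tbil (tmap_balanced u v).
HB.instance Definition _ M M' N N' u v :=
  GRing.Additive.on (@tmap M M' N N' u v).

Lemma tmapE M M' N N' (u : {linear M -> M'}) (v : {linear N -> N'}) m n :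
  tmap u v (tens m n) = tens (u m) (v n).
Proof. exact: tbilE. Qed.

Fact tswap_balanced M N : balanced (fun (m : M) (n : N) => tens n m).
Proof.
by split=> [n x y|m x y|c m n]; rewrite ?tensDl ?tensDr ?tensZ.
Qed.
Definition tswap M N : tensor M N -> tensor N M := tbil (tswap_balanced M N).
HB.instance Definition _ M N := GRing.Additive.on (@tswap M N).

Lemma tswapE M N m n : @tswap M N (tens m n) = tens n m.
Proof. exact: tbilE. Qed.

Lemma tswapK M N : cancel (@tswap M N) (@tswap N M).
Proof. by move=> x; tens_elim x; rewrite !tswapE. Qed.

Lemma tswap_tmap M M' N N' (u : {linear M -> M'}) (v : {linear N -> N'}) x :
  tswap (tmap u v x) = tmap v u (tswap x).
Proof. by tens_elim x; rewrite tswapE !tmapE tswapE. Qed.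

(** For K = [rscal f B^o] this is convertible to [flat_rmorphism f]. The notion is needed for
    modules because cokernels of diagrams of rings are no longer rings. *)
Definition flat_module (K : lmodType R) :=
  forall (M N : lmodType R) (u : {linear M -> N}),
    injective u -> injective (tmap (M := K) idfun u).

Lemma tmap_eq0_inj M N (Z : zmodType) (f : {additive tensor M N -> Z}) :
  (forall x, f x = 0 -> x = 0) -> injective f.
Proof. by move=> h x y e; apply/eqP; rewrite -subr_eq0; apply/eqP/h; rewrite raddfB e subrr. Qed.

Definition exact_at (A B C : zmodType) (u : A -> B) (v : B -> C) :=
  forall y, v y = 0 <-> exists x, u x = y.

Definition onto (A B : Type) (f : A -> B) := forall y, exists x, f x = y.

Lemma tmap_onto M M' N N' (u : {linear M -> M'}) (v : {linear N -> N'}) :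
  onto u -> onto v -> onto (tmap u v).
Proof.
move=> su sv y; elim/tens_ind: y => [|_ _ [x <-] [y <-]|m' n'].
- by exists 0; rewrite raddf0.
- by exists (x + y); rewrite raddfD.
- have [m <-] := su m'; have [n <-] := sv n'.
  by exists (tens m n); rewrite tmapE.
Qed.

(* A set-theoretic section of [v] lifts each generator of the congruence defining
   the tensor product to a difference lying in the image of [tmap idfun u]. *)
Lemma tmapr_exact (S M L N : lmodType R) (u : {linear M -> L}) (v : {linear L -> N}) :
  exact_at u v -> onto v ->
  exact_at (tmap (M := S) idfun u) (tmap (M := S) idfun v).
Proof.
move=> uv sv x; pose im y := exists z, tmap (M := S) idfun u z = y.
have imD y z : im y -> im z -> im (y + z).
  by move=> [a <-] [b <-]; exists (a + b); rewrite raddfD.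
have imN y : im y -> im (- y) by move=> [a <-]; exists (- a); rewrite raddfN.
have imt s l : v l = 0 -> im (tens s l).
  by move=> vl; have [m <-] := (uv l).1 vl; exists (tens s m); rewrite tmapE.
split; last first.
  move=> [y <-]; tens_elim y; rewrite !tmapE /=.
  set w := v _; have -> : w = 0 by apply: (uv _).2; eexists.
  by rewrite tens0r.
have [g gK] := choice sv.
pose gl (s : seq (S * N)) := tens_of [seq (p.1, g p.2) | p <- s].
have glC s t : gl (s ++ t) = gl s + gl t by rewrite /gl map_cat [RHS]tens_add_of.
have gl_rel s t : tens_rel s t -> im (gl s - gl t).
  elim=> {s t} [s|s t _ IH|s t r _ IH1 _ IH2|s s' t t' _ IH1 _ IH2|s t|m m' n|m n n'|n|c m n].
  - by exists 0; rewrite raddf0 subrr.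
  - by rewrite -opprB; exact: imN.
  - by rewrite -(subrK (gl t) (gl s)) -addrA; exact: imD.
  - by rewrite !glC opprD addrACA; exact: imD.
  - by rewrite !glC (addrC (gl t)) subrr; exists 0; rewrite raddf0.
  - rewrite /gl /= !tens_ofE !big_cons big_nil /= tensDl !addr0 subrr.
    by exists 0; rewrite raddf0.
  - rewrite /gl /= !tens_ofE !big_cons big_nil /= !addr0 -tensDr -tensBr.
    by apply: imt; rewrite raddfB raddfD /= !gK subrr.
  - rewrite /gl /= !tens_ofE !big_cons big_nil /= addr0 tens0l subrr.
    by exists 0; rewrite raddf0.
  - rewrite /gl /= !tens_ofE !big_cons big_nil /= !addr0 tensZ -tensBr.
    by apply: imt; rewrite raddfB /= linearZ /= !gK subrr.
move=> vx; rewrite -(tens_of_repr x); set s := repr x.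
have : im (gl [seq (p.1, v p.2) | p <- s] - gl [::]).
  apply: gl_rel; apply/tens_ofP.
  move: vx; rewrite -{1}(tens_of_repr x) -/s => vx.
  rewrite [RHS](_ : _ = 0) // -vx !tens_ofE raddf_sum big_map /=.
  by apply: eq_bigr => p _; rewrite tmapE.
have -> : gl [::] = 0 by [].
rewrite subr0; move: (s) => {vx}s h.
suff hs : im (tens_of s - gl [seq (p.1, v p.2) | p <- s]).
  by have := imD _ _ hs h; rewrite subrK.
elim: {h} s => [|[m n] s IH]; first by exists 0; rewrite raddf0 subrr.
have -> : tens_of ((m, n) :: s) = tens m n + tens_of s by rewrite [RHS]tens_add_of.
have -> : gl [seq (p.1, v p.2) | p <- (m, n) :: s] =
  tens m (g (v n)) + gl [seq (p.1, v p.2) | p <- s] by rewrite [RHS]tens_add_of.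
rewrite opprD addrACA -tensBr; apply: imD => //.
by apply: imt; rewrite raddfB /= gK subrr.
Qed.

Lemma tmapl_exact (S M L N : lmodType R) (u : {linear M -> L}) (v : {linear L -> N}) :
  exact_at u v -> onto v ->
  exact_at (tmap (N := S) u idfun) (tmap (N := S) v idfun).
Proof.
move=> uv sv x; have h := tmapr_exact (S := S) uv sv (tswap x).
have -> : tmap v idfun x = 0 <-> tmap (M := S) idfun v (tswap x) = 0.
  rewrite -tswap_tmap; split=> [->|e]; first by rewrite raddf0.
  by apply: (can_inj (@tswapK _ _)); rewrite e raddf0.
rewrite h; split=> [[y e]|[y e]]; exists (tswap y).
  by apply: (can_inj (@tswapK _ _)); rewrite tswap_tmap tswapK.
by rewrite -tswap_tmap e.
Qed.
End TensorMap.

(** * Submodules, products and flatness *)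

Record lsub_type (R : comPzRingType) (V : lmodType R) (S : lsubmod V) := LSubType {
  lsub_val : V;
  lsub_valP : S lsub_val }.

Section LSubType.
Variables (R : comPzRingType) (V : lmodType R) (S : lsubmod V).
Local Notation T := (lsub_type S).

Lemma lsub_val_inj : injective (@lsub_val _ _ S).
Proof. by move=> [v Sv] [w Sw] /= e; subst w; rewrite (Prop_irrelevance Sv Sw). Qed.

HB.instance Definition _ := gen_eqMixin T.
HB.instance Definition _ := gen_choiceMixin T.

Definition lsub_zero : T := LSubType (lsub0 S).
Definition lsub_opp (x : T) : T := LSubType (lsubN (lsub_valP x)).
Definition lsub_add (x y : T) : T := LSubType (lsubD (lsub_valP x) (lsub_valP y)).
Definition lsub_scale a (x : T) : T := LSubType (lsubZ a (lsub_valP x)).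

Fact lsub_addA : associative lsub_add.
Proof. by move=> x y z; apply: lsub_val_inj; exact: addrA. Qed.
Fact lsub_addC : commutative lsub_add.
Proof. by move=> x y; apply: lsub_val_inj; exact: addrC. Qed.
Fact lsub_add0 : left_id lsub_zero lsub_add.
Proof. by move=> x; apply: lsub_val_inj; exact: add0r. Qed.
Fact lsub_addN : left_inverse lsub_zero lsub_opp lsub_add.
Proof. by move=> x; apply: lsub_val_inj; exact: addNr. Qed.
HB.instance Definition _ :=
  GRing.isZmodule.Build T lsub_addA lsub_addC lsub_add0 lsub_addN.

Fact lsub_scaleA a b x : lsub_scale a (lsub_scale b x) = lsub_scale (a * b) x.
Proof. by apply: lsub_val_inj; exact: scalerA. Qed.
Fact lsub_scale1 : left_id 1 lsub_scale.
Proof. by move=> x; apply: lsub_val_inj; exact: scale1r. Qed.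
Fact lsub_scaleDr : right_distributive lsub_scale +%R.
Proof. by move=> a x y; apply: lsub_val_inj; exact: scalerDr. Qed.
Fact lsub_scaleDl x : {morph lsub_scale^~ x : a b / a + b}.
Proof. by move=> a b; apply: lsub_val_inj; exact: scalerDl. Qed.
HB.instance Definition _ := GRing.Zmodule_isLmodule.Build R T
  lsub_scaleA lsub_scale1 lsub_scaleDr lsub_scaleDl.

Fact lsub_val_linear : linear (@lsub_val _ _ S).
Proof. by []. Qed.
HB.instance Definition _ := GRing.isLinear.Build R T V *:%R (@lsub_val _ _ S)
  lsub_val_linear.
End LSubType.

Section KernelImage.
Variables (R : comPzRingType) (V W : lmodType R) (u : {linear V -> W}).

Definition lsub_ker : lsubmod V.
Proof.
exists (fun v => u v = 0) => [|v w hv hw|a v hv]; first exact: raddf0.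
  by rewrite linearD hv hw addr0.
by rewrite linearZ /= hv scaler0.
Defined.

Definition lsub_img : lsubmod W.
Proof.
exists (fun w => exists v, u v = w) => [|_ _ [v <-] [w <-]|a _ [v <-]].
- by exists 0; rewrite raddf0.
- by exists (v + w); rewrite linearD.
- by exists (a *: v); rewrite linearZ.
Defined.

Definition corestr (v : V) : lsub_type lsub_img :=
  @LSubType _ _ lsub_img (u v) (ex_intro _ v erefl).
Fact corestr_linear : linear corestr.
Proof. by move=> a v w; apply: lsub_val_inj; rewrite /= linearP. Qed.
HB.instance Definition _ := GRing.isLinear.Build R V (lsub_type lsub_img) *:%R corestr
  corestr_linear.

Lemma corestr_onto : onto corestr.
Proof. by move=> [w [v e]]; exists v; exact: lsub_val_inj. Qed.
End KernelImage.

Definition dprod (R : comPzRingType) (I : Type) (K : I -> lmodType R) : Type :=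
  forall i, K i.

Section DProd.
Variables (R : comPzRingType) (I : Type) (K : I -> lmodType R).
Implicit Types f g : dprod K.

HB.instance Definition _ := gen_eqMixin (dprod K).
HB.instance Definition _ := gen_choiceMixin (dprod K).

Lemma dprodP f g : (forall i, f i = g i) -> f = g.
Proof. exact: functional_extensionality_dep. Qed.

Fact dprod_addA : associative (fun f g : dprod K => (fun i => f i + g i) : dprod K).
Proof. by move=> f g h; apply: dprodP => i /=; rewrite addrA. Qed.
Fact dprod_addC : commutative (fun f g : dprod K => (fun i => f i + g i) : dprod K).
Proof. by move=> f g; apply: dprodP => i /=; rewrite addrC. Qed.
Fact dprod_add0 :
  left_id ((fun i => 0) : dprod K) (fun f g => (fun i => f i + g i) : dprod K).
Proof. by move=> f; apply: dprodP => i /=; rewrite add0r. Qed.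
Fact dprod_addN : left_inverse ((fun i => 0) : dprod K)
  (fun f => (fun i => - f i) : dprod K) (fun f g => (fun i => f i + g i) : dprod K).
Proof. by move=> f; apply: dprodP => i /=; rewrite addNr. Qed.
HB.instance Definition _ :=
  GRing.isZmodule.Build (dprod K) dprod_addA dprod_addC dprod_add0 dprod_addN.

Definition dprod_scale (a : R) f : dprod K := fun i => a *: f i.
Fact dprod_scaleA a b f : dprod_scale a (dprod_scale b f) = dprod_scale (a * b) f.
Proof. by apply: dprodP => i; exact: scalerA. Qed.
Fact dprod_scale1 : left_id 1 dprod_scale.
Proof. by move=> f; apply: dprodP => i; exact: scale1r. Qed.
Fact dprod_scaleDr : right_distributive dprod_scale +%R.
Proof. by move=> a f g; apply: dprodP => i; exact: scalerDr. Qed.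
Fact dprod_scaleDl f : {morph dprod_scale^~ f : a b / a + b}.
Proof. by move=> a b; apply: dprodP => i; exact: scalerDl. Qed.
HB.instance Definition _ := GRing.Zmodule_isLmodule.Build R (dprod K)
  dprod_scaleA dprod_scale1 dprod_scaleDr dprod_scaleDl.

Lemma dprodD f g i : (f + g) i = f i + g i. Proof. by []. Qed.
Lemma dprodN f i : (- f) i = - f i. Proof. by []. Qed.
Lemma dprodB f g i : (f - g) i = f i - g i. Proof. by []. Qed.
Lemma dprodZ a f i : (a *: f) i = a *: f i. Proof. by []. Qed.

Definition dproj i f : K i := f i.
Fact dproj_linear i : linear (dproj i).
Proof. by []. Qed.
HB.instance Definition _ i := GRing.isLinear.Build R (dprod K) (K i) *:%R (dproj i)
  (@dproj_linear i).

Definition dinj i (v : K i) : dprod K := fun j =>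
  if pselect (i = j) is left e then ecast j (K j) e v else 0.

Lemma dinj_same i v : @dinj i v i = v.
Proof.
by rewrite /dinj; case: pselect => // e; rewrite (Prop_irrelevance e erefl).
Qed.
Lemma dinj_diff i j v : i <> j -> @dinj i v j = 0.
Proof. by rewrite /dinj; case: pselect. Qed.

Fact dinj_linear i : linear (@dinj i).
Proof.
move=> a v w; apply: dprodP => j; rewrite dprodD dprodZ.
have [e|ij] := pselect (i = j); first by subst j; rewrite !dinj_same.
by rewrite !dinj_diff // scaler0 addr0.
Qed.
HB.instance Definition _ i := GRing.isLinear.Build R (K i) (dprod K) *:%R (@dinj i)
  (@dinj_linear i).

Lemma dprod_sum (s : seq {classic I}) f : uniq s -> (forall i, (i : {classic I}) \in s) ->
  f = \sum_(i <- s) @dinj i (@dproj i f).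
Proof.
move=> us cs; apply: dprodP => j.
have ev : zmod_morphism (fun g : dprod K => g j) by [].
pose evj : {additive dprod K -> K j} :=
  mkadd ev.
have E g : evj g = g j by [].
rewrite -[LHS]E -[RHS]E raddf_sum (bigD1_seq (j : {classic I})) //= !E dinj_same.
by rewrite big1 ?addr0 // => i /eqP ij; rewrite E; exact: dinj_diff.
Qed.

Section Tensor.
Variable N : lmodType R.
Hypothesis finI : finite_set [set: I].

Lemma fin_enum : exists s : seq {classic I},
  uniq s /\ forall i : I, (i : {classic I}) \in s.
Proof.
have /finite_seqP[s hs] := finI : finite_set [set: {classic I}].
exists (undup s); split=> [|i]; first exact: undup_uniq.
by have : [set: {classic I}] i by []; rewrite hs mem_undup.
Qed.

(** A finite product is a direct sum, so a tensor is the sum of the [dinj]-images of its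
    components. *)
Lemma dprod_tens_eq0l (t : tensor (dprod K) N) :
  (forall i, tmap (@dproj i) idfun t = 0) -> t = 0.
Proof.
have [s [us cs]] := fin_enum => h.
suff -> : t = \sum_(i <- s) tmap (@dinj i) idfun (tmap (@dproj i) idfun t).
  by rewrite big1 // => i _; rewrite h raddf0.
elim/tens_ind: t {h} => [|x y ex ey|f n].
- by rewrite big1 // => i _; rewrite !raddf0.
- rewrite {1}ex {1}ey -big_split /=; apply: eq_bigr => i _.
  by rewrite !raddfD.
- rewrite {1}(dprod_sum f us cs).
  have hb : zmod_morphism (fun g : dprod K => tens g n).
    by move=> a b; rewrite tensBl.
  pose ev : {additive dprod K -> tensor (dprod K) N} :=
    mkadd hb.
  rewrite -[LHS]/(ev _) raddf_sum; apply: eq_bigr => i _.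
  by rewrite !tmapE.
Qed.

Lemma dprod_tens_eq0r (t : tensor N (dprod K)) :
  (forall i, tmap idfun (@dproj i) t = 0) -> t = 0.
Proof.
move=> h; apply: (can_inj (@tswapK _ _ _)); rewrite raddf0.
by apply: dprod_tens_eq0l => i; rewrite -tswap_tmap h raddf0.
Qed.

Lemma dprod_tens_onto (t : forall i, tensor (K i) N) :
  exists T : tensor (dprod K) N, forall i, tmap (@dproj i) idfun T = t i.
Proof.
have [s [us cs]] := fin_enum.
exists (\sum_(i <- s) tmap (@dinj i) idfun (t i)) => i.
rewrite raddf_sum (bigD1_seq (i : {classic I})) //= big1 => [|j /eqP ji]; last first.
  by move: (t j) => x; tens_elim x; rewrite !tmapE /= /dproj dinj_diff // tens0l.
by rewrite addr0; move: (t i) => x; tens_elim x; rewrite !tmapE /= /dproj dinj_same.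
Qed.

Lemma dprod_tens_ontor (t : forall i, tensor N (K i)) :
  exists T : tensor N (dprod K), forall i, tmap idfun (@dproj i) T = t i.
Proof.
have [T hT] := dprod_tens_onto (fun i => tswap (t i)).
exists (tswap T) => i; apply: (can_inj (@tswapK _ _ _)).
by rewrite tswap_tmap tswapK hT.
Qed.
End Tensor.

End DProd.

Section Flat.
Variable R : comPzRingType.
Implicit Types K F G M N : lmodType R.

Lemma tmap_comp (M M' M2 N N' N2 : lmodType R) (u : {linear M -> M'}) (u' : {linear M' -> M2})
    (v : {linear N -> N'}) (v' : {linear N' -> N2}) (w : {linear M -> M2})
    (z : {linear N -> N2}) x :
  (forall m, u' (u m) = w m) -> (forall n, v' (v n) = z n) ->
  tmap u' v' (tmap u v x) = tmap w z x.
Proof. by move=> h h'; tens_elim x; rewrite !tmapE h h'. Qed.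

Lemma tmap_id M N (x : tensor M N) : tmap idfun idfun x = x.
Proof. by tens_elim x; rewrite tmapE. Qed.

Lemma flat_dprod (I : Type) (K : I -> lmodType R) :
  finite_set [set: I] -> (forall i, flat_module (K i)) -> flat_module (dprod K).
Proof.
move=> finI fK M N u ui; apply: tmap_eq0_inj => x x0.
apply: dprod_tens_eq0l => // i; apply: (fK i _ _ u ui); rewrite raddf0.
rewrite (tmap_comp (w := @dproj _ _ _ i) (z := u)) //.
rewrite -(tmap_comp (u := idfun) (v := u) (u' := @dproj _ _ _ i) (v' := idfun)) //.
by rewrite x0 raddf0.
Qed.

Lemma flat_retract K F (i : {linear K -> F}) (r : {linear F -> K}) :
  cancel i r -> flat_module F -> flat_module K.
Proof.
move=> ir fF M N u ui; apply: tmap_eq0_inj => x x0.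
rewrite -(tmap_id x) -(tmap_comp (u := i) (v := idfun) (u' := r) (v' := idfun)) //.
have -> : tmap i idfun x = 0; last by rewrite raddf0.
apply: (fF _ _ u ui); rewrite raddf0 (tmap_comp (w := i) (z := u)) //.
rewrite -(tmap_comp (u := idfun) (v := u) (u' := i) (v' := idfun)) //.
by rewrite x0 raddf0.
Qed.

Lemma flat_zero K : (forall x : K, x = 0) -> flat_module K.
Proof.
move=> K0 M N u _; apply: tmap_eq0_inj => x _.
have h m n : tens (m : K) n = 0 :> tensor K M by rewrite (K0 m) tens0l.
by tens_elim x.
Qed.

(** Since [v] need not be onto, it is factored through its image: right exactness treats the
    corestriction, and flatness keeps the inclusion of the image injective. *)
Lemma flat_exact (S M L N : lmodType R) (u : {linear M -> L}) (v : {linear L -> N}) :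
  flat_module S -> exact_at u v ->
  exact_at (tmap (M := S) idfun u) (tmap (M := S) idfun v).
Proof.
move=> fS uv.
have ex : exact_at u (corestr v).
  move=> y; split=> [e|/(uv y).2 e]; last exact: lsub_val_inj.
  by apply/(uv y).1; exact: (congr1 (@lsub_val _ _ _) e).
move=> t; rewrite -(tmapr_exact (S := S) ex (@corestr_onto _ _ _ v)).
have e x : tmap (M := S) idfun v x =
    tmap idfun (@lsub_val _ _ (lsub_img v)) (tmap idfun (corestr v) x).
  by rewrite (tmap_comp (w := idfun) (z := v)).
rewrite e; split=> [h|->]; last by rewrite raddf0.
by apply: (fS _ _ (@lsub_val _ _ (lsub_img v)) (@lsub_val_inj _ _ _)); rewrite h raddf0.
Qed.
End Flat.

(** * Free modules: coordinates of tensors and the universal property *)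

Section FreeTensor.
Variables (R : comPzRingType) (I : Type).
Implicit Types (f : finsupp I R) (i : I).

Fact fs_delta_finite i :
  finite_set [set j : I | (if pselect (i = j) then 1 else 0 : R) != 0].
Proof.
apply: (@sub_finite_set _ _ [set i]); last exact: finite_set1.
by move=> j /=; case: pselect => [e|ne] /=; rewrite ?eqxx.
Qed.
Definition fs_delta i : finsupp I R := FinSupp (fs_delta_finite i).

Lemma fs_delta_same i : fs_delta i i = 1.
Proof. by rewrite /=; case: pselect. Qed.
Lemma fs_delta_diff i j : i <> j -> fs_delta i j = 0.
Proof. by rewrite /=; case: pselect. Qed.

Lemma fsD f g i : (f + g) i = f i + g i. Proof. by []. Qed.
Lemma fsZ a f i : (a *: f) i = a * f i. Proof. by []. Qed.

Lemma fs_supp f : exists2 s : seq {classic I}, uniq s &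
  forall i, f i != 0 -> (i : {classic I}) \in s.
Proof.
have /finite_seqP[s hs] := fs_finite f : finite_set [set i : {classic I} | f i != 0].
exists (undup s) => [|i fi]; first exact: undup_uniq.
by rewrite mem_undup; have : [set i : {classic I} | f i != 0] i by []; rewrite hs.
Qed.

Lemma fs_sumE (J : Type) (s : seq J) (P : pred J) (F : J -> finsupp I R) i :
  (\sum_(j <- s | P j) F j) i = \sum_(j <- s | P j) F j i.
Proof. by elim/big_rec2: _ => // j x y _ <-. Qed.

Lemma fs_delta_sum f (s : seq {classic I}) : uniq s ->
  (forall i, f i != 0 -> (i : {classic I}) \in s) ->
  f = \sum_(i <- s) f i *: fs_delta i.
Proof.
move=> us cs; apply: finsuppP => j; rewrite fs_sumE.
have [fj|/cs js] := eqVneq (f j) 0.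
  rewrite fj big1 // => i _; rewrite fsZ.
  have [e|ij] := pselect (i = j); first by rewrite e fj mul0r.
  by rewrite fs_delta_diff ?mulr0.
rewrite (bigD1_seq (j : {classic I})) // big1 ?addr0 => [|i /eqP ij].
  by rewrite -[RHS]/((f j *: fs_delta j) j + 0) addr0 fsZ fs_delta_same mulr1.
by rewrite fsZ fs_delta_diff ?mulr0.
Qed.

Lemma fs_ind (P : finsupp I R -> Prop) : P 0 -> (forall f g, P f -> P g -> P (f + g)) ->
  (forall a i, P (a *: fs_delta i)) -> forall f, P f.
Proof.
move=> P0 PD Pd f; have [s us cs] := fs_supp f.
by rewrite (fs_delta_sum us cs); elim/big_ind: _.
Qed.

Variable K : lmodType R.

Fact tcoef_balanced i : balanced (fun (x : K) f => f i *: x).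
Proof.
by split=> [f x y|x f g|c x f] /=; rewrite ?scalerDr ?scalerDl // scalerA mulrC.
Qed.
Definition tcoef i : tensor K (finsupp I R) -> K := tbil (tcoef_balanced i).
HB.instance Definition _ i := GRing.Additive.on (tcoef i).

Lemma tcoefE i x f : tcoef i (tens x f) = f i *: x.
Proof. exact: tbilE. Qed.

Lemma tcoef_inj t : (forall i, tcoef i t = 0) -> t = 0.
Proof.
(* The expansion is claimed over every duplicate-free list containing [s], so that the supports of
   two tensors can be merged in the case of a sum. *)
suff [s hs] : exists s : seq {classic I}, forall s' : seq {classic I}, uniq s' ->
    {subset s <= s'} -> t = \sum_(i <- s') tens (tcoef i t) (fs_delta i).
  move=> t0; rewrite (hs (undup s)) ?undup_uniq ?big1 // => [i _|i].
    by rewrite t0 tens0l.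
  by rewrite mem_undup.
elim/tens_ind: t => [|x y [s hs] [s' hs']|x f].
- by exists [::] => s' _ _; rewrite big1 // => i _; rewrite raddf0 tens0l.
- exists (s ++ s') => s2 us2 ss2.
  rewrite {1}(hs s2) // => [|i hi]; last by apply: ss2; rewrite mem_cat hi.
  rewrite {1}(hs' s2) // => [|i hi]; last by apply: ss2; rewrite mem_cat hi orbT.
  by rewrite -big_split; apply: eq_bigr => i _; rewrite raddfD tensDl.
- have [s us cs] := fs_supp f; exists s => s' us' ss'.
  have cs' i : f i != 0 -> (i : {classic I}) \in s' by move=> /cs/ss'.
  rewrite {1}(fs_delta_sum us' cs').
  have hb : zmod_morphism (fun g : finsupp I R => tens x g).
    by move=> a b; rewrite tensBr.
  pose ev : {additive finsupp I R -> tensor K (finsupp I R)} :=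
    mkadd hb.
  rewrite -[LHS]/(ev _) raddf_sum; apply: eq_bigr => i _.
  by rewrite tcoefE tensZ.
Qed.
End FreeTensor.

Section FreeLift.
Variables (R S : comPzRingType) (h : {rmorphism R -> S}) (I : Type).
Variables (V : lmodType S) (g : I -> V).

(** The map from a free module determined by the images of the basis, semilinear along [h]. The sum
    runs over a chosen support; [fs_liftE] frees the value from that choice. *)
Definition fs_lift (f : finsupp I R) : V :=
  \sum_(i <- projT1 (cid2 (fs_supp f))) h (f i) *: g i.

Lemma fs_liftE (f : finsupp I R) (s : seq {classic I}) : uniq s ->
  (forall i, f i != 0 -> (i : {classic I}) \in s) ->
  fs_lift f = \sum_(i <- s) h (f i) *: g i.
Proof.
rewrite /fs_lift; case: cid2 => /= s' us' cs' us cs.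
rewrite (bigID (fun i => f i != 0)) /= [X in _ + X]big1 ?addr0; last first.
  by move=> i; rewrite negbK => /eqP->; rewrite rmorph0 scale0r.
rewrite [RHS](bigID (fun i => f i != 0)) /= [X in _ = _ + X]big1 ?addr0; last first.
  by move=> i; rewrite negbK => /eqP->; rewrite rmorph0 scale0r.
rewrite -big_filter -[RHS]big_filter.
apply: (@perm_big _ _ _ {classic I}).
apply: uniq_perm; rewrite ?filter_uniq // => i; rewrite !mem_filter.
by case: eqP => //= /eqP fi; rewrite cs // cs'.
Qed.

Lemma fs_lift_linear : linear_for (h \; *:%R) fs_lift.
Proof.
move=> a f f'; have [s us cs] := fs_supp f; have [s' us' cs'] := fs_supp f'.
pose s2 := undup (s ++ s').
have u2 : uniq s2 by exact: undup_uniq.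
have c i : f i != 0 -> (i : {classic I}) \in s2.
  by move=> /cs is_; rewrite mem_undup mem_cat is_.
have c' i : f' i != 0 -> (i : {classic I}) \in s2.
  by move=> /cs' is_; rewrite mem_undup mem_cat is_ orbT.
rewrite (fs_liftE u2 c) (fs_liftE u2 c') (fs_liftE u2); last first.
  move=> i; rewrite fsD fsZ; have [f0|/c //] := eqVneq (f i) 0.
  by rewrite f0 mulr0 add0r => /c'.
rewrite /= scaler_sumr -big_split; apply: eq_bigr => i _ /=.
by rewrite rmorphD rmorphM scalerDl scalerA.
Qed.
HB.instance Definition _ := GRing.isLinear.Build R (finsupp I R) V (h \; *:%R)
  fs_lift fs_lift_linear.

Lemma fs_lift_delta i : fs_lift (fs_delta R i) = g i.
Proof.
rewrite (@fs_liftE _ [:: (i : {classic I})]) // => [|j].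
  by rewrite big_seq1 fs_delta_same rmorph1 scale1r.
by rewrite inE /=; case: pselect => [e|ne] /=; rewrite ?eqxx // e eqxx.
Qed.
End FreeLift.

Section FlatSequence.
Variable R : comPzRingType.

(* Present [N] as a quotient of a free module [P]: an element of the kernel lifts
   to [K (x) P], and the flatness of [G] brings it into the image of [K (x) Q],
   where [Q] is the kernel of [P -> N]. *)
Lemma tmap_inj_flat_coker (K F G N : lmodType R) (i : {linear K -> F})
    (p : {linear F -> G}) :
  injective i -> exact_at i p -> onto p -> flat_module G ->
  injective (tmap (N := N) i idfun).
Proof.
move=> ii ip po fG; apply: tmap_eq0_inj => x x0.
have vl : linear (fs_lift idfun (fun n : N => n)).
  exact: (fs_lift_linear idfun).
pose v : {linear finsupp N R -> N} := mklin vl.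
have vo : onto v by move=> n; exists (fs_delta R n); exact: (fs_lift_delta idfun).
pose u : {linear lsub_type (lsub_ker v) -> finsupp N R} := @lsub_val _ _ (lsub_ker v).
have ui : injective u by exact: lsub_val_inj.
have uv : exact_at u v.
  move=> y; split=> [vy|[[z vz] <-]] //.
  by exists (LSubType (vy : lsub_ker v y)).
have [y yx] := tmap_onto (u := idfun) (v := v) (fun m : K => ex_intro _ m erefl) vo x.
have [z zy] : exists z, tmap (M := F) idfun u z = tmap i idfun y.
  apply/(tmapr_exact (S := F) uv vo).
  rewrite (tmap_comp (w := i) (z := v)) //.
  rewrite -(tmap_comp (u := idfun) (v := v) (u' := i) (v' := idfun)) //.
  by rewrite yx.
have pz : tmap p idfun z = 0.
  apply: (fG _ _ u ui); rewrite raddf0 (tmap_comp (w := p) (z := u)) //.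
  rewrite -(tmap_comp (u := idfun) (v := u) (u' := p) (v' := idfun)) // zy.
  by apply/(tmapl_exact (S := finsupp N R) ip po); exists y.
have [w wz] := (tmapl_exact (S := _) ip po z).1 pz.
have -> : x = tmap idfun v (tmap idfun u w).
  rewrite -yx; congr (tmap idfun v _); apply/eqP; rewrite -subr_eq0; apply/eqP.
  have e0 : tmap i idfun (y - tmap idfun u w) = 0.
    rewrite raddfB /= -zy -wz (tmap_comp (w := i) (z := u)) //.
    by rewrite (tmap_comp (w := i) (z := u)) // subrr.
  move: (y - _) e0 => t e0; apply: tcoef_inj => n; apply: ii; rewrite raddf0.
  have E r : i (tcoef n r) = tcoef n (tmap i idfun r).
    by tens_elim r; rewrite tmapE !tcoefE linearZ.
  by rewrite E e0 raddf0.
by apply/(tmapr_exact (S := K) uv vo); exists w.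
Qed.

(** The composite K (x) M -> F (x) M -> F (x) N is injective, the first arrow because Tor_1(G, M) =
    0 and the second because F is flat; it factors through K (x) N. *)
Lemma flat_kernel (K F G : lmodType R) (i : {linear K -> F}) (p : {linear F -> G}) :
  injective i -> exact_at i p -> onto p -> flat_module F -> flat_module G ->
  flat_module K.
Proof.
move=> ii ip po fF fG M N u ui; apply: tmap_eq0_inj => x x0.
apply: (tmap_inj_flat_coker (N := M) ii ip po fG); rewrite raddf0.
apply: (fF _ _ u ui); rewrite raddf0 (tmap_comp (w := i) (z := u)) //.
rewrite -(tmap_comp (u := idfun) (v := u) (u' := i) (v' := idfun)) //.
by rewrite x0 raddf0.
Qed.
End FlatSequence.

(** * Diagrams of modules on a finite poset *)

Section Quotient.
Variables (R : comPzRingType) (V : lmodType R).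

Definition ltop : lsubmod V :=
  @LSubmod R V (fun _ => True) I (fun _ _ _ _ => I) (fun _ _ _ => I).

Variable B : lsubmod V.
Definition lquot : Type := subquot ltop B.
HB.instance Definition _ := GRing.Lmodule.on lquot.

Definition qcl (v : V) : lquot := sq_class B (I : ltop v).

Fact qcl_linear : linear qcl.
Proof. by move=> a v w; rewrite [X in _ = X + _]sq_classZ [RHS]sq_classD; exact: sq_class_eq. Qed.
HB.instance Definition _ := GRing.isLinear.Build R V lquot *:%R qcl qcl_linear.

Lemma qcl_eq0 v : qcl v = 0 <-> B v.
Proof. by rewrite [0](_ : _ = qcl 0) ?raddf0 // sq_classP subr0. Qed.

Lemma qcl_onto : onto qcl.
Proof. by elim/sq_ind=> v Zv; exists v; exact: sq_class_eq. Qed.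

Section Lift.
Variables (W : zmodType) (f : {additive V -> W}).
Hypothesis fB : forall v, B v -> f v = 0.

Definition qlift (c : lquot) : W := f (sq_repr c).

Lemma qliftE v : qlift (qcl v) = f v.
Proof.
apply/eqP; rewrite -subr_eq0 -raddfB; apply/eqP/fB.
exact: (sq_repr_class B (I : ltop v)).
Qed.

Lemma qlift_additive : zmod_morphism qlift.
Proof.
move=> c d; have [v <-] := qcl_onto c; have [w <-] := qcl_onto d.
by rewrite -raddfB !qliftE raddfB.
Qed.
End Lift.

Lemma qlift_linear (W : lmodType R) (f : {linear V -> W}) :
  (forall v, B v -> f v = 0) -> linear (qlift f).
Proof.
move=> fB a c d; have [v <-] := qcl_onto c; have [w <-] := qcl_onto d.
rewrite -linearP !qliftE //; exact: linearP.
Qed.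
End Quotient.

Record fposet := FPoset {
  fp_pt :> Type;
  fp_le : fp_pt -> fp_pt -> Prop;
  fp_refl : forall x, fp_le x x;
  fp_trans : forall x y z, fp_le x y -> fp_le y z -> fp_le x z;
  fp_anti : forall x y, fp_le x y -> fp_le y x -> x = y;
  fp_fin : finite_set [set: fp_pt] }.

Record diagram (R : comPzRingType) (T : fposet) := Diagram {
  d_st :> T -> lmodType R;
  d_res : forall x y, fp_le x y -> {linear d_st x -> d_st y};
  d_id : forall x (h : fp_le x x) v, d_res h v = v;
  d_comp : forall x y z (xy : fp_le x y) (yz : fp_le y z) (xz : fp_le x z) v,
    d_res yz (d_res xy v) = d_res xz v }.

Record dmor (R : comPzRingType) (T : fposet) (D E : diagram R T) := DMor {
  dm_fun :> forall x, {linear D x -> E x};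
  dm_res : forall x y (h : fp_le x y) v, dm_fun y (d_res D h v) = d_res E h (dm_fun x v) }.

Section Diagrams.
Variables (R : comPzRingType) (T : fposet).
Implicit Types D E F Q : diagram R T.
Local Notation le := (@fp_le T).

Definition is_sec D (f : dprod D) := forall x y (h : le x y), d_res D h (f x) = f y.

Definition up (x : T) := {y : T | le x y}.

Lemma up_fin x : finite_set [set: up x].
Proof.
have := @finite_preimage _ _ [set: T] (fun y : up x => sval y).
rewrite preimage_setT; apply; last exact: fp_fin.
by move=> [y hy] [z hz] _ _ /= e; subst z; rewrite (Prop_irrelevance hy hz).
Qed.

Section Cokernel.
Variable D : diagram R T.

(** The stalk at [x] of the Godement sheaf of [D], that is the product of the stalks over the least
    open set of [x]. The global sections of that flasque sheaf are [dprod D], and [trunc] is their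
    restriction. *)
Definition god (x : T) : lmodType R := dprod (fun y : up x => D (sval y)).

Definition trunc x (f : dprod D) : god x := fun y => f (sval y).
Arguments trunc : clear implicits.
Fact trunc_linear x : linear (trunc x).
Proof. by []. Qed.
HB.instance Definition _ x := GRing.isLinear.Build R (dprod D) (god x) *:%R (trunc x)
  (@trunc_linear x).

Definition eta x (v : D x) : god x := fun y => d_res D (proj2_sig y) v.
Fact eta_linear x : linear (@eta x).
Proof. by move=> a v w; apply: dprodP => y; rewrite /eta linearP. Qed.
HB.instance Definition _ x := GRing.isLinear.Build R (D x) (god x) *:%R (@eta x)
  (@eta_linear x).

Definition base (x : T) : up x := exist _ x (fp_refl x).

Lemma eta_base x v : @eta x v (base x) = v.
Proof. exact: d_id. Qed.

Section Res.
Variables (x y : T) (h : le x y).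

Definition up_res (z : up y) : up x := exist _ (sval z) (fp_trans h (proj2_sig z)).

Definition god_res (g : god x) : god y := fun z => g (up_res z).
Fact god_res_linear : linear god_res.
Proof. by []. Qed.
HB.instance Definition _ := GRing.isLinear.Build R (god x) (god y) *:%R god_res
  god_res_linear.

Lemma god_res_eta v : god_res (eta v) = eta (d_res D h v).
Proof. by apply: dprodP => z; rewrite /god_res /eta (d_comp _ _ (fp_trans h (proj2_sig z))). Qed.

End Res.

Definition cok_st x : lmodType R := lquot (lsub_img (@eta x)).

Definition gcl x (g : god x) : cok_st x := qcl _ g.
Fact gcl_linear x : linear (@gcl x).
Proof. exact: qcl_linear. Qed.
HB.instance Definition _ x := GRing.isLinear.Build R (god x) (cok_st x) *:%R (@gcl x)
  (@gcl_linear x).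

Lemma gcl_eq0 x (g : god x) : gcl g = 0 <-> exists v, eta v = g.
Proof. exact: qcl_eq0. Qed.

Lemma gcl_eta x (v : D x) : gcl (eta v) = 0.
Proof. by apply/gcl_eq0; exists v. Qed.

Lemma gcl_onto x : onto (@gcl x).
Proof. exact: qcl_onto. Qed.

Lemma cok_res_vanish x y (h : le x y) (g : god x) :
  lsub_img (@eta x) g -> (@gcl y \o god_res h) g = 0.
Proof. by move=> [v <-] /=; rewrite god_res_eta gcl_eta. Qed.

Definition cok_res x y (h : le x y) : {linear cok_st x -> cok_st y} :=
  mklin (qlift_linear (@cok_res_vanish x y h)).

Lemma cok_resE x y (h : le x y) g : cok_res h (gcl g) = gcl (god_res h g).
Proof. exact: (qliftE (@cok_res_vanish x y h)). Qed.

Fact cok_id x (h : le x x) v : cok_res h v = v.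
Proof.
have [g <-] := gcl_onto v; rewrite cok_resE; congr gcl; apply: dprodP => -[z xz].
by rewrite /god_res /up_res /=; congr (g (exist _ _ _)); exact: Prop_irrelevance.
Qed.
Fact cok_comp x y z (xy : le x y) (yz : le y z) (xz : le x z) v :
  cok_res yz (cok_res xy v) = cok_res xz v.
Proof.
have [g <-] := gcl_onto v; rewrite !cok_resE; congr gcl; apply: dprodP => -[w zw].
by rewrite /god_res /up_res /=; congr (g (exist _ _ _)); exact: Prop_irrelevance.
Qed.

Definition cok : diagram R T := Diagram cok_id cok_comp.
End Cokernel.
Arguments trunc {D} x f.

(** This is H^1(T, D) = 0: in the long exact sequence of D -> [god D] -> [cok D] the middle term is
    flasque with global sections [dprod D]. *)
Definition acyc0 D := forall c : dprod (cok D), is_sec c ->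
  exists f : dprod D, forall x, c x = gcl (trunc x f).

(* [acyc n D] expresses the vanishing of H^(n+1)(T, D), by dimension shifting along the
   flasque embedding of [D] into [god D]. *)
Fixpoint acyc n D := if n is m.+1 then acyc m (cok D) else acyc0 D.

Section CokernelMap.
Variables (D E : diagram R T) (u : dmor D E).

Definition gmap x (g : god D x) : god E x := fun y => u (sval y) (g y).
Fact gmap_linear x : linear (@gmap x).
Proof. by move=> a v w; apply: dprodP => y; rewrite /gmap linearP. Qed.
HB.instance Definition _ x := GRing.isLinear.Build R (god D x) (god E x) *:%R
  (@gmap x) (@gmap_linear x).

Lemma gmap_eta x v : gmap (eta v) = eta (u x v).
Proof. by apply: dprodP => y; rewrite /gmap /eta dm_res. Qed.

Lemma cokmap_vanish x (g : god D x) :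
  lsub_img (@eta D x) g -> (@gcl E x \o @gmap x) g = 0.
Proof. by move=> [v <-] /=; rewrite gmap_eta gcl_eta. Qed.

Definition cokmap_fun x : {linear cok D x -> cok E x} :=
  mklin (qlift_linear (@cokmap_vanish x)).

Lemma cokmap_funE x (g : god D x) : cokmap_fun x (gcl g) = gcl (gmap g).
Proof. exact: (qliftE (@cokmap_vanish x)). Qed.

Fact cokmap_res x y (h : le x y) v :
  cokmap_fun y (d_res (cok D) h v) = d_res (cok E) h (cokmap_fun x v).
Proof. by have [g <-] := gcl_onto v; rewrite [d_res _ _ _]cok_resE !cokmap_funE [RHS]cok_resE. Qed.

Definition cokmap : dmor (cok D) (cok E) := DMor cokmap_res.

Lemma cokmapE x (g : god D x) : cokmap x (gcl g) = gcl (gmap g).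
Proof. exact: cokmap_funE. Qed.
End CokernelMap.

(** * Short exact sequences of diagrams and the long exact sequence *)

Definition ses F E Q (i : dmor F E) (j : dmor E Q) :=
  forall x, [/\ injective (i x), exact_at (i x) (j x) & onto (j x)].

Definition sec_onto E Q (j : dmor E Q) :=
  forall q : dprod Q, is_sec q -> exists2 e : dprod E, is_sec e & forall x, j x (e x) = q x.

Lemma eta_eq0 D x (v : D x) : eta v = 0 -> v = 0.
Proof. by move=> /(congr1 (fun g : god D x => g (base x))); rewrite eta_base. Qed.

(** If the truncation of [f] at [x] is [eta v], then [v] must be [f x], and the other components say
    that [f] is compatible. With [gcl_sec] this is left exactness of global sections on D -> [god D]
    -> [cok D]. *)
Lemma sec_gcl0 D (f : dprod D) : (forall x, gcl (trunc x f) = 0) -> is_sec f.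
Proof.
move=> h x y xy; have [v ev] := (gcl_eq0 _).1 (h x).
have e z (xz : le x z) : f z = d_res D xz v.
  exact: (esym (congr1 (fun g : god D x => g (exist _ z xz)) ev)).
by rewrite (e _ xy) (e _ (fp_refl x)) d_id.
Qed.

Lemma gcl_sec D (f : dprod D) : is_sec f -> forall x, gcl (trunc x f) = 0.
Proof.
move=> sf x; apply/gcl_eq0; exists (f x); apply: dprodP => -[y xy].
exact: sf.
Qed.

Lemma choice_dep (I : Type) (A : I -> Type) (P : forall i, A i -> Prop) :
  (forall i, exists a, P i a) -> exists f : forall i, A i, forall i, P i (f i).
Proof. by move=> h; exists (fun i => sval (cid (h i))) => i; exact: (svalP (cid (h i))). Qed.

Section Ses.
Variables (F E Q : diagram R T) (i : dmor F E) (j : dmor E Q).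
Hypothesis ijses : ses i j.

Lemma gmap_onto x : onto (@gmap _ _ j x).
Proof.
move=> q; have [e he] := choice_dep (fun y : up x => let: And3 _ _ o := ijses (sval y) in o (q y)).
by exists e; apply: dprodP.
Qed.

Lemma gmap_inj x : injective (@gmap _ _ i x).
Proof.
move=> g g' e; apply: dprodP => y; have [ii _ _] := ijses (sval y); apply: ii.
exact: (congr1 (fun k : god E x => k y) e).
Qed.

Lemma gmap_exact x : exact_at (@gmap _ _ i x) (@gmap _ _ j x).
Proof.
move=> g; split=> [g0|[f <-]]; last first.
  apply: dprodP => y; have [_ ij _] := ijses (sval y).
  by apply/(ij _).2; exists (f y).
have h (y : up x) : exists f, i (sval y) f = g y.
  have [_ ij _] := ijses (sval y).
  by apply/(ij _).1; exact: (congr1 (fun k : god Q x => k y) g0).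
by have [f hf] := choice_dep h; exists f; apply: dprodP.
Qed.

(** The nine lemma, applied to the Godement embeddings of F, E and Q. *)
Lemma cok_ses : ses (cokmap i) (cokmap j).
Proof.
move=> x; have [ii ij jo] := ijses x; split.
- apply/raddf_inj => c; have [g <-] := gcl_onto c.
  rewrite /= cokmapE => /gcl_eq0[e he].
  have je : j x e = 0.
    apply: eta_eq0; rewrite -gmap_eta he.
    by apply/(gmap_exact _).2; exists g.
  have [f fe] := (ij e).1 je.
  apply/gcl_eq0; exists f; apply: (@gmap_inj x).
  by rewrite gmap_eta fe.
- move=> c; split=> [|[f <-]]; last first.
    have [g <-] := gcl_onto f; rewrite !cokmapE.
    have -> : gmap j (gmap i g) = 0 by apply/(gmap_exact _).2; exists g.
    exact: raddf0.
  have [g <-] := gcl_onto c; rewrite cokmapE => /gcl_eq0[q hq].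
  have [e eq_] := jo q.
  have [f hf] : exists f, gmap i f = g - eta e.
    by apply/(gmap_exact _).1; rewrite raddfB /= gmap_eta eq_ hq subrr.
  by exists (gcl f); rewrite cokmapE hf raddfB /= gcl_eta subr0.
- move=> c; have [q <-] := gcl_onto c; have [g <-] := gmap_onto q.
  by exists (gcl g); rewrite cokmapE.
Qed.

(** The segment H^0(E) -> H^0(Q) -> H^1(F) -> H^1(E) = 0 of the long exact sequence. *)
Lemma acyc0_sec_onto : acyc0 E -> (acyc0 F <-> sec_onto j).
Proof.
move=> aE; split=> [aF q sq|jo c sc].
  have [e he] := choice_dep (fun x : T => let: And3 _ _ o := ijses x in o (q x)).
  have h x : exists c : cok F x, cokmap i x c = gcl (trunc x (e : dprod E)).
    have [_ ex _] := cok_ses x; apply/(ex _).1.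
    rewrite cokmapE (_ : gmap j _ = trunc x q); last by apply: dprodP => y; exact: he.
    exact: gcl_sec.
  have [c hc] := choice_dep h.
  have sc : is_sec (c : dprod (cok F)).
    move=> x y xy; have [ci _ _] := cok_ses y; apply: ci.
    by rewrite dm_res !hc [LHS]cok_resE.
  have [f hf] := aF c sc.
  (* The pointwise lift [e] of [q] is not a section; its defect in [cok E] comes from the section
     [c] of [cok F], and an [f] inducing [c] corrects it. *)
  exists (fun x => e x - i x (f x)); last first.
    move=> x; have [_ ij _] := ijses x; rewrite raddfB /= he.
    by rewrite (_ : j x (i x (f x)) = 0) ?subr0 //; apply/(ij _).2; exists (f x).
  apply: sec_gcl0 => x.
  rewrite (_ : trunc x _ = trunc x (e : dprod E) - gmap i (trunc x f)) //.
  by rewrite raddfB /= -cokmapE -hf hc subrr.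
have sc' : is_sec ((fun x => cokmap i x (c x)) : dprod (cok E)).
  by move=> x y xy; rewrite -dm_res sc.
have [e he] := aE _ sc'.
have sq : is_sec ((fun x => j x (e x)) : dprod Q).
  apply: sec_gcl0 => x; rewrite (_ : trunc x _ = gmap j (trunc x e)) //.
  rewrite -cokmapE -he; have [_ ex _] := cok_ses x.
  by apply/(ex _).2; exists (c x).
have [e' se' he'] := jo _ sq.
have h x : exists f, i x f = e x - e' x.
  have [_ ij _] := ijses x; apply/(ij _).1.
  by rewrite raddfB /= he' subrr.
have [f hf] := choice_dep h.
exists f => x; have [ci _ _] := cok_ses x; apply: ci.
rewrite he cokmapE.
have -> : gmap i (trunc x (f : dprod F)) = trunc x e - trunc x e'.
  by apply: dprodP => y; exact: hf.
by rewrite raddfB /= (gcl_sec se') subr0.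
Qed.
End Ses.

(** Dimension shift from H^(n+2)(F) to H^(n+1)(Q). For n = 0, sections of [cok E] come from
    [dprod E], which maps onto [dprod Q], so lifting sections of [cok Q] to [cok E] amounts to
    lifting them to [dprod Q]. *)
Lemma acyc_shift n F E Q (i : dmor F E) (j : dmor E Q) : ses i j ->
  (forall m, acyc m E) -> (acyc n.+1 F <-> acyc n Q).
Proof.
elim: n F E Q i j => [|n IH] F E Q i j ij aE; last first.
  by apply: IH (cok_ses ij) _ => m; exact: (aE m.+1).
have a1 : acyc0 (cok E) by exact: (aE 1).
rewrite /= (acyc0_sec_onto (cok_ses ij) a1); split=> [jo c sc|aQ c sc].
  have [d sd hd] := jo c sc; have [e he] := aE 0 d sd.
  by exists (fun x => j x (e x)) => x; rewrite -hd he [LHS]cokmapE.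
have [q hq] := aQ c sc.
have [e he] := choice_dep (fun x : T => let: And3 _ _ o := ij x in o (q x)).
exists (fun x => gcl (trunc x (e : dprod E))).
  by move=> x y xy; rewrite [LHS]cok_resE.
move=> x; rewrite hq [LHS]cokmapE; congr gcl.
by apply: dprodP => y; exact: he.
Qed.

(* Satisfied when [D -> god D] splits; the formula below makes the property pass to
   [cok D], which the existence of a natural splitting does not obviously do. *)
Definition csplit D := exists eps : forall x, {additive cok D x -> D x},
  forall x (c : cok D x),
    c = gcl ((fun y : up x => eps (sval y) (d_res (cok D) (proj2_sig y) c)) : god D x).

Lemma csplit_acyc0 D : csplit D -> acyc0 D.
Proof.
move=> [eps h] c sc; exists (fun x => eps x (c x)) => x.
rewrite {1}(h x (c x)); congr gcl; apply: dprodP => y.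
by rewrite (sc _ _ (proj2_sig y)).
Qed.

Lemma csplit_cok D : csplit D -> csplit (cok D).
Proof.
move=> [eps h].
(* [e] compares [g (base x)] with the class rebuilt from [g] by [eps]. It vanishes on [eta] by the
   formula for [D], so it descends to the map required on [cok (cok D)]. *)
pose e x (g : god (cok D) x) : cok D x :=
  g (base x) - gcl ((fun y : up x => eps (sval y) (g y)) : god D x).
have ea x : zmod_morphism (@e x).
  move=> g g'; rewrite /e [LHS](_ : _ = (g (base x) - g' (base x)) -
    (gcl ((fun y : up x => eps (sval y) (g y)) : god D x) -
     gcl ((fun y : up x => eps (sval y) (g' y)) : god D x))).
    by rewrite !opprD !opprK addrACA.
  congr (_ - _); rewrite -raddfB; congr gcl; apply: dprodP => y.
  by rewrite [in LHS]raddfB.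
pose ep x : {additive god (cok D) x -> cok D x} := mkadd (ea x).
have e0 x g : lsub_img (@eta (cok D) x) g -> ep x g = 0.
  move=> [c <-]; rewrite -[LHS]/(e x (eta c)) /e eta_base; apply/eqP; rewrite subr_eq0.
  by apply/eqP; rewrite {1}(h x c).
pose eps' x : {additive cok (cok D) x -> cok D x} := mkadd (qlift_additive (e0 x)).
exists eps' => x c; have [g <-] := gcl_onto c.
pose w : god D x := fun y => eps (sval y) (g y).
rewrite (_ : (fun y => _) = g - @eta (cok D) x (gcl w)).
  by rewrite raddfB /= gcl_eta subr0.
apply: dprodP => y; rewrite cok_resE [LHS](qliftE (e0 _)) dprodB.
rewrite [LHS]/(_ - _) [X in _ = _ - X]cok_resE; congr (_ - _).
case: y => y xy; rewrite /god_res /up_res /=.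
by congr (g (exist _ _ _)); exact: Prop_irrelevance.
Qed.

Lemma csplit_acyc D : csplit D -> forall n, acyc n D.
Proof.
move=> h n; elim: n D h => [|n IH] D h; first exact: csplit_acyc0.
by apply: IH; exact: csplit_cok.
Qed.

Lemma split_csplit D (r : forall x, {additive god D x -> D x}) :
  (forall x y (h : le x y) g, r y (god_res h g) = d_res D h (r x g)) ->
  (forall x v, r x (eta v) = v) -> csplit D.
Proof.
move=> rn re.
(* By naturality of [r], the representative [g - eta (r x g)] of the class of [g] has as component
   at [y] the value of [e] on the restriction of [g] to the points above [y]. *)
pose e x (g : god D x) : D x := g (base x) - r x g.
have ea x : zmod_morphism (@e x).
  by move=> g g'; rewrite /e dprodB raddfB !opprD !opprK addrACA.
pose ep x : {additive god D x -> D x} := mkadd (ea x).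
have e0 x g : lsub_img (@eta D x) g -> ep x g = 0.
  by move=> [c <-]; rewrite -[LHS]/(e x (eta c)) /e eta_base re subrr.
pose eps x : {additive cok D x -> D x} := mkadd (qlift_additive (e0 x)).
exists eps => x c; have [g <-] := gcl_onto c.
rewrite (_ : (fun y => _) = g - eta (r x g)).
  by rewrite raddfB /= gcl_eta subr0.
apply: dprodP => y; rewrite cok_resE [LHS](qliftE (e0 _)) dprodB.
rewrite [LHS]/(_ - _) rn; congr (_ - _).
case: y => y xy; rewrite /god_res /up_res /=.
by congr (g (exist _ _ _)); exact: Prop_irrelevance.
Qed.

(** At a single point g -> [g (base x)] retracts [eta], so [cok D x] is a retract of the finite
    product [god D x]. These retractions need not commute with restriction maps. *)
Lemma flat_cok D : (forall x, flat_module (D x)) -> forall x, flat_module (cok D x).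
Proof.
move=> fD x.
pose s (g : god D x) : god D x := g - eta (g (base x)).
have sl : linear s.
  move=> a g g'; apply: dprodP => y; rewrite /s.
  rewrite !(dprodD, dprodN, dprodZ) /eta linearP scalerBr opprD addrACA.
  by [].
have s0 g : lsub_img (@eta D x) g -> mklin sl g = 0.
  by move=> [v <-]; rewrite -[LHS]/(s (eta v)) /s eta_base subrr.
apply: (flat_retract (i := mklin (qlift_linear s0)) (r := @gcl D x)).
  move=> c; have [g <-] := gcl_onto c; rewrite -[LHS]/(gcl (qlift (mklin sl) (qcl _ g))) (qliftE s0).
  by rewrite -[LHS]/(gcl (g - eta (g (base x)))) raddfB /= gcl_eta subr0.
by apply: flat_dprod => [|y]; [exact: up_fin|exact: fD].
Qed.

(* The chains starting at [x] have at most [n] elements. *)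
Fixpoint low n (x : T) : Prop :=
  if n is m.+1 then forall y, le x y -> x <> y -> low m y else False.

Fixpoint cokn n D := if n is m.+1 then cokn m (cok D) else D.

(** If D vanishes strictly above [x], then [god D x] reduces to [D x] and [cok D] vanishes at [x].
    Each cokernel thus gains one level of the poset. *)
Lemma cokn_low n m D : (forall x, low m x -> forall v : D x, v = 0) ->
  forall x, low (m + n) x -> forall v : cokn n D x, v = 0.
Proof.
elim: n m D => [|n IH] m D hD x; first by rewrite addn0; exact: hD.
rewrite addnS -addSn; apply: IH => {}x lx c.
have [g <-] := gcl_onto c; apply/gcl_eq0; exists (g (base x)).
apply: dprodP => -[y xy]; have [e|ne] := pselect (x = y).
  subst y; rewrite /eta d_id; congr (g (exist _ _ _)); exact: Prop_irrelevance.
have h0 := hD _ (lx y xy ne).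
exact: etrans (h0 _) (esym (h0 _)).
Qed.

Lemma low_bound : exists n, forall x, low n x.
Proof.
have [s [us cs]] := fin_enum (fp_fin T).
pose m (x : T) := count (fun y : {classic T} => `[< le x y >]) s.
have lt x y : le x y -> x <> y -> (m y < m x)%N.
  move=> xy ne; rewrite /m -!size_filter.
  have sub : {subset [seq z : {classic T} <- s | `[< le y z >]] <=
      [seq z : {classic T} <- s | `[< le x z >]]}.
    move=> z; rewrite !mem_filter => /andP[/asboolP yz ->]; rewrite andbT.
    by apply/asboolP; exact: fp_trans yz.
  rewrite ltn_neqAle uniq_leq_size ?filter_uniq // andbT.
  apply/negP => /eqP e.
  have [_ /(_ (x : {classic T}))] := uniq_min_size (filter_uniq _ us) sub (eq_leq (esym e)).
  rewrite !mem_filter cs !andbT (asboolT (fp_refl x)) => /asboolP yx.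
  by apply: ne; exact: fp_anti.
(* One more than the number of points, because [low 0] holds nowhere; the induction is on the number
   [m x] of points above [x]. *)
exists (size s).+1 => x.
have : (m x < (size s).+1)%N by rewrite ltnS count_size.
elim: (size s).+1 x => // n IH x mx y xy ne /=.
by apply: IH; apply: leq_trans (lt _ _ xy ne) _.
Qed.

Lemma cokn_eq0 D : exists n, forall x (v : cokn n D x), v = 0.
Proof.
have [n hn] := low_bound; exists n => x; exact: (@cokn_low n 0).
Qed.

(** * Limits of acyclic flat diagrams and tensor products *)

Section Limit.
Variable D : diagram R T.

Definition sec_mod : lsubmod (dprod D).
Proof.
exists (@is_sec D) => [x y h|f g sf sg x y h|a f sf x y h]; first exact: raddf0.
  by rewrite dprodD linearD sf sg.
by rewrite dprodZ linearZ /= sf.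
Defined.

End Limit.

(** The last arrow of 0 -> Gamma(D) -> [dprod D] -> Gamma([cok D]): the sequence is exact by
    [cosec_eq0], and also on the right when [acyc0 D] holds. *)
Definition cosec_fun D (f : dprod D) : lsub_type (sec_mod (cok D)) :=
  @LSubType _ _ (sec_mod (cok D)) (fun x => gcl (trunc x f))
    (fun x y h => cok_resE h (trunc x f)).
Fact cosec_linear D : linear (@cosec_fun D).
Proof.
move=> a f g; apply: lsub_val_inj; apply: dprodP => x /=.
exact: (linearP (@gcl D x \o trunc x)).
Qed.
Definition cosec D : {linear dprod D -> lsub_type (sec_mod (cok D))} :=
  mklin (@cosec_linear D).

Lemma cosec_onto D : acyc0 D -> onto (cosec D).
Proof.
move=> aD [c sc]; have [f hf] := aD c sc; exists f.
by apply: lsub_val_inj; apply: dprodP => x; exact/esym/hf.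
Qed.

Lemma cosec_eq0 D f : cosec D f = 0 <-> is_sec f.
Proof.
split=> [e|sf]; last first.
  by apply: lsub_val_inj; apply: dprodP => x; exact: gcl_sec.
apply: sec_gcl0 => x.
exact: (congr1 (fun c : lsub_type (sec_mod (cok D)) => lsub_val c x) e).
Qed.

(** Gamma(D) is the kernel of a surjection from the flat module [dprod D] onto Gamma([cok D]). The
    induction climbs back from the iterated cokernel that vanishes. *)
Lemma flat_sec n D : (forall x, flat_module (D x)) -> (forall m, acyc m D) ->
  (forall x (v : cokn n D x), v = 0) -> flat_module (lsub_type (sec_mod D)).
Proof.
elim: n D => [|n IH] D fD aD D0.
  apply: flat_zero => s; apply: lsub_val_inj; apply: dprodP => x; exact: D0.
apply: (flat_kernel (i := @lsub_val _ _ (sec_mod D)) (p := cosec D)).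
- exact: lsub_val_inj.
- move=> f; rewrite cosec_eq0; split=> [sf|[[g sg] <-]] //.
  by exists (LSubType (sf : sec_mod D f)).
- exact: cosec_onto (aD 0).
- by apply: flat_dprod => //; exact: fp_fin.
- by apply: IH D0 => [|m]; [exact: flat_cok|exact: (aD m.+1)].
Qed.

Section LimitTensor.
Variables (D : diagram R T) (L N : lmodType R) (lam : forall x, {linear L -> D x}).
Hypotheses (fD : forall x, flat_module (D x)) (aD : forall m, acyc m D).
Hypotheses (lam_inj : forall l, (forall x, lam x l = 0) -> l = 0)
  (lam_sec : forall l, @is_sec D (fun x => lam x l))
  (lam_onto : forall f : dprod D, is_sec f -> exists l, forall x, lam x l = f x).

Definition lim_map (l : L) : dprod D := fun x => lam x l.
Fact lim_map_linear : linear lim_map.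
Proof. by move=> a l m; apply: dprodP => x; rewrite /lim_map linearP. Qed.
HB.instance Definition _ := GRing.isLinear.Build R L (dprod D) *:%R lim_map
  lim_map_linear.

Lemma lim_map_inj : injective lim_map.
Proof.
apply: raddf_inj => l l0; apply: lam_inj => x.
exact: (congr1 (fun f : dprod D => f x) l0).
Qed.

Lemma lim_map_exact : exact_at lim_map (cosec D).
Proof.
move=> f; rewrite cosec_eq0; split=> [/lam_onto[l hl]|[l <-]]; last exact: lam_sec.
by exists l; apply: dprodP.
Qed.

Lemma flat_cosec : flat_module (lsub_type (sec_mod (cok D))).
Proof.
have [n hn] := cokn_eq0 (cok D); apply: flat_sec hn => [|m]; first exact: flat_cok.
exact: (aD m.+1).
Qed.

(** 0 -> L -> [dprod D] -> Gamma([cok D]) -> 0 is exact with flat last term, hence stays exact on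
    the left after tensoring with any N. *)
Lemma lim_tens_inj (t : tensor L N) :
  (forall x, tmap (lam x) idfun t = 0) -> t = 0.
Proof.
move=> t0.
apply: (tmap_inj_flat_coker lim_map_inj lim_map_exact (cosec_onto (aD 0)) flat_cosec).
rewrite raddf0; apply: dprod_tens_eq0l => [|x]; first exact: fp_fin.
by rewrite (tmap_comp (w := lam x) (z := idfun)).
Qed.

(** Right exactness reduces the claim to the vanishing of the image of [s] in Gamma([cok D]) (x) N.
    That module embeds in [dprod (cok D)] (x) N because Gamma([cok (cok D)]) is flat, so the
    vanishing is tested point by point. *)
Lemma lim_tens_onto (t : forall x, tensor (D x) N) :
  (forall x y (h : le x y), tmap (d_res D h) idfun (t x) = t y) ->
  exists s : tensor L N, forall x, tmap (lam x) idfun s = t x.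
Proof.
move=> ct; have [s hs] := dprod_tens_onto (fp_fin T) t.
suff /(tmapl_exact lim_map_exact (cosec_onto (aD 0)))[l hl] : tmap (cosec D) idfun s = 0.
  exists l => x; rewrite -hs -hl.
  by rewrite (tmap_comp (w := lam x) (z := idfun)).
have aD1 m : acyc m (cok D) by exact: (aD m.+1).
have [n hn] := cokn_eq0 (cok (cok D)).
have fc : flat_module (lsub_type (sec_mod (cok (cok D)))).
  by apply: flat_sec hn => [|m]; [do 2!apply: flat_cok|exact: (aD m.+2)].
pose v := @lsub_val _ _ (sec_mod (cok D)).
have vex : exact_at v (cosec (cok D)).
  move=> f; rewrite cosec_eq0; split=> [sf|[[g sg] <-]] //.
  by exists (LSubType (sf : sec_mod (cok D) f)).
apply: (tmap_inj_flat_coker (@lsub_val_inj _ _ (sec_mod (cok D))) vex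
  (cosec_onto (aD1 0)) fc).
rewrite raddf0; apply: dprod_tens_eq0l => [|x]; first exact: fp_fin.
pose gt : {linear dprod D -> cok D x} := @gcl D x \o trunc x.
rewrite (tmap_comp (w := @dproj _ _ _ x \o v) (z := idfun)) //.
rewrite (tmap_comp (w := gt) (z := idfun)) //.
rewrite -(tmap_comp (u := trunc x) (v := idfun) (u' := @gcl D x) (v' := idfun)) //.
(* Compatibility of the family says that above [x] the tensor [s] is the image of [t x] under [eta],
   which [gcl] kills. *)
have -> : tmap (trunc x) idfun s = tmap (@eta D x) idfun (t x).
  apply/eqP; rewrite -subr_eq0; apply/eqP; apply: dprod_tens_eq0l => [|y]; first exact: up_fin.
  rewrite raddfB /= (tmap_comp (w := @dproj _ _ _ (sval y)) (z := idfun)) //.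
  rewrite (tmap_comp (w := d_res D (proj2_sig y)) (z := idfun)) //.
  by rewrite hs ct subrr.
rewrite (tmap_comp (w := \0) (z := idfun)) ?raddf0 // => [|w]; last exact: gcl_eta.
by move: (t x) => r; tens_elim r; rewrite tmapE tens0l.
Qed.
End LimitTensor.
End Diagrams.

(** * Injective resolutions *)

Section KernelDiagram.
Variables (R : comPzRingType) (T : fposet) (D E : diagram R T) (u : dmor D E).
Local Notation le := (@fp_le T).

Definition dker_st x : lmodType R := lsub_type (lsub_ker (u x)).

Fact dker_res_proof x y (h : le x y) (v : dker_st x) :
  lsub_ker (u y) (d_res D h (lsub_val v)).
Proof. by rewrite /= dm_res (lsub_valP v) raddf0. Qed.
Definition dker_res_fun x y (h : le x y) (v : dker_st x) : dker_st y :=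
  LSubType (dker_res_proof h v).
Fact dker_res_linear x y (h : le x y) : linear (dker_res_fun h).
Proof. by move=> a v w; apply: lsub_val_inj; rewrite /= linearP. Qed.
Definition dker_res x y (h : le x y) : {linear dker_st x -> dker_st y} :=
  mklin (dker_res_linear h).

Fact dker_id x (h : le x x) v : dker_res h v = v.
Proof. by apply: lsub_val_inj; exact: d_id. Qed.
Fact dker_comp x y z (xy : le x y) (yz : le y z) (xz : le x z) v :
  dker_res yz (dker_res xy v) = dker_res xz v.
Proof. by apply: lsub_val_inj; exact: d_comp. Qed.
Definition dker : diagram R T := Diagram dker_id dker_comp.

Definition dker_incl : dmor dker D :=
  @DMor R T dker D (fun x => @lsub_val _ _ (lsub_ker (u x))) (fun _ _ _ _ => erefl).

Variables (C : diagram R T) (d : dmor C D).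
Hypothesis dd : forall x v, u x (d x v) = 0.

Definition dker_lift_fun x (v : C x) : dker x := @LSubType _ _ (lsub_ker (u x)) _ (dd v).
Fact dker_lift_linear x : linear (@dker_lift_fun x).
Proof. by move=> a v w; apply: lsub_val_inj; rewrite /= linearP. Qed.
Fact dker_lift_res x y (h : le x y) v :
  mklin (@dker_lift_linear y) (d_res C h v) = d_res dker h (mklin (@dker_lift_linear x) v).
Proof. by apply: lsub_val_inj; exact: dm_res. Qed.
Definition dker_lift : dmor C dker := DMor dker_lift_res.
End KernelDiagram.

Section ResolutionDiagram.
Variables (R : comPzRingType) (T : fposet).

Lemma dker_ses (F C D E : diagram R T) (w : dmor F C) (d : dmor C D) (u : dmor D E)
    (dd : forall x v, u x (d x v) = 0) :
  (forall x, injective (w x)) -> (forall x, exact_at (w x) (d x)) ->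
  (forall x, exact_at (d x) (u x)) -> ses w (dker_lift dd).
Proof.
move=> wi wd du x; split=> [//|v|v].
  rewrite -(wd x v); split=> [e|e]; last exact: lsub_val_inj.
  exact: (congr1 (@lsub_val _ _ _) e).
have [c cv] := (du x (lsub_val v)).1 (lsub_valP v).
by exists c; apply: lsub_val_inj.
Qed.

(** Dimension shift along F -> C 0 -> ker (d 1), the kernel being resolved by the complex shifted by
    one. The left side does not see the resolution, so any two resolutions of this kind detect the
    same vanishing. *)
Lemma acyc_resolution n (C : nat -> diagram R T) (d : forall n, dmor (C n) (C n.+1))
    (F : diagram R T) (w : dmor F (C 0)) :
  (forall m, csplit (C m)) -> (forall x, injective (w x)) ->
  (forall x, exact_at (w x) (d 0 x)) ->
  (forall m x, exact_at (d m x) (d m.+1 x)) ->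
  acyc n F <-> forall s : dprod (C n.+1), is_sec s -> (forall x, d n.+1 x (s x) = 0) ->
    exists2 t : dprod (C n), is_sec t & forall x, d n x (t x) = s x.
Proof.
elim: n C d F w => [|n IH] C d F w spl wi w0 dex; last first.
  have dd x v : d 1 x (d 0 x v) = 0 by apply/(dex 0 x _).2; exists v.
  rewrite (acyc_shift n (dker_ses dd wi w0 (dex 0)) (csplit_acyc (spl 0))).
  apply: (IH (fun m => C m.+1) (fun m => d m.+1) _ (dker_incl (d 1))) => //.
    by move=> x; exact: lsub_val_inj.
  move=> x v; split=> [e|[[u hu] <-] //].
  by exists (LSubType (e : lsub_ker (d 1 x) v)).
have dd x v : d 1 x (d 0 x v) = 0 by apply/(dex 0 x _).2; exists v.
rewrite [acyc 0 F](acyc0_sec_onto (dker_ses dd wi w0 (dex 0)) (csplit_acyc (spl 0) 0)).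
split=> [h s ss s0|h s ss].
    have sk : is_sec ((fun x => LSubType (s0 x : lsub_ker (d 1 x) (s x))) : dprod (dker (d 1))).
      by move=> x y xy; apply: lsub_val_inj; exact: ss.
    have [t st ht] := h _ sk; exists t => // x.
    exact: (congr1 (@lsub_val _ _ _) (ht x)).
  have [||t st ht] := h (fun x => lsub_val (s x)).
  - by move=> x y xy; exact: (congr1 (@lsub_val _ _ _) (ss x y xy)).
  - by move=> x; exact: (lsub_valP (s x)).
  - by exists t => // x; apply: lsub_val_inj; exact: ht.
Qed.
End ResolutionDiagram.

Section Representatives.
Variable T : topologicalType.
Implicit Types x y : T.

Definition spclass x : set T := [set y | sple x y /\ sple y x].

Fact spclass_ex x : exists y, spclass x y.
Proof. by exists x; split; exact: sple_refl. Qed.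

Definition sprep x : T := sval (cid (spclass_ex x)).

Lemma sprep_ge x : sple x (sprep x).
Proof. by rewrite /sprep; case: cid => y []. Qed.
Lemma sprep_le x : sple (sprep x) x.
Proof. by rewrite /sprep; case: cid => y []. Qed.

Arguments sprep_ge : clear implicits.
Arguments sprep_le : clear implicits.

Lemma sprep_eq x y : sple x y -> sple y x -> sprep x = sprep y.
Proof.
move=> xy yx; rewrite /sprep.
have e : spclass x = spclass y.
  by apply/seteqP; split=> z [h1 h2]; split; apply: sple_trans; eassumption.
by move: (spclass_ex x) (spclass_ex y); rewrite e => p q; rewrite (Prop_irrelevance p q).
Qed.

Lemma sprepK x : sprep (sprep x) = sprep x.
Proof. exact: sprep_eq (sprep_le x) (sprep_ge x). Qed.
End Representatives.
Arguments sprep_ge {T} x.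
Arguments sprep_le {T} x.

Section ModuleDiagram.
Variables (k : comPzRingType) (Y : rfspace k) (U : set Y).
Hypothesis Uup : forall x y, U x -> sple x y -> U y.

(* A finite space need not be T0: diagrams are taken on representatives, which form a
   poset, so that iterated cokernels eventually vanish. *)
Definition rep_pt := {w : Y | U w /\ sprep w = w}.
Definition rep_le (a b : rep_pt) := sple (sval a) (sval b).

Fact rep_anti a b : rep_le a b -> rep_le b a -> a = b.
Proof.
case: a b => [a [ua ra]] [b [ub rb]]; rewrite /rep_le /= => ab ba.
have e : a = b by rewrite -ra -rb; exact: sprep_eq.
by subst b; rewrite (Prop_irrelevance ua ub) (Prop_irrelevance ra rb).
Qed.

Fact rep_fin : finite_set [set: rep_pt].
Proof.
have := @finite_preimage _ _ [set: Y] (fun y : rep_pt => sval y).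
rewrite preimage_setT; apply; last exact: rf_finite.
by move=> [y hy] [z hz] _ _ /= e; subst z; rewrite (Prop_irrelevance hy hz).
Qed.

Definition rep_poset : fposet :=
  @FPoset rep_pt rep_le (fun a => @sple_refl _ (sval a))
    (fun a b c => @sple_trans _ (sval a) (sval b) (sval c)) rep_anti rep_fin.

Lemma rep_in (a : rep_pt) : U (sval a).
Proof. by case: a => a []. Qed.

Definition to_rep x (ux : U x) : rep_pt :=
  exist _ (sprep x) (conj (Uup ux (sprep_ge x)) (sprepK x)).

Variables (R : comPzRingType) (rho : forall w, U w -> {rmorphism R -> ostalk w}).
Hypothesis rho_res : forall w w' (uw : U w) (uw' : U w') (h : sple w w') a,
  ores h (rho uw a) = rho uw' a.

Section One.
Variable F : omodule Y.

Definition md_st (a : rep_poset) : lmodType R := rscal (rho (rep_in a)) (mstalk F (sval a)).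

Definition md_res_fun (a b : rep_poset) (h : fp_le a b) (v : md_st a) : md_st b :=
  mres F h v.
Fact md_res_linear a b (h : fp_le a b) : linear (@md_res_fun a b h).
Proof.
move=> c v w; rewrite /md_res_fun raddfD /=; congr (_ + _).
rewrite -[X in mres F h X]/(rho (rep_in a) c *: (v : mstalk F (sval a))) linearZ /=.
by rewrite (rho_res _ (rep_in b)).
Qed.
Definition md_res a b (h : fp_le a b) : {linear md_st a -> md_st b} :=
  mklin (@md_res_linear a b h).

Fact md_id a (h : fp_le a a) v : md_res h v = v.
Proof. exact: mres_id. Qed.
Fact md_comp (a b c : rep_poset) (ab : fp_le a b) (bc : fp_le b c) (ac : fp_le a c) v :
  md_res bc (md_res ab v) = md_res ac v.
Proof. exact: mres_comp. Qed.
Definition mdiag : diagram R rep_poset := Diagram md_id md_comp.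

Lemma mdiag_sec (s : msect F U) : @is_sec _ _ mdiag (fun a => s (sval a) (rep_in a)).
Proof. by move=> a b h; exact: ms_res. Qed.

Lemma mdiag_sec_inj (s t : msect F U) :
  (forall a : rep_pt, s (sval a) (rep_in a) = t (sval a) (rep_in a)) -> s = t.
Proof.
move=> h; apply: msectP => p up.
have e (x : msect F U) : x p up = mres F (sprep_le p) (x (sprep p) (rep_in (to_rep up))).
  by rewrite ms_res.
by rewrite (e s) (e t); congr (mres F _ _); exact: (h (to_rep up)).
Qed.

Lemma mdiag_sec_onto (f : dprod mdiag) : is_sec f ->
  exists s : msect F U, forall a : rep_pt, s (sval a) (rep_in a) = f a.
Proof.
move=> sf.
pose g p (up : U p) : mstalk F p := mres F (sprep_le p) (f (to_rep up)).
have gP p q (up : U p) (uq : U q) (h : sple p q) : mres F h (g p up) = g q uq.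
  have pq : @fp_le rep_poset (to_rep up) (to_rep uq).
    exact: sple_trans (sple_trans (sprep_le p) h) (sprep_ge q).
  rewrite /g -(sf _ _ pq) (mres_comp _ _ (sple_trans (sprep_le p) h)).
  by rewrite [RHS](mres_comp _ _ (sple_trans (sprep_le p) h)).
exists (MSect gP) => a; rewrite /= /g.
have ha : @fp_le rep_poset (to_rep (rep_in a)) a by exact: sprep_le.
rewrite -[RHS](sf _ _ ha).
exact: (congr1 (fun h => mres F h (f _)) (Prop_irrelevance _ _)).
Qed.
End One.

Section Map.
Variables (F G : omodule Y) (u : omor F G).

Definition mdmap_fun (a : rep_poset) (v : mdiag F a) : mdiag G a := u (sval a) v.
Fact mdmap_linear a : linear (@mdmap_fun a).
Proof.
move=> c v w; rewrite /mdmap_fun raddfD /=; congr (_ + _).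
exact: (linearZZ (u (sval a)) (rho (rep_in a) c) v).
Qed.
Fact mdmap_res a b (h : fp_le a b) v :
  mklin (@mdmap_linear b) (d_res (mdiag F) h v) = d_res (mdiag G) h (mklin (@mdmap_linear a) v).
Proof. exact: om_res. Qed.
Definition mdmap : dmor (mdiag F) (mdiag G) := DMor mdmap_res.
End Map.

Section Injective.
Variable E : omodule Y.

(** The Godement construction inside O-modules and over all points of Y, representatives or not,
    because injectivity of [E] is a statement about O-modules on Y. *)
Definition ogod_st (p : Y) : lmodType (ostalk p) :=
  dprod (fun z : {y | sple p y} => rscal (ores (proj2_sig z)) (mstalk E (sval z))).

Definition ogod_res_fun p q (h : sple p q) (g : ogod_st p) : ogod_st q :=
  fun z => g (exist _ (sval z) (sple_trans h (proj2_sig z))).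
Fact ogod_res_linear p q (h : sple p q) :
  linear_for (ores h \; *:%R) (ogod_res_fun h).
Proof.
move=> a f g; apply: dprodP => z; rewrite /ogod_res_fun !dprodD !dprodZ; congr (_ + _).
exact: (congr1 (fun c => c *: (f (exist _ (sval z) _) : mstalk E (sval z)))
  (esym (ores_comp h (proj2_sig z) (sple_trans h (proj2_sig z)) a))).
Qed.
Definition ogod_res p q (h : sple p q) :
    {linear ogod_st p -> ogod_st q | ores h \; *:%R} := mklin (ogod_res_linear h).
Fact ogod_id p (h : sple p p) g : ogod_res h g = g.
Proof.
apply: dprodP => -[y py] /=; congr (g (exist _ _ _)); exact: Prop_irrelevance.
Qed.
Fact ogod_comp p q r (pq : sple p q) (qr : sple q r) (pr : sple p r) g :
  ogod_res qr (ogod_res pq g) = ogod_res pr g.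
Proof.
apply: dprodP => -[y py] /=; congr (g (exist _ _ _)); exact: Prop_irrelevance.
Qed.
Definition ogod : omodule Y := OModule ogod_id ogod_comp.

Definition oeta_fun p (v : mstalk E p) : ogod_st p := fun z => mres E (proj2_sig z) v.
Fact oeta_linear p : linear (@oeta_fun p).
Proof. by move=> a v w; apply: dprodP => z; rewrite /oeta_fun linearP. Qed.
Fact oeta_res p q (h : sple p q) v :
  mklin (@oeta_linear q) (mres E h v) = mres ogod h (mklin (@oeta_linear p) v).
Proof.
apply: dprodP => z; exact: mres_comp.
Qed.
Definition oeta : omor E ogod := @OMor _ _ E ogod (fun p => mklin (@oeta_linear p)) oeta_res.

(** Extending the identity of [E] along the monomorphism [oeta] gives a retraction that commutes
    with restrictions, which is what [split_csplit] asks for. *)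
Lemma injective_csplit : injective_omodule E -> csplit (mdiag E).
Proof.
move=> iE.
have mono : omono oeta.
  move=> p v w /(congr1 (fun g : ogod_st p => g (exist _ p (@sple_refl _ p)))).
  by rewrite [LHS]mres_id [RHS]mres_id.
pose idE : omor E E := @OMor _ _ E E (fun p => idfun) (fun _ _ _ _ => erefl).
have [h hE] := iE E ogod oeta idE mono.
(* A family on representatives is spread to all points above by the restrictions from each
   representative to the points indistinguishable from it. *)
pose ext (a : rep_poset) (g : god (mdiag E) a) : ogod_st (sval a) := fun z =>
  mres E (sprep_le (sval z)) (g (exist _ (to_rep (Uup (rep_in a) (proj2_sig z)))
    (sple_trans (proj2_sig z) (sprep_ge (sval z))))).
have ext_add a : zmod_morphism (ext a).
  by move=> g g'; apply: dprodP => z; rewrite /ext dprodB raddfB.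
pose r a : {additive god (mdiag E) a -> mdiag E a} :=
  (h (sval a) : {additive ogod_st (sval a) -> mstalk E (sval a)}) \o mkadd (ext_add a).
have irr (a : rep_poset) (g : god (mdiag E) a) y (u u' : U y)
    (l : fp_le a (to_rep u)) (l' : fp_le a (to_rep u')) :
    (g (exist _ (to_rep u) l) : mstalk E (sprep y)) = g (exist _ (to_rep u') l').
  by move: l; rewrite (Prop_irrelevance u u') => l; rewrite (Prop_irrelevance l l').
apply: (split_csplit (r := r)).
  move=> a b ab g.
  rewrite [RHS](_ : _ = h (sval b) (ogod_res ab (ext a g))); last by rewrite om_res.
  rewrite [LHS]/(h _ (ext b _)); congr (h _ _); apply: dprodP => -[y hy].
  rewrite /ext /ogod_res_fun /god_res /up_res /=; congr (mres _ _ _).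
  exact: irr.
move=> a v; rewrite [LHS]/(h _ (ext a _)) -[RHS](hE _ v); congr (h _ _).
apply: dprodP => -[y hy]; exact: mres_comp.
Qed.
End Injective.

Definition sect_exact (C : ocomplex Y) n := forall s : msect (C n.+1) U,
  msect_map (oc_d C n.+1) s = 0 -> exists t, msect_map (oc_d C n) t = s.

(** The left side does not involve [E] and the right side involves neither [R] nor [rho]. Vanishing
    can therefore be moved between injective resolutions and between base rings. *)
Lemma acyc_sect_exact (F : omodule Y) (E : injective_resolution F) n :
  acyc n (mdiag F) <-> sect_exact E n.
Proof.
rewrite (acyc_resolution n (C := fun m => mdiag (E m)) (d := fun m => mdmap (oc_d E m))
  (w := mdmap (ir_aug E))).
- split=> [h s s0|h s ss s0].
    have [|t st ht] := h _ (mdiag_sec s).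
      by move=> a; exact: (congr1 (fun r : msect _ _ => r (sval a) (rep_in a)) s0).
    have [t' ht'] := mdiag_sec_onto st; exists t'; apply: mdiag_sec_inj => a.
    by rewrite -[RHS]ht -[RHS]/(oc_d E n (sval a) (t a)) -ht'.
  have [s' hs'] := mdiag_sec_onto ss.
  have [|t ht] := h s'.
    by apply: mdiag_sec_inj => a; rewrite -[RHS](s0 a) -hs'.
  exists (fun a => t (sval a) (rep_in a)); first exact: mdiag_sec.
  by move=> a; rewrite -hs' -ht.
- by move=> m; apply: injective_csplit; exact: ir_inj.
- by move=> a v w; exact: (@ir_aug_mono _ _ _ E (sval a) v w).
- by move=> a v; exact: (@ir_exact0 _ _ _ E (sval a) v).
- by move=> m a v; exact: (@ir_exact _ _ _ E m (sval a) v).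
Qed.

End ModuleDiagram.

(** * Base change *)

(** A separate name for the tensor product, to which the action of [S] on the first factor is
    attached. *)
Definition base_change (R S : comPzRingType) (f : {rmorphism R -> S}) (N : lmodType R)
  : Type := tensor (rscal f S^o) N.

Section BaseChange.
Variables (R S : comPzRingType) (f : {rmorphism R -> S}).

Section Module.
Variable N : lmodType R.
HB.instance Definition _ := GRing.Zmodule.on (base_change f N).

Definition btens (s : S) (n : N) : base_change f N := @tens R (rscal f S^o) N s n.

Lemma btensDl s s' n : btens (s + s') n = btens s n + btens s' n.
Proof. exact: tensDl. Qed.
Lemma btensDr s n n' : btens s (n + n') = btens s n + btens s n'.
Proof. exact: tensDr. Qed.
Lemma btensZ r s n : btens s (r *: n) = btens (s * f r) n.
Proof. by rewrite mulrC; exact/esym/(@tensZ R (rscal f S^o) N). Qed.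

Fact bmul_linear (a : S) : linear ( *%R a : rscal f S^o -> rscal f S^o).
Proof.
move=> c x y; rewrite mulrDr; congr (_ + _).
exact: (mulrCA a (f c) x).
Qed.
Definition bscale (a : S) : base_change f N -> base_change f N :=
  tmap (mklin (bmul_linear a)) idfun.
HB.instance Definition _ a := GRing.Additive.on (bscale a).

Lemma bscaleE a s n : bscale a (btens s n) = btens (a * s) n.
Proof. exact: tmapE. Qed.

Lemma btens_ind (P : base_change f N -> Prop) : P 0 ->
  (forall x y, P x -> P y -> P (x + y)) -> (forall s n, P (btens s n)) -> forall x, P x.
Proof. exact: tens_ind. Qed.

Fact bscaleA a b x : bscale a (bscale b x) = bscale (a * b) x.
Proof.
elim/btens_ind: x => [|x y hx hy|s n]; first by rewrite !raddf0.
  by rewrite !raddfD /= hx hy.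
by rewrite !bscaleE mulrA.
Qed.
Fact bscale1 : left_id 1 bscale.
Proof.
elim/btens_ind=> [|x y hx hy|s n]; first by rewrite !raddf0.
  by rewrite !raddfD /= hx hy.
by rewrite !bscaleE mul1r.
Qed.
Fact bscaleDr : right_distributive bscale +%R.
Proof. by move=> a x y; rewrite raddfD. Qed.
Fact bscaleDl x : {morph bscale^~ x : a b / a + b}.
Proof.
move=> a b; elim/btens_ind: x => [|x y hx hy|s n]; first by rewrite !raddf0 addr0.
  by rewrite !raddfD /= hx hy addrACA.
by rewrite !bscaleE mulrDl btensDl.
Qed.
HB.instance Definition _ := GRing.Zmodule_isLmodule.Build S (base_change f N)
  bscaleA bscale1 bscaleDr bscaleDl.

Lemma btens_scale a s n : a *: btens s n = btens (a * s) n.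
Proof. exact: bscaleE. Qed.

Fact btens1_linear : linear_for (f \; *:%R) (btens 1).
Proof. by move=> a m n; rewrite btensDr btensZ mul1r /= btens_scale mulr1. Qed.
Definition bunit : {linear N -> base_change f N | f \; *:%R} := mklin btens1_linear.

Variables (P : lmodType S) (phi : {linear N -> P | f \; *:%R}).

Fact bc_balanced : @balanced R (rscal f S^o) N P (fun s n => s *: phi n).
Proof.
split=> [n x y|s x y|c s n] /=; first by rewrite scalerDl.
  by rewrite raddfD scalerDr.
by rewrite linearZ /= scalerA mulrC.
Qed.
(** The [S]-linear map adjoint to the semilinear [phi]. That it is injective and onto means that P
    is S (x)_R N by way of [phi]. *)
Definition bc : base_change f N -> P := tbil bc_balanced.
HB.instance Definition _ := GRing.Additive.on bc.

Lemma bcE s n : bc (btens s n) = s *: phi n.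
Proof. exact: tbilE. Qed.

Lemma bc_scale a x : bc (a *: x) = a *: bc x.
Proof.
elim/btens_ind: x => [|x y hx hy|s n]; first by rewrite !(scaler0, raddf0).
  by rewrite scalerDr !raddfD /= hx hy.
by rewrite btens_scale !bcE scalerA.
Qed.
End Module.

Definition bmap (N N' : lmodType R) (u : {linear N -> N'}) :
  base_change f N -> base_change f N' := tmap idfun u.
HB.instance Definition _ N N' u := GRing.Additive.on (@bmap N N' u).

Lemma bmapE (N N' : lmodType R) (u : {linear N -> N'}) s n :
  bmap u (btens s n) = btens s (u n).
Proof. exact: tmapE. Qed.
End BaseChange.

Section Pushout.
Variables (R S R' S' : comPzRingType).
Variables (f : {rmorphism R -> S}) (g : {rmorphism R -> R'}).
Variables (f' : {rmorphism R' -> S'}) (g' : {rmorphism S -> S'}).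
Hypothesis comm : forall r, f' (g r) = g' (f r).

Fact pushout_linear :
  linear_for (f \; *:%R) (f' : rscal g R'^o -> rscal g' S'^o).
Proof.
move=> a x y; have := rmorphD f' (g a * x) y; rewrite rmorphM comm; exact.
Qed.
(** Its [bc] is the comparison S (x)_R R' -> S', so the two hypotheses that follow say that the
    square is a pushout of rings. *)
Definition pushout_map : {linear rscal g R'^o -> rscal g' S'^o | f \; *:%R} :=
  mklin pushout_linear.

Hypothesis mu_inj : injective (bc pushout_map).
Hypothesis mu_onto : onto (bc pushout_map).
Variable N : lmodType R'.

(* [theta] inverts [S (x)_R N -> S' (x)_R' N]. *)
Lemma pushout_base_change :
  exists theta : {additive base_change f' N -> base_change f (rscal g N)},
    forall s r n, theta (btens f' (g' s * f' r) n) = @btens _ _ f (rscal g N) s (r *: n : N).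
Proof.
have [ka hka] := choice mu_onto.
have kaK t : ka (bc pushout_map t) = t by apply: mu_inj; rewrite hka.
have kaD x y : ka (x + y) = ka x + ka y by apply: mu_inj; rewrite raddfD /= !hka.
have bl (n : N) : linear ((fun r : R' => r *: n) : rscal g R'^o -> rscal g N).
  by move=> a x y; have := scalerDl n (g a * x) y; rewrite -scalerA; exact.
pose be n : base_change f (rscal g R'^o) -> base_change f (rscal g N) := bmap (mklin (bl n)).
have beE n s r : be n (@btens _ _ f (rscal g R'^o) s r) = @btens _ _ f (rscal g N) s (r *: n : N) by exact: bmapE.
have beD n : {morph be n : x y / x + y} by move=> x y; exact: raddfD.
have be0 n : be n 0 = 0 by exact: raddf0.
have bb : @balanced R' (rscal f' S'^o) N _ (fun s n => be n (ka s)).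
  split=> [n x y|s m n|c s n]; first by rewrite kaD beD.
    elim/btens_ind: (ka s) => [|x y hx hy|a b]; first by rewrite !be0 addr0.
      by rewrite !beD hx hy addrACA.
    by rewrite !beE scalerDr btensDr.
  have ml : linear ( *%R c : rscal g R'^o -> rscal g R'^o).
    by move=> a x y; rewrite mulrDr; congr (_ + _); exact: (mulrCA c (g a) x).
  have E t : f' c * (bc pushout_map t : S') = bc pushout_map (bmap (f := f) (mklin ml) t).
    elim/btens_ind: t => [|x y hx hy|a b]; first by rewrite !raddf0 mulr0.
      by rewrite !raddfD /= -hx -hy [LHS]mulrDr.
    rewrite bmapE !bcE; apply: etrans (mulrCA (f' c) (g' a) (f' b)) _.
    exact: (congr1 ( *%R (g' a)) (esym (rmorphM f' c b))).
  rewrite -[s]hka; move: (ka s) => t.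
  have -> : c *: (bc pushout_map t : rscal f' S'^o) = bc pushout_map (bmap (f := f) (mklin ml) t).
    exact: E.
  rewrite !kaK; elim/btens_ind: t => [|x y hx hy|a b]; first by rewrite raddf0 !be0.
    by rewrite raddfD !beD hx hy.
  by rewrite bmapE !beE scalerA mulrC.
exists (tbil bb) => s r n.
have -> : g' s * f' r = bc pushout_map (btens f s (r : rscal g R'^o)) by rewrite bcE.
by rewrite [LHS]tbilE kaK beE.
Qed.

Variables (P : lmodType S') (phi : {linear N -> P | f' \; *:%R}).

Fact pushout_phi_linear :
  linear_for (f \; *:%R) (phi : rscal g N -> rscal g' P).
Proof.
move=> a m n; apply: etrans (raddfD phi (g a *: (m : N)) n) _; congr (_ + _).
have e : phi (g a *: (m : N)) = g' (f a) *: phi m by rewrite linearZ /= comm.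
exact: e.
Qed.
Definition pushout_phi : {linear rscal g N -> rscal g' P | f \; *:%R} :=
  mklin pushout_phi_linear.

Fact pushout_psi_balanced :
  @balanced R (rscal f S^o) (rscal g N) _ (fun s n => btens f' (g' s) (n : N)).
Proof.
split=> [m s s'|s m m'|c s m] /=.
- by rewrite rmorphD btensDl.
- by rewrite btensDr.
by rewrite -[c *: m]/(g c *: (m : N)) btensZ comm mulrC -rmorphM.
Qed.
Definition pushout_psi : base_change f (rscal g N) -> base_change f' N :=
  tbil pushout_psi_balanced.
HB.instance Definition _ := GRing.Additive.on pushout_psi.

Lemma pushout_psiE s n : pushout_psi (@btens _ _ f (rscal g N) s n) = btens f' (g' s) (n : N).
Proof. exact: tbilE. Qed.

Lemma bc_pushout_psi t : bc phi (pushout_psi t) = bc pushout_phi t.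
Proof.
elim/btens_ind: t => [|t t' ht ht'|s n]; first by rewrite !raddf0.
  by rewrite !raddfD /= ht ht'.
by rewrite pushout_psiE !bcE.
Qed.

(** S (x)_R N = S' (x)_R' N for a pushout square, so the comparison map of [phi] over R' becomes the
    one over R. *)
Lemma pushout_bc_inj : injective (bc phi) -> injective (bc pushout_phi).
Proof.
move=> phi_inj; have [th hth] := pushout_base_change.
have K t : th (pushout_psi t) = t.
  elim/btens_ind: t => [|t t' ht ht'|s n]; first by rewrite !raddf0.
    by rewrite !raddfD /= ht ht'.
  by rewrite pushout_psiE; have := hth s 1 n; rewrite rmorph1 mulr1 scale1r; exact.
apply: raddf_inj => t t0; rewrite -(K t).
suff -> : pushout_psi t = 0 by rewrite raddf0.
by apply: phi_inj; rewrite raddf0 bc_pushout_psi.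
Qed.

Lemma pushout_bc_onto : onto (bc phi) -> onto (bc pushout_phi).
Proof.
move=> phi_onto p; have [T <-] := phi_onto p; have [th hth] := pushout_base_change.
exists (th T); elim/btens_ind: T => [|t t' ht ht'|c n]; first by rewrite !raddf0.
  by rewrite !raddfD /= ht ht'.
have [tau <-] := mu_onto c; elim/btens_ind: tau => [|s s' hs hs'|s r].
- have e : btens f' (0 : S') n = 0 by exact: tens0l.
  by rewrite raddf0 e !raddf0.
- by rewrite raddfD btensDl !raddfD /= hs hs'.
rewrite bcE [X in th X](_ : _ = btens f' (g' s * f' r) n) //.
rewrite hth !bcE.
have e : phi (r *: n) = f' r *: phi n by rewrite linearZ.
by apply: etrans (congr1 (fun p : P => g' s *: p) e) _; rewrite scalerA.
Qed.
End Pushout.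

Section CokernelBaseChange.
Variables (R S : comPzRingType) (f : {rmorphism R -> S}) (I J : Type).
Variables (N : lmodType R) (P : lmodType S) (phi : {linear N -> P | f \; *:%R}).
Variables (u : {linear finsupp I R -> finsupp J R}) (v : {linear finsupp J R -> N}).
Variables (u' : {linear finsupp I S -> finsupp J S}) (v' : {linear finsupp J S -> P}).
Hypotheses (uv : exact_at u v) (vo : onto v) (uv' : exact_at u' v') (vo' : onto v').
Hypotheses (uu' : forall x, u' (fs_map f x) = fs_map f (u x))
  (vv' : forall y, v' (fs_map f y) = phi (v y)).

Fact fs_map_linear (K : Type) :
  linear_for (f \; *:%R) (@fs_map K R S f).
Proof. by move=> a x y; rewrite raddfD /= linearZ. Qed.
Definition fs_mapl K : {linear finsupp K R -> finsupp K S | f \; *:%R} :=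
  mklin (@fs_map_linear K).

Lemma fs_map_delta K (i : K) : fs_map f (fs_delta R i) = fs_delta S i.
Proof. by apply: finsuppP => j /=; case: pselect => e; rewrite ?rmorph1 ?rmorph0. Qed.

Lemma bc_free_onto K : onto (bc (fs_mapl K)).
Proof.
elim/fs_ind=> [|_ _ [x <-] [y <-]|a i]; first by exists 0; rewrite raddf0.
  by exists (x + y); rewrite raddfD.
by exists (btens f a (fs_delta R i)); rewrite bcE [fs_mapl K _]fs_map_delta.
Qed.

Lemma bc_free_inj K : injective (bc (fs_mapl K)).
Proof.
apply: raddf_inj => t t0; apply: tcoef_inj => i.
have E s : tcoef i s = bc (fs_mapl K) s i.
  elim/btens_ind: s => [|x y hx hy|a b]; first by rewrite !raddf0.
    by rewrite !raddfD /= hx hy.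
  by rewrite tcoefE bcE [RHS]mulrC.
by rewrite E t0.
Qed.

Lemma bc_coker_onto : onto (bc phi).
Proof.
move=> y; have [z <-] := vo' y; have [t <-] := bc_free_onto z.
exists (bmap (f := f) v t); elim/btens_ind: t => [|t t' ht ht'|s x].
- by rewrite !raddf0.
- by rewrite !raddfD /= ht ht'.
- by rewrite bmapE !bcE linearZ /= -vv'.
Qed.

(** A five lemma argument: S (x)_R applied to the presentation of N is right exact, and it agrees
    with the presentation of P on the free modules, where the comparison is bijective. *)
Lemma bc_coker_inj : injective (bc phi).
Proof.
apply: raddf_inj => x x0.
have [y yx] := tmap_onto (u := idfun) (v := v) (fun m : rscal f S^o => ex_intro _ m erefl) vo x.
have Ev t : v' (bc (fs_mapl J) t) = bc phi (bmap (f := f) v t).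
  elim/btens_ind: t => [|t t' ht ht'|s z]; first by rewrite !raddf0.
    by rewrite !raddfD /= ht ht'.
  by rewrite bmapE !bcE linearZ /= vv'.
have Eu t : u' (bc (fs_mapl I) t) = bc (fs_mapl J) (bmap (f := f) u t).
  elim/btens_ind: t => [|t t' ht ht'|s z]; first by rewrite !raddf0.
    by rewrite !raddfD /= ht ht'.
  by rewrite bmapE !bcE linearZ /= uu'.
have [z' hz'] := (uv' _).1 (etrans (Ev y) (etrans (congr1 _ yx) x0)).
have [z hz] := bc_free_onto z'.
have ey : bmap (f := f) u z = y by apply: bc_free_inj; rewrite -Eu hz.
by rewrite -yx -ey; apply/(tmapr_exact uv vo); exists z.
Qed.
End CokernelBaseChange.

(** * Restriction to open subspaces *)

Section SubspacePoints.
Variables (k : comPzRingType) (X : rfspace k) (U : set X) (oU : open U).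
Local Notation XU := (open_subspace oU).

Definition sub_pt p (up : U p) : XU := exist _ p (mem_set up).

Lemma sub_ptP (p : XU) : U (\val p).
Proof. exact: set_mem (svalP p). Qed.

Lemma osub_spleV (p q : XU) : sple (\val p) (\val q) -> sple p q.
Proof. by move=> pq V [[W oW <-] Wp]; apply: pq. Qed.

Lemma sple_up p q : U p -> sple p q -> U q.
Proof. exact: sple_open. Qed.
End SubspacePoints.

(** A presentation on an open set containing [p] is also available at [q], with free modules of the
    same ranks; hence M_q = O_q (x)_(O_p) M_p. *)
Lemma quasi_coherent_bc (k : comPzRingType) (Z : rfspace k) (M : omodule Z) (p q : Z)
    (h : sple p q) :
  quasi_coherent M -> injective (bc (mres M h)) /\ onto (bc (mres M h)).
Proof.
move=> /(_ p)[U [oU [up [I [J [u [v uv]]]]]]].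
pose p' := sub_pt oU up; pose q' := sub_pt oU (sple_up oU up h).
have h' : sple p' q' by exact: osub_spleV.
have -> : h = osub_sple h' by exact: Prop_irrelevance.
have [vo ex] := uv p'; have [vo' ex'] := uv q'.
have uu' x : u q' (fs_map (ores (osub_sple h')) x) = fs_map (ores (osub_sple h')) (u p' x).
  exact: (om_res u h' x).
have vv' y : v q' (fs_map (ores (osub_sple h')) y) = mres M (osub_sple h') (v p' y).
  exact: (om_res v h' y).
split.
  exact: (@bc_coker_inj _ _ _ _ _ _ _ (mres M (osub_sple h')) (u p') (v p') (u q') (v q')).
exact: (@bc_coker_onto _ _ _ _ _ _ (mres M (osub_sple h')) (v p') (v q')).
Qed.

Section ExtensionByZero.
Variables (k : comPzRingType) (X : rfspace k) (U : set X) (oU : open U).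
Local Notation XU := (open_subspace oU).

Section Object.
Variable M : omodule XU.

(* The product over the proofs of [U p] is M_p if p is in U and 0 otherwise. *)
Definition ez_st (p : X) : lmodType (ostalk p) :=
  dprod (fun hp : U p => mstalk M (sub_pt oU hp) : lmodType (ostalk p)).

Definition ez_res_fun p q (h : sple p q) (f : ez_st p) : ez_st q := fun hq =>
  if pselect (U p) is left hp
  then mres M (osub_spleV (h : sple (\val (sub_pt oU hp)) (\val (sub_pt oU hq)))) (f hp)
  else 0.

Lemma ez_res_in p q (h : sple p q) f (hp : U p) (hq : U q) (h' : sple (sub_pt oU hp) (sub_pt oU hq)) :
  ez_res_fun h f hq = mres M h' (f hp).
Proof.
rewrite /ez_res_fun; case: pselect => // hp'.
move: h'; rewrite (Prop_irrelevance hp hp') => h'.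
by congr (mres M _ _); exact: Prop_irrelevance.
Qed.

Lemma ez_res_out p q (h : sple p q) f (hq : U q) : ~ U p -> ez_res_fun h f hq = 0.
Proof. by rewrite /ez_res_fun; case: pselect. Qed.

Fact ez_res_linear p q (h : sple p q) : linear_for (ores h \; *:%R) (ez_res_fun h).
Proof.
move=> a f g; apply: dprodP => hq; rewrite /= dprodD dprodZ.
have [hp|np] := pselect (U p); last by rewrite !ez_res_out // scaler0 addr0.
have h' : sple (sub_pt oU hp) (sub_pt oU hq) by exact: osub_spleV.
rewrite !(ez_res_in _ _ h') dprodD dprodZ raddfD /= linearZ /=; congr (_ *: _ + _).
exact: ores_irr.
Qed.
Definition ez_res p q (h : sple p q) : {linear ez_st p -> ez_st q | ores h \; *:%R} :=
  mklin (ez_res_linear h).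

Fact ez_id p (h : sple p p) f : ez_res h f = f.
Proof.
apply: dprodP => hp; have h' : sple (sub_pt oU hp) (sub_pt oU hp) by exact: osub_spleV.
by rewrite [LHS](ez_res_in _ _ h') mres_id.
Qed.
Fact ez_comp p q r (pq : sple p q) (qr : sple q r) (pr : sple p r) f :
  ez_res qr (ez_res pq f) = ez_res pr f.
Proof.
apply: dprodP => hr; have [hp|np] := pselect (U p); last first.
  rewrite [RHS]ez_res_out //; have [hq|nq] := pselect (U q); last exact: ez_res_out.
  have h' : sple (sub_pt oU hq) (sub_pt oU hr) by exact: osub_spleV.
  by rewrite [LHS](ez_res_in _ _ h') [ez_res _ _ _]ez_res_out // raddf0.
have hq := sple_up oU hp pq.
have h1 : sple (sub_pt oU hp) (sub_pt oU hq) by exact: osub_spleV.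
have h2 : sple (sub_pt oU hq) (sub_pt oU hr) by exact: osub_spleV.
rewrite [LHS](ez_res_in _ _ h2) [ez_res _ _ _](ez_res_in _ _ h1).
by rewrite [RHS](ez_res_in _ _ (sple_trans h1 h2)); exact: mres_comp.
Qed.
Definition ez : omodule X := OModule ez_id ez_comp.
End Object.

Section Map.
Variables (M N : omodule XU) (u : omor M N).
Definition ez_map_fun p (f : ez_st M p) : ez_st N p := fun hp => u (sub_pt oU hp) (f hp).
Fact ez_map_linear p : linear (@ez_map_fun p).
Proof. by move=> a f g; apply: dprodP => hp; rewrite /ez_map_fun linearP. Qed.
Fact ez_map_res p q (h : sple p q) f :
  mklin (@ez_map_linear q) (mres (ez M) h f) = mres (ez N) h (mklin (@ez_map_linear p) f).
Proof.
apply: dprodP => hq; have [hp|np] := pselect (U p); last first.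
  rewrite [RHS]ez_res_out // -[LHS]/(u _ (ez_res_fun h f hq)) ez_res_out //.
  exact: raddf0.
have h' : sple (sub_pt oU hp) (sub_pt oU hq) by exact: osub_spleV.
rewrite [RHS](ez_res_in _ _ h') -[LHS]/(u _ (ez_res_fun h f hq)) (ez_res_in _ _ h').
exact: om_res.
Qed.
Definition ez_map : omor (ez M) (ez N) :=
  @OMor _ _ (ez M) (ez N) (fun p => mklin (@ez_map_linear p)) ez_map_res.

Lemma ez_map_mono : omono u -> omono ez_map.
Proof.
move=> mu p f g e; apply: dprodP => hp; apply: mu.
exact: (congr1 (fun w : ez_st N p => w hp) e).
Qed.
End Map.

Section Adjoint.
Variables (M : omodule XU) (E : omodule X) (g : omor M (mrestr E oU)).

Definition ez_adj_fun p (f : ez_st M p) : mstalk E p :=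
  if pselect (U p) is left hp then g (sub_pt oU hp) (f hp) else 0.
Lemma ez_adj_in p f (hp : U p) : ez_adj_fun f = g (sub_pt oU hp) (f hp).
Proof. by rewrite /ez_adj_fun; case: pselect => // hp'; rewrite (Prop_irrelevance hp hp'). Qed.
Lemma ez_adj_out p (f : ez_st M p) : ~ U p -> ez_adj_fun f = 0.
Proof. by rewrite /ez_adj_fun; case: pselect. Qed.

Fact ez_adj_linear p : linear (@ez_adj_fun p).
Proof.
move=> a f f'; have [hp|np] := pselect (U p); last by rewrite !ez_adj_out // scaler0 addr0.
by rewrite !(ez_adj_in _ hp) dprodD dprodZ; exact: (linearP (g (sub_pt oU hp))).
Qed.
Fact ez_adj_res p q (h : sple p q) f :
  mklin (@ez_adj_linear q) (mres (ez M) h f) = mres E h (mklin (@ez_adj_linear p) f).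
Proof.
rewrite -[LHS]/(ez_adj_fun (ez_res_fun h f)) -[X in _ = mres E h X]/(ez_adj_fun f).
have [hp|np] := pselect (U p); last first.
  rewrite (ez_adj_out _ np) raddf0; have [hq|nq] := pselect (U q); last exact: ez_adj_out.
  by rewrite (ez_adj_in _ hq) ez_res_out // raddf0.
have hq := sple_up oU hp h.
have h' : sple (sub_pt oU hp) (sub_pt oU hq) by exact: osub_spleV.
rewrite (ez_adj_in _ hq) (ez_adj_in _ hp) (ez_res_in _ _ h') om_res.
by congr (mres E _ _); exact: Prop_irrelevance.
Qed.
Definition ez_adj : omor (ez M) E :=
  @OMor _ _ (ez M) E (fun p => mklin (@ez_adj_linear p)) ez_adj_res.
End Adjoint.

Section Unadjoint.
Variables (N : omodule XU) (E : omodule X) (h : omor (ez N) E).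

Definition ez_unit_fun (p : XU) (n : mstalk N p) : ez_st N (\val p) := fun hp =>
  mres N (osub_spleV (@sple_refl _ (\val p) : sple (\val p) (\val (sub_pt oU hp)))) n.
Fact ez_unit_linear p : linear (@ez_unit_fun p).
Proof.
move=> a n m; apply: dprodP => hp; rewrite /ez_unit_fun raddfD /= linearZ /=.
by congr (_ *: _ + _); exact: ores_id.
Qed.
Fact ez_unit_res (p q : XU) (pq : sple p q) n :
  ez_unit_fun (mres N pq n) = ez_res N (osub_sple pq) (ez_unit_fun n).
Proof.
apply: dprodP => hq; have hp : U (\val p) := sub_ptP p.
have h' : sple (sub_pt oU hp) (sub_pt oU hq) by apply: osub_spleV; exact: osub_sple pq.
rewrite [RHS](ez_res_in _ _ h') /ez_unit_fun.
have h2 : sple p (sub_pt oU hq) by apply: osub_spleV; exact: osub_sple pq.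
by rewrite (mres_comp _ _ h2) (mres_comp _ _ h2).
Qed.

Definition ez_unadj_fun (p : XU) (n : mstalk N p) : mstalk (mrestr E oU) p :=
  h (\val p) (ez_unit_fun n).
Fact ez_unadj_linear p : linear (@ez_unadj_fun p).
Proof.
move=> a n m; rewrite /ez_unadj_fun ez_unit_linear.
exact: (linearP (h (\val p))).
Qed.
Fact ez_unadj_res (p q : XU) (pq : sple p q) n :
  mklin (@ez_unadj_linear q) (mres N pq n) =
  mres (mrestr E oU) pq (mklin (@ez_unadj_linear p) n).
Proof.
rewrite -[LHS]/(h (\val q) (ez_unit_fun (mres N pq n))) ez_unit_res.
exact: (om_res h).
Qed.
Definition ez_unadj : omor N (mrestr E oU) :=
  @OMor _ _ N (mrestr E oU) (fun p => mklin (@ez_unadj_linear p)) ez_unadj_res.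
End Unadjoint.

(** Restriction to an open set has the left adjoint [ez], which preserves monomorphisms; [ez_adj]
    and [ez_unadj] are the two directions of the adjunction. *)
Lemma mrestr_injective (E : omodule X) :
  injective_omodule E -> injective_omodule (mrestr E oU).
Proof.
move=> iE M N u g mu.
have [h hE] := iE _ _ (ez_map u) (ez_adj g) (ez_map_mono mu).
exists (ez_unadj h) => p v.
rewrite -[LHS]/(h (\val p) (ez_unit_fun (u p v))).
have -> : ez_unit_fun (u p v) = ez_map u (\val p) (ez_unit_fun v).
  by apply: dprodP => hp; rewrite /ez_unit_fun -om_res.
rewrite hE -[LHS]/(ez_adj_fun g (ez_unit_fun v)) (ez_adj_in _ _ (sub_ptP p)).
by rewrite /ez_unit_fun om_res; exact: (@mres_id _ _ E (\val p) _ (g p v)).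
Qed.

Definition omor_restr (M N : omodule X) (u : omor M N) : omor (mrestr M oU) (mrestr N oU) :=
  @OMor _ _ (mrestr M oU) (mrestr N oU) (fun p => u (\val p))
    (fun p q h v => om_res u (osub_sple h) v).

Definition complex_restr (C : ocomplex X) : ocomplex XU :=
  @OComplex _ XU (fun n => mrestr (C n) oU) (fun n => omor_restr (oc_d C n))
    (fun n p v => @oc_dd _ _ C n (\val p) v).

Section Resolution.
Variable E : injective_resolution (struct_module X).

Definition aug_restr : omor (struct_module XU) (mrestr (E 0) oU) :=
  @OMor _ XU (struct_module XU) (mrestr (E 0) oU) (fun p => ir_aug E (\val p))
    (fun p q h v => om_res (ir_aug E) (osub_sple h) v).

Definition resolution_restr : injective_resolution (struct_module XU) :=
  @InjRes _ XU (struct_module XU) (complex_restr E)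
    (fun n => mrestr_injective (ir_inj (i := E) (n := n))) aug_restr
    (fun p => @ir_aug_mono _ _ _ E (\val p))
    (fun p => @ir_exact0 _ _ _ E (\val p))
    (fun n p => @ir_exact _ _ _ E n (\val p)).
End Resolution.
End ExtensionByZero.

(** * Sections of flat base changes *)

Lemma linear_inverse (R : comPzRingType) (M N : lmodType R) (f : {linear M -> N}) :
  injective f -> onto f -> exists g : {linear N -> M}, bijective g /\ forall m, g (f m) = m.
Proof.
move=> fi fo; have [g gK] := choice fo.
have gl : linear g by move=> a x y; apply: fi; rewrite linearP !gK.
have gK' m : g (f m) = m by apply: fi; rewrite gK.
by exists (mklin gl); split=> //; exists f.
Qed.

Section SectionTensor.
Variables (k : comPzRingType) (Y : rfspace k) (U : set Y).
Hypothesis Uup : forall x y, U x -> sple x y -> U y.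
Variables (R : comPzRingType) (rho : forall w, U w -> {rmorphism R -> ostalk w}).
Hypothesis rho_res : forall w w' (uw : U w) (uw' : U w') (h : sple w w') a,
  ores h (rho uw a) = rho uw' a.

Definition rsect (a : R) : osect U :=
  @OSect _ _ U (fun w uw => rho uw a) (fun p q up uq h => rho_res up uq h a).
Fact rsect_is_additive : zmod_morphism rsect.
Proof. by move=> a b; apply: osectP => w uw /=; rewrite rmorphB. Qed.
HB.instance Definition _ := GRing.isZmodMorphism.Build R (osect U) rsect
  rsect_is_additive.
Fact rsect_is_multiplicative : monoid_morphism rsect.
Proof. by split=> [|a b]; apply: osectP => w uw /=; rewrite ?rmorph1 ?rmorphM. Qed.
HB.instance Definition _ := GRing.isMonoidMorphism.Build R (osect U) rsect
  rsect_is_multiplicative.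

Definition sev_fun w (uw : U w) (s : osect U) : ostalk w := s w uw.
Fact sev_linear w (uw : U w) :
  linear (sev_fun uw : rscal rsect (osect U)^o -> rscal (rho uw) (ostalk w)^o).
Proof. by []. Qed.
Definition sev w (uw : U w) :
    {linear rscal rsect (osect U)^o -> rscal (rho uw) (ostalk w)^o} :=
  mklin (sev_linear uw).

Fact sres_linear w w' (uw : U w) (uw' : U w') (h : sple w w') :
  linear (ores h : rscal (rho uw) (ostalk w)^o -> rscal (rho uw') (ostalk w')^o).
Proof.
move=> a x y; have := rmorphD (ores h) (rho uw a * x) y.
by rewrite rmorphM (rho_res uw uw' h); exact.
Qed.
Definition sres w w' (uw : U w) (uw' : U w') (h : sple w w') :
    {linear rscal (rho uw) (ostalk w)^o -> rscal (rho uw') (ostalk w')^o} :=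
  mklin (@sres_linear w w' uw uw' h).

Hypothesis flat_rho : forall w (uw : U w), flat_rmorphism (rho uw).
Hypothesis acyc_rho : forall n, acyc n (mdiag rho_res (struct_module Y)).
Variable N : lmodType R.

Let D := mdiag rho_res (struct_module Y).
Let lam (a : rep_poset U) : {linear rscal rsect (osect U)^o -> D a} := sev (rep_in a).

Let flatD (a : rep_poset U) : flat_module (D a).
Proof. exact: flat_rho. Qed.

Let osect_msect (s : osect U) : msect (struct_module Y) U :=
  @MSect _ _ (struct_module Y) U (fun w uw => s w uw)
    (fun p q up uq h => os_res s up uq h).

(** The limit lemmas for L = O(U) as an R-algebra. With [sect_tens_onto]: O(U) (x)_R N is the module
    of compatible families in the O_w (x)_R N. *)
Lemma sect_tens_inj (t : base_change rsect N) :
  (forall w uw, tmap (@sev w uw) idfun t = 0) -> t = 0.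
Proof.
move=> t0; apply: (@lim_tens_inj _ _ D _ _ lam flatD acyc_rho _ _ _ t) => [l l0|l|f sf|a].
- suff e : osect_msect l = osect_msect 0.
    apply: osectP => w uw; exact: (congr1 (fun s : msect _ U => s w uw) e).
  by apply: (mdiag_sec_inj Uup) => a; exact: (l0 a).
- exact: (mdiag_sec rho_res (osect_msect l)).
- have [s hs] := mdiag_sec_onto Uup sf.
  exists (@OSect _ _ U (fun w uw => s w uw) (fun p q up uq h => ms_res s up uq h)).
  by move=> a; exact: hs.
- exact: t0.
Qed.

Lemma sect_tens_onto (t : forall w (uw : U w), base_change (rho uw) N) :
  (forall w w' uw uw' h, tmap (@sres w w' uw uw' h) idfun (t w uw) = t w' uw') ->
  exists s : base_change rsect N, forall w uw, tmap (@sev w uw) idfun s = t w uw.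
Proof.
move=> ct.
have [l|f sf|a b h|s hs] := @lim_tens_onto _ _ D _ N lam flatD acyc_rho _ _
    (fun a => t (sval a) (rep_in a)).
- exact: (mdiag_sec rho_res (osect_msect l)).
- have [s hs] := mdiag_sec_onto Uup sf.
  exists (@OSect _ _ U (fun w uw => s w uw) (fun p q up uq h => ms_res s up uq h)).
  by move=> a; exact: hs.
- exact: ct.
exists s => w uw.
have := ct _ _ (rep_in (to_rep Uup uw)) uw (sprep_le w).
rewrite -[t _ (rep_in _)]hs (tmap_comp (w := sev uw) (z := idfun)) //.
by move=> r; exact: os_res.
Qed.
End SectionTensor.

(** * Quasi-coherent modules are generated by sections *)

Section Meet.
Variables (k : comPzRingType) (Y : rfspace k).

Definition meet (x z : Y) : set Y := [set w | sple x w /\ sple z w].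

Lemma meet_up x z w w' : meet x z w -> sple w w' -> meet x z w'.
Proof. by move=> [xw zw] h; split; exact: sple_trans h. Qed.

Definition meet_l x z w (h : meet x z w) : {rmorphism ostalk x -> ostalk w} :=
  ores (proj1 h).
Definition meet_r x z w (h : meet x z w) : {rmorphism ostalk z -> ostalk w} :=
  ores (proj2 h).

Lemma meet_l_res x z w w' (h : meet x z w) (h' : meet x z w') (ww : sple w w') a :
  ores ww (meet_l h a) = meet_l h' a.
Proof. exact: ores_comp. Qed.
Lemma meet_r_res x z w w' (h : meet x z w) (h' : meet x z w') (ww : sple w w') a :
  ores ww (meet_r h a) = meet_r h' a.
Proof. exact: ores_comp. Qed.

Definition meet_sect_l x z : {rmorphism ostalk x -> osect (meet x z)} :=
  rsect (@meet_l_res x z).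
Definition meet_sect_r x z : {rmorphism ostalk z -> osect (meet x z)} :=
  rsect (@meet_r_res x z).
End Meet.

Section AffineCriterion.
Variables (k : comPzRingType) (Y : rfspace k) (R : comPzRingType).
Variable rho : forall w : Y, {rmorphism R -> ostalk w}.
Hypothesis rho_res : forall w w' (h : sple w w') a, ores h (rho w a) = rho w' a.

Lemma rho_meet x z r : meet_sect_l x z (rho x r) = meet_sect_r x z (rho z r).
Proof. by apply: osectP => w h /=; rewrite /meet_l /meet_r !rho_res. Qed.

(** The form of [rho] that [mdiag] and [rsect] expect, taken over the whole space. *)
Definition rhoT (w : Y) (_ : [set: Y] w) := rho w.
Lemma rhoT_res w w' (uw : [set: Y] w) (uw' : [set: Y] w') (h : sple w w') a :
  ores h (rhoT uw a) = rhoT uw' a.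
Proof. exact: rho_res. Qed.
Lemma setT_up (x y : Y) : [set: Y] x -> sple x y -> [set: Y] y.
Proof. by []. Qed.

Local Notation rT := (rsect rhoT_res).

Hypothesis flat_rho : forall w, flat_rmorphism (rho w).
Hypothesis flat_res : finite_space Y.

Section QuasiCoherent.
Variable M : omodule Y.
Hypothesis qcM : quasi_coherent M.

Section Two.
Variables x z : Y.
Hypothesis acyc_meet : forall n, acyc n (mdiag (@meet_l_res _ _ x z) (struct_module Y)).
Hypothesis meet_inj : injective (bc (pushout_map (@rho_meet x z))).
Hypothesis meet_onto : onto (bc (pushout_map (@rho_meet x z))).

Fact act_linear w (h : meet x z w) :
  linear_for (rho z \; *:%R)
    (mres M (proj1 h) : rscal (rho x) (mstalk M x) -> rscal (meet_r h) (mstalk M w)).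
Proof.
move=> a m n.
apply: etrans (raddfD (mres M (proj1 h)) (rho x a *: (m : mstalk M x)) n) _.
congr (_ + _).
have e : mres M (proj1 h) (rho x a *: (m : mstalk M x)) = rho w a *: mres M (proj1 h) m.
  by rewrite linearZ /= rho_res.
by apply: etrans e _; rewrite -(rho_res (proj2 h)).
Qed.
Definition act w (h : meet x z w) :
    base_change (rho z) (rscal (rho x) (mstalk M x)) -> mstalk M w :=
  bc (mklin (act_linear h)).
HB.instance Definition _ w h := GRing.Additive.on (@act w h).

Lemma actE w (h : meet x z w) s m :
  act h (btens (rho z) s m) = ores (proj2 h) s *: mres M (proj1 h) m.
Proof. exact: (bcE (mklin (act_linear h)) s m). Qed.

Lemma bc_psi w (h : meet x z w)
    (t : base_change (rho z) (rscal (rho x) (mstalk M x))) :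
  bc (mres M (proj1 h)) (tmap (sev (@meet_l_res _ _ x z) h) idfun
    (pushout_psi (rho_meet x z) t)) = act h t.
Proof.
elim/btens_ind: t => [|t t' ht ht'|s m]; first by rewrite !raddf0.
  by rewrite !raddfD /= ht ht'.
by rewrite pushout_psiE tmapE actE bcE.
Qed.

(* Together, [act_inj] and [act_onto] say O_z (x)_R M_x = Gamma(U_x n U_z, M). *)
Lemma act_inj t : (forall w (h : meet x z w), act h t = 0) -> t = 0.
Proof.
move=> t0.
have [th hth] := pushout_base_change meet_inj meet_onto (mstalk M x).
have K s : th (pushout_psi (rho_meet x z) s) = s.
  elim/btens_ind: s => [|s s' hs hs'|s m]; first by rewrite !raddf0.
    by rewrite !raddfD /= hs hs'.
  rewrite pushout_psiE; have := hth s 1 m; rewrite rmorph1 mulr1 scale1r; exact.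
rewrite -(K t); suff -> : pushout_psi (rho_meet x z) t = 0 by rewrite raddf0.
apply: (sect_tens_inj (@meet_up _ _ x z) _ acyc_meet) => [w h|w h].
  exact: flat_res.
apply: (quasi_coherent_bc (proj1 h) qcM).1.
by rewrite raddf0 -(t0 w h) -bc_psi.
Qed.

(** Three identifications: O_z (x)_R M_x = O(U_x n U_z) (x)_(O_x) M_x by the pushout hypotheses; the
    latter consists of compatible families in the O_w (x)_(O_x) M_x by acyclicity and flatness; and
    each of these is M_w by quasi-coherence. *)
Lemma act_onto (m : forall w, meet x z w -> mstalk M w) :
  (forall w w' (h : meet x z w) (h' : meet x z w') (ww : sple w w'),
    mres M ww (m w h) = m w' h') ->
  exists t, forall w (h : meet x z w), act h t = m w h.
Proof.
move=> cm.
have [t ht] := choice_dep (fun wh : {w | meet x z w} =>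
  (quasi_coherent_bc (proj1 (proj2_sig wh)) qcM).2 (m _ (proj2_sig wh))).
pose t' w (h : meet x z w) : base_change (meet_l h) (mstalk M x) := t (exist _ w h).
have fl w (h : meet x z w) : flat_rmorphism (meet_l h) by exact: flat_res.
have [w w' h h' ww|T hT] := @sect_tens_onto _ _ _ (@meet_up _ _ x z) _ _
   (@meet_l_res _ _ x z) fl acyc_meet (mstalk M x) t'.
  apply: (quasi_coherent_bc (proj1 h') qcM).1.
  rewrite [RHS](ht (exist _ w' h')) -(cm _ _ h h' ww).
  have E s : bc (mres M (proj1 h')) (tmap (sres (@meet_l_res _ _ x z) h h' ww) idfun s) =
      mres M ww (bc (mres M (proj1 h)) s).
    elim/btens_ind: s => [|s s' hs hs'|s n]; first by rewrite !raddf0.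
      by rewrite !raddfD /= hs hs'.
    rewrite [tmap _ _ _]tmapE [LHS]bcE bcE linearZ /=; congr (_ *: _).
    exact/esym/mres_comp.
  by rewrite E; congr (mres M ww _); exact: (ht (exist _ w h)).
have [th hth] := pushout_base_change meet_inj meet_onto (mstalk M x).
exists (th T) => w h; rewrite -[RHS](ht (exist _ w h)) -[t _]hT.
elim/btens_ind: {hT} T => [|s s' hs hs'|c n]; first by rewrite !raddf0.
  by rewrite !raddfD /= hs hs'.
have [tau <-] := meet_onto c; elim/btens_ind: tau => [|s s' hs hs'|s r].
- have e : btens (meet_sect_l x z) (0 : osect (meet x z)) n = 0 by exact: tens0l.
  by rewrite raddf0 e !raddf0.
- by rewrite raddfD btensDl !raddfD /= hs hs'.
rewrite bcE [X in th X](_ : _ = btens (meet_sect_l x z) (meet_sect_r x z s * meet_sect_l x z r) n) //.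
rewrite hth actE tmapE bcE linearZ /= scalerA.
by [].
Qed.
End Two.

Hypothesis acyc_meets : forall x z n,
  acyc n (mdiag (@meet_l_res _ _ x z) (struct_module Y)).
Hypothesis meet_injs : forall x z, injective (bc (pushout_map (@rho_meet x z))).
Hypothesis meet_ontos : forall x z, onto (bc (pushout_map (@rho_meet x z))).

Local Notation G := (rscal rT (msect M [set: Y])).

Section Stalk.
Variable z : Y.

Fact gen_linear : linear_for (rho z \; *:%R)
  ((fun s => ms_val s (I : [set: Y] z)) : G -> mstalk M z).
Proof. by []. Qed.
Definition gen : base_change (rho z) G -> mstalk M z := bc (mklin gen_linear).
HB.instance Definition _ := GRing.Additive.on gen.

Lemma genE s (m : msect M [set: Y]) : gen (btens (rho z) s (m : G)) = s *: m z I.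
Proof. exact: (bcE (mklin gen_linear)). Qed.

Let P := dprod (fun x : Y => rscal (rho x) (mstalk M x)).
Let Q := dprod (fun xy : Y * Y => rscal (rho xy.2) (mstalk M xy.2)).

Let iota_fun (s : G) : P := fun x => ms_val s (I : [set: Y] x).
Let iota_linear : linear iota_fun.
Proof. by []. Qed.
Let iota : {linear G -> P} := mklin iota_linear.

Let mresR_linear x y (h : sple x y) :
  linear (mres M h : rscal (rho x) (mstalk M x) -> rscal (rho y) (mstalk M y)).
Proof.
move=> a m n.
apply: etrans (raddfD (mres M h) (rho x a *: (m : mstalk M x)) n) _.
congr (_ + _).
have e : mres M h (rho x a *: (m : mstalk M x)) = rho y a *: mres M h m.
  by rewrite linearZ /= rho_res.
exact: e.
Qed.
Let mresR x y (h : sple x y) :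
  {linear rscal (rho x) (mstalk M x) -> rscal (rho y) (mstalk M y)} :=
  mklin (mresR_linear h).

(** Gamma(Y, M) is the kernel of this map, a finite limit written as a left exact sequence 0 ->
    Gamma(Y, M) -> P -> Q. Pairs that are not comparable contribute 0. *)
Let d_fun (f : P) : Q := fun xy =>
  if pselect (sple xy.1 xy.2) is left h then mresR h (f xy.1) - f xy.2 else 0.
Let d_linear : linear d_fun.
Proof.
move=> a f g; apply: dprodP => xy; rewrite dprodD dprodZ /d_fun.
case: pselect => h; last by rewrite scaler0 addr0.
by rewrite !dprodD !dprodZ linearP scalerBr opprD addrACA.
Qed.
Let d : {linear P -> Q} := mklin d_linear.

Let iota_inj : injective iota.
Proof.
move=> s t e; apply: msectP => p; case.
exact: (congr1 (fun f : P => f p) e).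
Qed.

Let iota_d : exact_at iota d.
Proof.
move=> f; split=> [f0|[s <-]]; last first.
  apply: dprodP => -[x y]; rewrite -[LHS]/(d_fun (iota s) (x, y)) /d_fun /=.
  case: pselect => // h; apply/eqP; rewrite subr_eq0; apply/eqP.
  exact: ms_res.
have c p q (up : [set: Y] p) (uq : [set: Y] q) (h : sple p q) : mres M h (f p) = f q.
  have := congr1 (fun g : Q => g (p, q)) f0.
  rewrite -[LHS]/(d_fun f (p, q)) /d_fun /=; case: pselect => //= h' /eqP.
  rewrite subr_eq0 => /eqP <-; exact: (congr1 (fun h => mres M h (f p)) (Prop_irrelevance _ _)).
exists (@MSect _ _ M [set: Y] (fun p _ => f p) c).
exact: dprodP.
Qed.

Let act_gen x w (h : meet x z w) t :
  act h (tmap idfun (@dproj _ _ _ x) (bmap iota t)) = mres M (proj2 h) (gen t).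
Proof.
elim/btens_ind: t => [|t t' ht ht'|s m]; first by rewrite !raddf0.
  by rewrite !raddfD /= ht ht'.
rewrite bmapE [X in act h X]tmapE [LHS]actE genE linearZ /=.
congr (_ *: _).
exact: (etrans (@ms_res _ _ _ _ m x w I I (proj1 h)) (esym (@ms_res _ _ _ _ m z w I I (proj2 h)))).
Qed.

(** By flatness O_z (x)_R Gamma(Y, M) embeds in the product of the O_z (x)_R M_x = Gamma(U_x n U_z,
    M), where [t] becomes the family of restrictions of [gen t]. *)
Lemma gen_inj : injective gen.
Proof.
apply: raddf_inj => t t0.
have fl : flat_module (rscal (rho z) (ostalk z)^o) by exact: flat_rho.
apply: (fl _ _ iota iota_inj); rewrite raddf0.
apply: dprod_tens_eq0r => [|x]; first exact: rf_finite.
apply: (act_inj (@acyc_meets x z) (@meet_injs x z) (@meet_ontos x z)) => w h.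
by rewrite [LHS]act_gen t0 raddf0.
Qed.

(** The restrictions of [m] to all U_x n U_z give an element of O_z (x)_R P; it is killed by [d],
    hence comes from Gamma(Y, M) by flatness. *)
Lemma gen_onto : onto gen.
Proof.
move=> m.
have cm x w w' (h : meet x z w) (h' : meet x z w') (ww : sple w w') :
    mres M ww (mres M (proj2 h) m) = mres M (proj2 h') m by exact: mres_comp.
have [t ht] := choice_dep (fun x => act_onto (@acyc_meets x z) (@meet_injs x z)
  (@meet_ontos x z) (cm x)).
have [T hT] := dprod_tens_ontor (rf_finite Y) t.
have [s hs] : exists s, bmap (f := rho z) iota s = T.
  apply/(flat_exact (@flat_rho z) iota_d).
  apply: dprod_tens_eq0r => [|[x y]].
    by rewrite -setXTT; apply: finite_setX; exact: rf_finite.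
  have [h|nh] := pselect (sple x y); last first.
    rewrite (tmap_comp (w := idfun) (z := \0)) // => [|f]; last first.
      by rewrite [LHS]/(d_fun f (x, y)) /d_fun; case: pselect.
    by move: (T) => r; tens_elim r; rewrite tmapE tens0r.
  have e r : tmap idfun (@dproj _ _ _ (x, y)) (tmap (M := rscal (rho z) (ostalk z)^o) idfun d r) =
      tmap idfun (mresR h) (tmap idfun (@dproj _ _ _ x) r) - tmap idfun (@dproj _ _ _ y) r.
    elim/tens_ind: r => [|r r' hr hr'|a f]; first by rewrite !raddf0 addr0.
      by rewrite !raddfD /= hr hr' addrACA.
    rewrite !tmapE /= -tensBr; congr (tens _ _).
    rewrite [LHS]/(d_fun f (x, y)) /d_fun; case: pselect => // h'.
    by rewrite (Prop_irrelevance h h').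
  rewrite e !hT.
  apply: (act_inj (@acyc_meets y z) (@meet_injs y z) (@meet_ontos y z)) => w hw.
  have hw' : meet x z w by case: hw => yw zw; split=> //; exact: sple_trans yw.
  have e2 r : act hw (tmap idfun (mresR h) r) = act hw' r.
    elim/btens_ind: r => [|r r' hr hr'|a n]; first by rewrite !raddf0.
      by rewrite !raddfD /= hr hr'.
    rewrite [X in act hw X]tmapE [LHS]actE actE; congr (_ *: _).
      exact: ores_irr.
    exact: mres_comp.
  rewrite raddfB /= [X in X - _]e2 !ht; apply/eqP; rewrite subr_eq0; apply/eqP.
  by congr (mres M _ m); exact: Prop_irrelevance.
exists s.
(* The component x = z, evaluated at the point z itself, recovers [m]. *)
have hz : meet z z z by split; exact: sple_refl.
by rewrite -(mres_id (proj2 hz) (gen s)) -act_gen hs hT ht mres_id.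
Qed.
End Stalk.
End QuasiCoherent.
End AffineCriterion.

(** * The module attached to a module over the base ring *)

Section FreeCokernel.
Variables (R S : comPzRingType) (f : {rmorphism R -> S}) (N : lmodType R).

(** The tautological presentation: all elements of N as generators, all elements of the kernel as
    relations. Its index types are unchanged by base change, so one presentation serves for [bsheaf]
    on the whole space. *)
Definition taut_cover : {linear finsupp N R -> N} :=
  mklin (fs_lift_linear idfun (fun n : N => n) : linear (fs_lift idfun (fun n : N => n))).
Definition taut_rel : Type := lsub_type (lsub_ker taut_cover).
Definition taut_syz : {linear finsupp taut_rel R -> finsupp N R} :=
  mklin (fs_lift_linear idfun (fun r : taut_rel => lsub_val r)
    : linear (fs_lift idfun (fun r : taut_rel => lsub_val r))).

Lemma taut_cover_delta n : taut_cover (fs_delta R n) = n.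
Proof. exact: (fs_lift_delta idfun). Qed.
Lemma taut_syz_delta r : taut_syz (fs_delta R r) = lsub_val r.
Proof. exact: (fs_lift_delta idfun). Qed.

Lemma taut_onto : onto taut_cover.
Proof. by move=> n; exists (fs_delta R n); exact: taut_cover_delta. Qed.

Lemma taut_exact : exact_at taut_syz taut_cover.
Proof.
move=> y; split=> [y0|[x <-]].
  by exists (fs_delta R (LSubType (y0 : lsub_ker taut_cover y))); exact: taut_syz_delta.
elim/fs_ind: x => [|x x' hx hx'|a r]; first by rewrite !raddf0.
  by rewrite !raddfD /= hx hx' addr0.
rewrite linearZ /= linearZ /=.
have e := lsub_valP (r : lsub_type (lsub_ker taut_cover)).
by rewrite taut_syz_delta [X in a *: X]e scaler0.
Qed.

Definition bc_syz : {linear finsupp taut_rel S -> finsupp N S} :=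
  mklin (fs_lift_linear idfun (fun r : taut_rel => fs_map f (lsub_val r))
    : linear (fs_lift idfun (fun r : taut_rel => fs_map f (lsub_val r)))).
Definition bc_cover : {linear finsupp N S -> base_change f N} :=
  mklin (fs_lift_linear idfun (fun n : N => btens f 1 n)
    : linear (fs_lift idfun (fun n : N => btens f 1 n))).

Lemma bc_cover_delta n : bc_cover (fs_delta S n) = btens f 1 n.
Proof. exact: (fs_lift_delta idfun). Qed.
Lemma bc_syz_delta r : bc_syz (fs_delta S r) = fs_map f (lsub_val r).
Proof. exact: (fs_lift_delta idfun). Qed.

Lemma bc_cover_map y : bc_cover (fs_map f y) = btens f 1 (taut_cover y).
Proof.
elim/fs_ind: y => [|y y' hy hy'|a n].
- by rewrite !raddf0 -[RHS]/(bunit f N 0) raddf0.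
- by rewrite !raddfD /= hy hy' -btensDr.
- rewrite !linearZ /= fs_map_delta bc_cover_delta btensZ btens_scale mul1r mulr1.
  by rewrite taut_cover_delta.
Qed.

Lemma bc_syz_map x : bc_syz (fs_map f x) = fs_map f (taut_syz x).
Proof.
elim/fs_ind: x => [|x x' hx hx'|a r]; first by rewrite !raddf0.
  by rewrite !raddfD /= hx hx'.
by rewrite !linearZ /= fs_map_delta bc_syz_delta taut_syz_delta.
Qed.

Lemma bc_cover_onto : onto bc_cover.
Proof.
elim/btens_ind=> [|_ _ [x <-] [y <-]|s n]; first by exists 0; rewrite raddf0.
  by exists (x + y); rewrite raddfD.
by exists (s *: fs_delta S n); rewrite linearZ /= bc_cover_delta btens_scale mulr1.
Qed.

Lemma bc_cover_exact : exact_at bc_syz bc_cover.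
Proof.
have Ev t : bc_cover (bc (fs_mapl f N) t) = bmap (f := f) taut_cover t.
  elim/btens_ind: t => [|t t' ht ht'|s z]; first by rewrite !raddf0.
    by rewrite !raddfD /= ht ht'.
  rewrite bmapE !bcE linearZ; apply: etrans (congr1 ( *:%R s) (bc_cover_map z)) _.
  by rewrite btens_scale mulr1.
have Eu t : bc_syz (bc (fs_mapl f taut_rel) t) = bc (fs_mapl f N) (bmap (f := f) taut_syz t).
  elim/btens_ind: t => [|t t' ht ht'|s z]; first by rewrite !raddf0.
    by rewrite !raddfD /= ht ht'.
  rewrite bmapE !bcE linearZ.
  exact: (congr1 ( *:%R s) (bc_syz_map z)).
move=> y; split=> [|[x <-]].
  have [t <-] := bc_free_onto f y; rewrite Ev => /(tmapr_exact taut_exact taut_onto)[w <-].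
  by exists (bc (fs_mapl f taut_rel) w); rewrite Eu.
have [t <-] := bc_free_onto f x; rewrite Eu Ev.
by apply/(tmapr_exact taut_exact taut_onto); exists t.
Qed.
End FreeCokernel.

Section BaseChangeSheaf.
Variables (k : comPzRingType) (Y : rfspace k) (R : comPzRingType).
Variable rho : forall w : Y, {rmorphism R -> ostalk w}.
Hypothesis rho_res : forall w w' (h : sple w w') a, ores h (rho w a) = rho w' a.
Variable N : lmodType R.

Section Res.
Variables (p q : Y) (h : sple p q).

Definition bsheaf_res_fun : base_change (rho p) N -> base_change (rho q) N :=
  tmap (sres (rhoT_res rho_res) (I : [set: Y] p) (I : [set: Y] q) h) idfun.

Lemma bsheaf_resE s n : bsheaf_res_fun (btens (rho p) s n) = btens (rho q) (ores h s) n.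
Proof. exact: tmapE. Qed.

Fact bsheaf_res_linear : linear_for (ores h \; *:%R) bsheaf_res_fun.
Proof.
move=> a x y; rewrite [LHS]raddfD; congr (_ + _).
elim/btens_ind: x => [|x x' hx hx'|s n].
- by rewrite scaler0 /bsheaf_res_fun !raddf0 /= ?scaler0.
- rewrite scalerDr /= [LHS]raddfD [bsheaf_res_fun (x + x')]raddfD /= scalerDr.
  by congr (_ + _).
- rewrite btens_scale [LHS]bsheaf_resE rmorphM; apply/esym.
  by apply: etrans (congr1 ( *:%R (ores h a)) (bsheaf_resE s n)) _; exact: btens_scale.
Qed.
Definition bsheaf_res :
  {linear base_change (rho p) N -> base_change (rho q) N | ores h \; *:%R} :=
  mklin bsheaf_res_linear.
End Res.

Fact bsheaf_id p (h : sple p p) v : bsheaf_res h v = v.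
Proof.
elim/btens_ind: v => [|x y hx hy|s n]; first by rewrite raddf0.
  by rewrite raddfD /= hx hy.
by rewrite [LHS]bsheaf_resE ores_id.
Qed.
Fact bsheaf_comp p q r (pq : sple p q) (qr : sple q r) (pr : sple p r) v :
  bsheaf_res qr (bsheaf_res pq v) = bsheaf_res pr v.
Proof.
elim/btens_ind: v => [|x y hx hy|s n]; first by rewrite !raddf0.
  by rewrite !raddfD /= hx hy.
rewrite [X in bsheaf_res _ X]bsheaf_resE [LHS]bsheaf_resE [RHS]bsheaf_resE.
by rewrite (ores_comp _ _ pr).
Qed.

Definition bsheaf : omodule Y :=
  @OModule k Y (fun p => base_change (rho p) N) bsheaf_res bsheaf_id bsheaf_comp.

Lemma bsheaf_quasi_coherent : quasi_coherent bsheaf.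
Proof.
move=> p; exists setT, openT; split=> //; exists (taut_rel N), N.
pose XT := open_subspace (@openT Y).
have uP (x y : XT) (h : sple x y) v :
    bc_syz (rho (\val y)) N (fs_map (ores (osub_sple h)) v) =
    fs_map (ores (osub_sple h)) (bc_syz (rho (\val x)) N v).
  elim/fs_ind: v => [|v w hv hw|a r]; first by rewrite !raddf0.
    by rewrite !raddfD /= hv hw.
  rewrite !linearZ /= fs_map_delta !bc_syz_delta; congr (_ *: _).
  by apply: finsuppP => i /=; rewrite rho_res.
have vP (x y : XT) (h : sple x y) v :
    bc_cover (rho (\val y)) N (fs_map (ores (osub_sple h)) v) =
    bsheaf_res (osub_sple h) (bc_cover (rho (\val x)) N v).
  elim/fs_ind: v => [|v w hv hw|a n]; first by rewrite !raddf0.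
    by rewrite !raddfD /= hv hw.
  rewrite !linearZ /= fs_map_delta !bc_cover_delta; congr (_ *: _).
  by rewrite [RHS]bsheaf_resE rmorph1.
exists (@OMor _ XT (free_module XT (taut_rel N)) (free_module XT N)
  (fun x => bc_syz (rho (\val x)) N) uP).
exists (@OMor _ XT (free_module XT N) (mrestr bsheaf openT)
  (fun x => bc_cover (rho (\val x)) N) vP).
by move=> x; split; [exact: bc_cover_onto|exact: bc_cover_exact].
Qed.
End BaseChangeSheaf.

(** * The equivalence given by global sections *)

Section GlobalSections.
Variables (k : comPzRingType) (Y : rfspace k) (R : comPzRingType).
Variable rho : forall w : Y, {rmorphism R -> ostalk w}.
Hypothesis rho_res : forall w w' (h : sple w w') a, ores h (rho w a) = rho w' a.

Local Notation rT := (rsect (rhoT_res rho_res)).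
Local Notation B := (osect [set: Y]).

Hypothesis flat_rho : forall w, flat_rmorphism (rho w).
Hypothesis flat_res : finite_space Y.
Hypothesis acyc_meets : forall x z n,
  acyc n (mdiag (@meet_l_res _ _ x z) (struct_module Y)).
Hypothesis meet_injs : forall x z, injective (bc (pushout_map (rho_meet rho_res x z))).
Hypothesis meet_ontos : forall x z, onto (bc (pushout_map (rho_meet rho_res x z))).

Section FullyFaithful.
Variables (M N : omodule Y) (qcM : quasi_coherent M).
Variable g : {linear msect M [set: Y] -> msect N [set: Y]}.
Local Notation G := (rscal rT (msect M [set: Y])).

Let gi z : injective (@gen _ _ _ _ rho_res M z).
Proof. exact: gen_inj. Qed.
Let go z : onto (@gen _ _ _ _ rho_res M z).
Proof. exact: gen_onto. Qed.

Fact stalk_linear z : linear_for (rho z \; *:%R)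
  ((fun s => ms_val (g s) (I : [set: Y] z)) : G -> mstalk N z).
Proof.
move=> a s t.
have e := linearP g (rT a) (s : msect M [set: Y]) t.
exact: (congr1 (fun w : msect N _ => w z I) e).
Qed.
Let ga z : base_change (rho z) G -> mstalk N z := bc (mklin (@stalk_linear z)).
Let gaE z s (m : msect M [set: Y]) : ga (btens (rho z) s (m : G)) = s *: g m z I.
Proof. exact: (bcE (mklin (@stalk_linear z))). Qed.

Let gaD z (x y : base_change (rho z) G) : ga (x + y) = ga x + ga y.
Proof. exact: raddfD. Qed.

(** The base change of [g] along R -> O_z, read through the bijection [gen] from O_z (x)_R Gamma(Y,
    M) to M_z. *)
Let u_fun z (m : mstalk M z) : mstalk N z := ga (sval (cid (go m))).
Let u_gen z t : u_fun (@gen _ _ _ _ rho_res M z t) = ga t.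
Proof. by rewrite /u_fun; congr ga; apply: gi; exact: (svalP (cid (go _))). Qed.

Let u_linear z : linear (@u_fun z).
Proof.
move=> a m m'; have [t <-] := go m; have [t' <-] := go m'.
rewrite -[a *: _](bc_scale _ a t) -[X in u_fun X](raddfD (@gen _ _ _ _ rho_res M z)) !u_gen.
by rewrite /ga raddfD /= bc_scale.
Qed.

Let u_res z z' (h : sple z z') v :
  mklin (@u_linear z') (mres M h v) = mres N h (mklin (@u_linear z) v).
Proof.
have [t <-] := go v; rewrite -[X in _ = mres N h X]/(u_fun _) u_gen.
have e : mres M h (@gen _ _ _ _ rho_res M z t) =
    @gen _ _ _ _ rho_res M z' (tmap (sres (rhoT_res rho_res) I I h) idfun t).
  elim/btens_ind: t => [|x y hx hy|s m]; first by rewrite !raddf0.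
    by rewrite !raddfD /= hx hy.
  rewrite genE [X in _ = gen X]tmapE [RHS]genE linearZ /=; congr (_ *: _).
  exact: ms_res.
rewrite e -[LHS]/(u_fun _) u_gen.
elim/btens_ind: {e} t => [|x y hx hy|s m]; first by rewrite /ga !raddf0.
  by rewrite raddfD !gaD hx hy raddfD.
rewrite [X in ga X]tmapE [LHS]gaE gaE linearZ /=; congr (_ *: _).
exact/esym/ms_res.
Qed.

Lemma sections_full : exists u : omor M N, forall s, msect_map u s = g s.
Proof.
exists (@OMor _ _ M N (fun z => mklin (@u_linear z)) u_res) => s.
apply: msectP => z []; rewrite -[LHS]/(u_fun (s z I)).
have -> : s z I = @gen _ _ _ _ rho_res M z (btens (rho z) 1 (s : G)) by rewrite genE scale1r.
by rewrite u_gen gaE scale1r.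
Qed.

(** By [gen_onto] every stalk of M is generated by global sections, and on these both morphisms are
    [g]. *)
Lemma sections_faithful (u u' : omor M N) :
  (forall s, msect_map u (U := [set: Y]) s = g s) ->
  (forall s, msect_map u' (U := [set: Y]) s = g s) -> forall p v, u p v = u' p v.
Proof.
move=> hu hu' p v; have [t <-] := go v.
elim/btens_ind: t => [|x y hx hy|s m]; first by rewrite !raddf0.
  by rewrite !raddfD /= hx hy.
rewrite genE !linearZ /=; congr (_ *: _).
have e : msect_map u m = msect_map u' m by rewrite hu hu'.
exact: (congr1 (fun w : msect N _ => w p I) e).
Qed.
End FullyFaithful.

Hypothesis acyc_all : forall n, acyc n (mdiag (rhoT_res rho_res) (struct_module Y)).

Local Notation BR := (rscal rT B^o).

Fact eval_linear w : linear_for (rho w \; *:%R)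
  ((fun b => os_val b (I : [set: Y] w)) : BR -> (ostalk w)^o).
Proof. by []. Qed.
(** The injective half of O_w (x)_R O(Y) = O_w. Combined with [sect_tens_inj], it detects equalities
    in O(Y) (x)_R O(Y) by evaluating both factors at each point. *)
Hypothesis eval_inj : forall w, injective (bc (mklin (@eval_linear w))).

Let flT w (uw : [set: Y] w) : flat_rmorphism (rhoT rho uw).
Proof. exact: flat_rho. Qed.

(* [R -> O(Y)] is an epimorphism of rings. *)
Lemma sections_epi (b : B) : btens rT b (1 : BR) = btens rT 1 (b : BR).
Proof.
apply/eqP; rewrite -subr_eq0; apply/eqP.
apply: (sect_tens_inj (@setT_up _ Y) flT acyc_all) => w [].
have E (c d : B) : bc (mklin (@eval_linear w))
    (tmap (sev (rhoT_res rho_res) (I : [set: Y] w)) idfun (btens rT c (d : BR))) =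
    os_val c (I : [set: Y] w) * os_val d (I : [set: Y] w).
  by rewrite [X in bc _ X]tmapE [LHS]bcE.
by apply: (@eval_inj w); rewrite !raddfB raddf0 /= !E mulr1 mul1r addrN.
Qed.

Section EssentiallySurjective.
Variable N : lmodType B.
Local Notation NR := (rscal rT N).

(** The image of [sections_epi] under c -> c *: n. In B (x)_R N the two actions of B agree, whence B
    (x)_R N = N. *)
Lemma sections_epi_module (b : B) (n : N) :
  btens rT b (n : NR) = btens rT 1 (b *: n : NR).
Proof.
have l : linear ((fun c : B => c *: n) : BR -> NR).
  by move=> a x y; have := scalerDl n (rT a * x) y; rewrite -scalerA; exact.
have := congr1 (bmap (f := rT) (mklin l)) (sections_epi b).
rewrite !bmapE => e; apply: etrans e.
exact: (congr1 (@btens _ _ rT NR b) (esym (scale1r n))).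
Qed.

Let S := bsheaf rho_res NR.

(** The candidate isomorphism N -> Gamma(Y, O (x)_R N). Its B-linearity rests on the agreement of
    the two actions of B on B (x)_R N. *)
Let tilde (n : N) : msect S [set: Y].
Proof.
exists (fun w _ => btens (rho w) 1 (n : NR)) => p q up uq h.
by rewrite [LHS]bsheaf_resE rmorph1.
Defined.

Let tilde_linear : linear tilde.
Proof.
move=> b m n; apply: msectP => w [].
apply: etrans (@btensDr _ _ (rho w) NR 1 (b *: m : N) n) _.
rewrite -[RHS]/(os_val b (I : [set: Y] w) *: btens (rho w) 1 (m : NR) + btens (rho w) 1 (n : NR)).
congr (_ + _); rewrite btens_scale mulr1.
have := congr1 (tmap (sev (rhoT_res rho_res) (I : [set: Y] w)) idfun) (sections_epi_module b m).
by rewrite [X in X = _ -> _]tmapE [X in _ = X -> _]tmapE => /esym.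
Qed.

Let act_fun_linear : linear_for (rT \; *:%R) ((fun n => n) : NR -> N).
Proof. by []. Qed.

Let tilde_inj : injective tilde.
Proof.
have ia : injective (mklin tilde_linear).
  apply: raddf_inj => n n0.
  have e : btens rT 1 (n : NR) = 0.
    apply: (sect_tens_inj (@setT_up _ Y) flT acyc_all) => w [].
    rewrite [LHS]tmapE; exact: (congr1 (fun s : msect S _ => s w I) n0).
  (* Multiplication B (x)_R N -> N retracts n -> 1 (x) n. *)
  have := congr1 (bc (mklin act_fun_linear)) e.
  by rewrite raddf0 bcE scale1r.
exact: ia.
Qed.

Let tilde_onto : onto tilde.
Proof.
move=> s.
have [|T hT] := sect_tens_onto (@setT_up _ Y) flT acyc_all (t := fun w uw => ms_val s uw).
  by move=> w w' [] [] h; exact: (@ms_res _ _ S _ s w w' I I h).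
have [n hn] : exists n : N, T = btens rT 1 (n : NR).
  elim/btens_ind: {hT} T => [|_ _ [n ->] [m ->]|b n].
  - by exists 0; exact/esym/tens0r.
  - by exists (n + m); exact: (esym (@btensDr _ _ rT NR 1 n m)).
  - by exists (b *: n); exact: sections_epi_module.
exists n; apply: msectP => w uw.
by rewrite -hT hn [RHS]tmapE.
Qed.

Lemma sections_essentially_onto : exists2 M : omodule Y, quasi_coherent M &
  exists g : {linear msect M [set: Y] -> N}, bijective g.
Proof.
exists S; first exact: bsheaf_quasi_coherent.
have [g [bg _]] := linear_inverse (f := mklin tilde_linear) tilde_inj tilde_onto.
by exists g.
Qed.
End EssentiallySurjective.

Lemma sections_equivalence : global_sections_equivalence Y.
Proof.
split=> [M N qcM qcN g|N]; last exact: sections_essentially_onto.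
by split; [exact: sections_full|exact: sections_faithful].
Qed.
End GlobalSections.

(** * Cohomology on open subspaces *)

Lemma sple_pair (S T : topologicalType) (p p' : S) (q q' : T) :
  sple p p' -> sple q q' -> sple ((p, q) : S * T) (p', q').
Proof.
move=> pp qq W [oW Wpq].
have : nbhs ((p, q) : S * T) W by exact: open_nbhs_nbhs.
move=> [[A B] /= [+ +]] AB.
rewrite !nbhsE /= => -[A' [oA pA] AA] [B' [oB pB] BB].
by apply: AB; split=> /=; [apply: AA; exact: pp|apply: BB; exact: qq].
Qed.

Lemma quasi_coherent_iso (k : comPzRingType) (Z : rfspace k) (M N : omodule Z)
    (u : omor N M) : (forall p, injective (u p)) -> (forall p, onto (u p)) ->
  quasi_coherent M -> quasi_coherent N.
Proof.
move=> ui uo qM p; have [U [oU [up [I [J [a [b ab]]]]]]] := qM p.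
exists U, oU; split=> //; exists I, J, a.
pose g x := projT1 (choice (uo x)).
have gK x v : u x (g x v) = v := projT2 (choice (uo x)) v.
have gl x : linear (g x : mstalk M x -> mstalk N x).
  by move=> c v w; apply: ui; rewrite linearP !gK.
pose F := free_module (open_subspace oU) J.
have br (x y : open_subspace oU) (h : sple x y) v :
    (mklin (gl (\val y)) \o b y) (mres F h v) =
    mres (mrestr N oU) h ((mklin (gl (\val x)) \o b x) v).
  apply: ui; rewrite [LHS]gK (om_res b h) [RHS]om_res.
  by congr (mres M _ _); rewrite [RHS]gK.
exists (@OMor _ _ F (mrestr N oU) (fun x => mklin (gl (\val x)) \o b x) br).
move=> x; have [bo ex] := ab x; split.
  move=> z; have [y hy] := bo (u (\val x) z); exists y.
  by apply: ui; rewrite [LHS]gK.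
move=> y; rewrite -ex; split=> e.
  by rewrite -[LHS](gK (\val x)) [X in u _ X]e raddf0.
by apply: ui; rewrite [LHS]gK raddf0.
Qed.

Section RestrictExact.
Variables (k : comPzRingType) (X : rfspace k) (U : set X) (oU : open U).
Local Notation XU := (open_subspace oU).
Variables (V : set X) (VU : forall x, V x -> U x) (V' : set XU).
Hypothesis VV' : forall p : XU, V' p <-> V (\val p).

Section Sections.
Variable M : omodule X.

Definition sect_restr (s : msect M V) : msect (mrestr M oU) V'.
Proof.
exists (fun p vp => s (\val p) ((VV' p).1 vp)) => p q vp vq h.
exact: (ms_res s ((VV' p).1 vp) ((VV' q).1 vq) (osub_sple h)).
Defined.

Lemma in_sub p (vp : V p) : V' (sub_pt oU (VU vp)).
Proof. exact: ((VV' (sub_pt oU (VU vp))).2 vp). Qed.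

Definition sect_unrestr (s : msect (mrestr M oU) V') : msect M V.
Proof.
exists (fun p vp => s (sub_pt oU (VU vp)) (in_sub vp)) => p q vp vq h.
have h' : sple (sub_pt oU (VU vp)) (sub_pt oU (VU vq)) by exact: osub_spleV.
rewrite -(ms_res s (in_sub vp) (in_sub vq) h').
exact: (congr1 (fun h => mres M h _) (Prop_irrelevance _ _)).
Defined.

Lemma sect_restrK (s : msect (mrestr M oU) V') : sect_restr (sect_unrestr s) = s.
Proof.
apply: msectP => p vp.
have h : sple p (sub_pt oU (VU ((VV' p).1 vp))).
  by apply: osub_spleV; exact: sple_refl.
rewrite -[LHS](ms_res s vp _ h).
exact: (@mres_id _ _ M (\val p)).
Qed.
End Sections.

Lemma sect_exact_restr (C : ocomplex X) n :
  sect_exact (V') (complex_restr oU C) n <-> sect_exact (V) C n.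
Proof.
split=> h s s0.
  have [|t ht] := h (sect_restr s).
    by apply: msectP => p vp; exact: (congr1 (fun r : msect _ V => r _ ((VV' p).1 vp)) s0).
  exists (sect_unrestr t); apply: msectP => p vp.
  have := congr1 (fun r : msect _ V' => r _ (in_sub vp)) ht.
  move=> e; apply: etrans e _.
  by congr (ms_val s _); exact: Prop_irrelevance.
have [|t ht] := h (sect_unrestr s).
  by apply: msectP => p vp; exact: (congr1 (fun r : msect _ V' => r _ (in_sub vp)) s0).
exists (sect_restr t); rewrite -[RHS]sect_restrK -ht.
exact: msectP.
Qed.
End RestrictExact.

Lemma cohomology_sect_exact (k : comPzRingType) (X : rfspace k) (C : ocomplex X) n :
  lmod_zero (lcohomology (sect_complex C [set: X]) n.+1) <->
  sect_exact ([set: X]) C n.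
Proof.
split=> [h s s0|h].
  have e := h (sq_class _ (s0 : cocycles (sect_complex C [set: X]) n.+1 s)).
  have := (sq_classP _ _ (lsub0 (cocycles (sect_complex C [set: X]) n.+1))).1 e.
  by rewrite subr0.
elim/sq_ind=> s s0; apply/(sq_classP _ s0 (lsub0 _)); rewrite subr0.
exact: h.
Qed.

Lemma higher_dimage_sect_exact (k : comPzRingType) (X Y : rfspace k) (f : rfmor X Y)
    (C : ocomplex X) n :
  omodule_zero (ocohomology (dimage_complex f C) n.+1) <->
  forall y, sect_exact (fiber_open f y) C n.
Proof.
split=> [h y s s0|h y].
  pose K := stalk_complex (dimage_complex f C) y.
  have e := h y (sq_class _ (s0 : cocycles K n.+1 s)).
  have := (sq_classP _ _ (lsub0 (cocycles K n.+1))).1 e.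
  by rewrite subr0.
elim/sq_ind=> s s0; apply/(sq_classP _ s0 (lsub0 _)); rewrite subr0.
exact: h.
Qed.

(** * The diagonal *)

Section DiagonalBaseChange.
Variables (k : comPzRingType) (X : rfspace k).
Local Notation XX := (rfprod X X).
Local Notation delta := (diagonal_mor X).
Local Notation D := (dimage delta (struct_module X)).

Section Step.
Variables (p p' q : X) (hp : sple p p').

Definition inl_st (a b : X) : {rmorphism ostalk a -> ostalk ((a, b) : XX)} :=
  @tinl k _ _ (ostr a) (ostr b).
Definition inr_st (a b : X) : {rmorphism ostalk b -> ostalk ((a, b) : XX)} :=
  @tinr k _ _ (ostr a) (ostr b).

Let h : sple ((p, q) : XX) (p', q) := sple_pair hp (@sple_refl _ q).

Lemma ores_pair a b :
  ores h (tpure (ostr p) (ostr q) a b) = tpure (ostr p') (ostr q) (ores hp a) b.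
Proof.
rewrite [LHS]prod_resE; congr tpure; first exact: ores_irr.
exact: ores_id.
Qed.

Lemma inl_comm r : ores h (inl_st p q r) = inl_st p' q (ores hp r).
Proof. exact: ores_pair. Qed.

Local Notation CR := (rscal (inl_st p q) (ostalk ((p, q) : XX))^o).
(** The map O_p' (x)_(O_p) (O_p (x)_k O_q) -> O_p' (x)_k O_q, shown below to be bijective: moving
    the first index alone is a pushout along O_p -> O_p'. *)
Let mu := bc (pushout_map inl_comm).

Let muE s a b : mu (@btens _ _ (ores hp) CR s
  (tpure (ostr p) (ostr q) a b)) = tpure (ostr p') (ostr q) (s * ores hp a) b.
Proof.
rewrite [LHS]bcE -[LHS]/(inl_st p' q s * ores h (tpure _ _ a b)) ores_pair.
by rewrite [LHS]tpureM mul1r.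
Qed.

Let mu_onto : onto mu.
Proof.
elim/tpure_ind=> [|_ _ [x <-] [y <-]|a b]; first by exists 0; rewrite /mu raddf0.
  by exists (x + y); rewrite /mu raddfD.
exists (@btens _ _ (ores hp) (CR) a
  (tpure (ostr p) (ostr q) 1 b)).
by rewrite muE rmorph1 mulr1.
Qed.

Let W := base_change (ores hp) CR.
Let ka_fun (s : ostalk p') (b : ostalk q) : W :=
  btens (ores hp) s (inr_st p q b : CR).

Let ka_balanced : @balanced k (rscal (ostr p') (ostalk p')^o) (rscal (ostr q) (ostalk q)^o)
  W ka_fun.
Proof.
split=> [b s s'|s b b'|c s b].
- exact: btensDl.
- by rewrite /ka_fun raddfD; exact: btensDr.
have e : inr_st p q (ostr q c * b) = inl_st p q (ostr p c) * inr_st p q b.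
  by rewrite rmorphM; congr (_ * _); exact/esym/tin_scal.
rewrite /ka_fun -[c *: b]/(ostr q c * b) e.
apply: esym; apply: etrans (btensZ (ores hp) (ostr p c) s
  (inr_st p q b : CR)) _.
by rewrite ores_str mulrC.
Qed.

Let mu_inj : injective mu.
Proof.
pose ka : ostalk ((p', q) : XX) -> W := tbil ka_balanced.
have kaE a b : ka (tpure (ostr p') (ostr q) a b) = ka_fun a b by exact: tbilE.
have ka0 : ka 0 = 0 by exact: raddf0.
have kaD x y : ka (x + y) = ka x + ka y by exact: raddfD.
have muD x y : mu (x + y) = mu x + mu y by exact: raddfD.
apply: (can_inj (g := ka)) => t.
elim/btens_ind: t => [|t t' ht ht'|s c]; first by rewrite [mu 0]raddf0.
  by rewrite muD kaD ht ht'.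
elim/tpure_ind: c => [|c c' hc hc'|a b].
- have e : btens (ores hp) s (0 : CR) = 0.
    exact: tens0r.
  by rewrite [X in mu X]e [X in _ = X]e [mu 0]raddf0.
- have e : btens (ores hp) s (c + c' : CR) =
    btens (ores hp) s (c : CR) +
    btens (ores hp) s (c' : CR) by exact: btensDr.
  by rewrite [X in mu X]e [X in _ = X]e muD kaD hc hc'.
rewrite muE kaE /ka_fun.
apply: etrans (esym (btensZ (ores hp) a s
  (inr_st p q b : CR))) _.
congr btens; rewrite [LHS]tpureM.
by rewrite mulr1 mul1r.
Qed.

Hypothesis qcD : quasi_coherent D.

Let D_res : {linear mstalk D (p, q) -> mstalk D (p', q) | ores h \; *:%R} := mres D h.

Definition diag_phi :
    {linear rscal (inl_st p q) (mstalk D (p, q)) -> rscal (inl_st p' q) (mstalk D (p', q))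
      | ores hp \; *:%R} :=
  pushout_phi inl_comm D_res.

(** Quasi-coherence of delta_* O compares its stalks over O_p (x)_k O_q; the pushout square turns
    this into a comparison over O_p alone. With [diag_bc_onto]: O_p' (x)_(O_p) O(U_p n U_q) = O(U_p'
    n U_q). *)
Lemma diag_bc_inj : injective (bc diag_phi).
Proof.
apply: (@pushout_bc_inj _ _ _ _ _ _ _ _ inl_comm mu_inj mu_onto _ _ D_res).
exact: (quasi_coherent_bc h qcD).1.
Qed.

Lemma diag_bc_onto : onto (bc diag_phi).
Proof.
apply: (@pushout_bc_onto _ _ _ _ _ _ _ _ inl_comm mu_inj mu_onto _ _ D_res).
exact: (quasi_coherent_bc h qcD).2.
Qed.

End Step.

Lemma in_fiber (a b w : X) : sple a w -> sple b w -> fiber_open delta (a, b) w.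
Proof. exact: sple_pair. Qed.

Lemma fiber_fst (a b w : X) : fiber_open delta (a, b) w -> sple a w.
Proof. exact: (@sple_fst _ X X (a, b) (w, w)). Qed.
Lemma fiber_snd (a b w : X) : fiber_open delta (a, b) w -> sple b w.
Proof. exact: (@sple_snd _ X X (a, b) (w, w)). Qed.

Lemma inl_stE (a b w : X) (s : ostalk a) (m : mstalk D (a, b))
    (hw : fiber_open delta (a, b) w) :
  ms_val (inl_st a b s *: m) hw = ores (fiber_fst hw) s * ms_val m hw.
Proof.
rewrite -[LHS]/(diag_sharp w (ores hw (inl_st a b s)) * ms_val m hw).
rewrite [X in diag_sharp w X]prod_resE diag_sharpE rmorph1 mulr1.
by congr (_ * _); exact: ores_irr.
Qed.

Lemma diag_bcE (p p' q : X) (hp : sple p p') s (m : mstalk D (p, q)) w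
    (hw : fiber_open delta (p', q) w) (hw' : fiber_open delta (p, q) w) :
  ms_val (bc (diag_phi q hp)
    (@btens _ _ (ores hp) (rscal (inl_st p q) (mstalk D (p, q))) s m)) hw =
  ores (fiber_fst hw) s * ms_val m hw'.
Proof.
rewrite bcE [LHS]inl_stE; congr (_ * ms_val m _).
exact: Prop_irrelevance.
Qed.
End DiagonalBaseChange.

(** * The open subspace U_p n U_q over the ring O_p *)

Section IntersectionSpace.
Variables (k : comPzRingType) (X : rfspace k) (p q : X).
Local Notation delta := (diagonal_mor X).
Local Notation D := (dimage delta (struct_module X)).
Hypothesis qcD : quasi_coherent D.

Local Notation U := (fiber_open delta (p, q)).
Local Notation Y := (open_subspace (fiber_open_open delta (p, q))).

Definition sub_fst (w : Y) : sple p (\val w) := fiber_fst (sub_ptP w).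
Definition sub_snd (w : Y) : sple q (\val w) := fiber_snd (sub_ptP w).

Definition fst_res (w : Y) : {rmorphism ostalk p -> ostalk w} := ores (sub_fst w).
Lemma fst_res_res (w w' : Y) (h : sple w w') a : ores h (fst_res w a) = fst_res w' a.
Proof. exact: (ores_comp (sub_fst w) (osub_sple h) (sub_fst w') a). Qed.

Section Meet.
Variables x z : Y.
Local Notation O_x := (rscal (fst_res x) (ostalk x)^o).
Local Notation D_x := (rscal (inl_st p (\val x)) (mstalk D (p, \val x))).

(** Since x lies in U_p, the fibre of the diagonal over (p, x) is U_x, and the stalk of delta_* O
    there is O_x; [spread] and [eval_x] pass between the two as O_p-modules. *)
Definition spread_fun (a : ostalk (\val x)) : mstalk D (p, \val x).
Proof.
exists (fun w hw => ores (fiber_snd hw) a) => w w' hw hw' h.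
exact: (ores_comp (fiber_snd hw) h (fiber_snd hw') a).
Defined.
Fact spread_linear : linear (spread_fun : O_x -> D_x).
Proof.
move=> r a b; apply: msectP => w hw.
rewrite [RHS](_ : _ = ms_val (inl_st p (\val x) r *: spread_fun a) hw + ms_val (spread_fun b) hw) //.
rewrite inl_stE.
have := rmorphD (ores (fiber_snd hw)) (ores (sub_fst x) r * a) b.
rewrite rmorphM (ores_comp _ _ (fiber_fst hw)); exact.
Qed.
Definition spread : {linear O_x -> D_x} := mklin spread_linear.

Definition at_x (m : mstalk D (p, \val x)) : ostalk (\val x) :=
  ms_val m (in_fiber (sub_fst x) (@sple_refl _ (\val x))).
Fact at_x_linear : linear (at_x : D_x -> O_x).
Proof.
move=> r m m'; have := inl_stE r m (in_fiber (sub_fst x) (@sple_refl _ (\val x))).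
move=> e; rewrite [LHS](_ : _ = at_x (inl_st p (\val x) r *: m) + at_x m') //.
congr (_ + _); apply: etrans e _.
exact: (congr1 ( *%R^~ (at_x m)) (ores_irr _ (sub_fst x) r)).
Qed.
Definition eval_x : {linear D_x -> O_x} := mklin at_x_linear.

Lemma spreadK a : eval_x (spread a) = a.
Proof. exact: (@ores_id _ X (\val x) _ a). Qed.

Local Notation mu := (bc (pushout_map (rho_meet fst_res_res x z))).

Lemma meet_fiber w (hw : meet x z w) : fiber_open delta (\val z, \val x) (\val w).
Proof. by case: hw => xw zw; apply: in_fiber; exact: osub_sple. Qed.

Lemma mu_spread t w (hw : meet x z w) :
  ms_val (bc (diag_phi (\val x) (sub_fst z)) (bmap (f := fst_res z) spread t))
    (meet_fiber hw) = os_val (mu t) hw.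
Proof.
elim/btens_ind: t => [|t t' ht ht'|s a]; first by rewrite !raddf0.
  by rewrite !raddfD /= -ht -ht'.
have hw' : fiber_open delta (p, \val x) (\val w).
  by apply: in_fiber; [exact: sub_fst|exact: osub_sple hw.1].
rewrite bmapE.
apply: etrans (@diag_bcE k X p (\val z) (\val x) (sub_fst z) s (spread a) (\val w)
  (meet_fiber hw) hw') _.
rewrite bcE.
rewrite -[RHS]/(ores (osub_sple hw.2) s * ores (osub_sple hw.1) a).
exact: (f_equal2 *%R (ores_irr _ _ _) (ores_irr _ _ _)).
Qed.

Lemma fiber_sub w (hw : fiber_open delta (\val z, \val x) w) : U w.
Proof.
apply: in_fiber; first exact: sple_trans (sub_fst z) (fiber_fst hw).
exact: sple_trans (sub_snd x) (fiber_snd hw).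
Qed.
Lemma fiber_meet w (hw : fiber_open delta (\val z, \val x) w) :
  meet x z (sub_pt (fiber_open_open delta (p, q)) (fiber_sub hw)).
Proof. by split; apply: osub_spleV; [exact: (fiber_snd hw)|exact: (fiber_fst hw)]. Qed.

(** After replacing O_x by the stalk of delta_* O at (p, x), this is the base change from (p, x) to
    (z, x), whose target is O(U_z n U_x). *)
Lemma mu_meet_inj : injective mu.
Proof.
apply: raddf_inj => t t0.
have e : bmap (f := fst_res z) spread t = 0.
  apply: (diag_bc_inj (q := \val x) (hp := sub_fst z) qcD); rewrite raddf0.
  apply: msectP => w hw.
  have := mu_spread t (fiber_meet hw); rewrite t0 => e0; apply: etrans _ e0.
  by congr (ms_val _ _); exact: Prop_irrelevance.
rewrite -(tmap_id t) -(tmap_comp (u := idfun) (v := spread) (u' := idfun) (v' := eval_x)) //.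
  by rewrite [X in tmap _ _ X]e raddf0.
exact: spreadK.
Qed.

Lemma mu_eval T w (hw : meet x z w) :
  os_val (mu (bmap (f := fst_res z) eval_x T)) hw =
  ms_val (bc (diag_phi (\val x) (sub_fst z)) T) (meet_fiber hw).
Proof.
elim/btens_ind: T => [|t t' ht ht'|s m]; first by rewrite !raddf0.
  by rewrite !raddfD /= -ht -ht'.
have hw' : fiber_open delta (p, \val x) (\val w).
  by apply: in_fiber; [exact: sub_fst|exact: osub_sple hw.1].
rewrite bmapE; apply: esym.
apply: etrans (@diag_bcE k X p (\val z) (\val x) (sub_fst z) s m (\val w)
  (meet_fiber hw) hw') _.
rewrite bcE -[RHS]/(ores (osub_sple hw.2) s * ores (osub_sple hw.1) (at_x m)).
congr (_ * _); first exact: ores_irr.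
exact: (esym (ms_res m _ hw' (osub_sple hw.1))).
Qed.

Lemma mu_meet_onto : onto mu.
Proof.
move=> c.
have cP v w (hv : fiber_open delta (\val z, \val x) v)
    (hw : fiber_open delta (\val z, \val x) w) (h : sple v w) :
    mres (struct_module X) h (os_val c (fiber_meet hv)) = os_val c (fiber_meet hw).
  have h' : sple (sub_pt (fiber_open_open delta (p, q)) (fiber_sub hv))
      (sub_pt (fiber_open_open delta (p, q)) (fiber_sub hw)) by exact: osub_spleV.
  by rewrite -(os_res c (fiber_meet hv) (fiber_meet hw) h'); exact: ores_irr.
pose m : mstalk D (\val z, \val x) := MSect cP.
have [T hT] := @diag_bc_onto _ _ _ _ (\val x) (sub_fst z) qcD m.
exists (bmap (f := fst_res z) eval_x T); apply: osectP => w hw.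
rewrite mu_eval hT /=.
have h : sple w (sub_pt (fiber_open_open delta (p, q)) (fiber_sub (meet_fiber hw))).
  by apply: osub_spleV; exact: sple_refl.
rewrite -(os_res c hw _ h).
exact: (@ores_id _ X (\val w)).
Qed.
End Meet.

Local Notation rT := (rsect (rhoT_res fst_res_res)).
Local Notation BR := (rscal rT (osect [set: Y])^o).
Local Notation DR := (rscal (inl_st p q) (mstalk D (p, q))).

Definition to_diag_fun (b : osect [set: Y]) : mstalk D (p, q).
Proof.
exists (fun w (hw : U w) => os_val b (I : [set: Y] (sub_pt (fiber_open_open delta (p, q)) hw))).
move=> v w hv hw h.
have h' : sple (sub_pt (fiber_open_open delta (p, q)) hv)
    (sub_pt (fiber_open_open delta (p, q)) hw) by exact: osub_spleV.
rewrite -(@os_res _ _ _ b _ _ I I h'); exact: ores_irr.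
Defined.
Fact to_diag_linear : linear (to_diag_fun : BR -> DR).
Proof.
move=> r a b; apply: msectP => w hw.
rewrite [RHS](_ : _ = ms_val (inl_st p q r *: to_diag_fun a) hw + ms_val (to_diag_fun b) hw) //.
rewrite inl_stE; congr (_ * _ + _); exact: ores_irr.
Qed.
Definition to_diag : {linear BR -> DR} := mklin to_diag_linear.

Definition of_diag_fun (m : mstalk D (p, q)) : osect [set: Y].
Proof.
exists (fun w _ => ms_val m (sub_ptP w)) => v w _ _ h.
exact: (ms_res m (sub_ptP v) (sub_ptP w) (osub_sple h)).
Defined.
Fact of_diag_linear : linear (of_diag_fun : DR -> BR).
Proof.
move=> r m m'; apply: osectP => w [].
rewrite [LHS](_ : _ = ms_val (inl_st p q r *: m) (sub_ptP w) + ms_val m' (sub_ptP w)) //.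
by rewrite inl_stE.
Qed.
Definition of_diag : {linear DR -> BR} := mklin of_diag_linear.

Lemma to_diagK b : of_diag (to_diag b) = b.
Proof.
apply: osectP => w [] /=.
have h : sple w (sub_pt (fiber_open_open delta (p, q)) (sub_ptP w)).
  by apply: osub_spleV; exact: sple_refl.
by rewrite -(@os_res _ _ _ b w _ I I h); exact: (@ores_id _ X (\val w)).
Qed.

(** Base change from (p, q) to (w, q) embeds O_w (x)_(O_p) B in O(U_w n U_q), and that embedding
    factors through the multiplication map to O_w. *)
Lemma diag_eval_inj w : injective (bc (mklin (@eval_linear _ _ _ _ fst_res_res w))).
Proof.
apply: raddf_inj => t t0.
have E v (hv : fiber_open delta (\val w, q) v) :
    ms_val (bc (diag_phi q (sub_fst w)) (bmap (f := fst_res w) to_diag t)) hv =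
    ores (fiber_fst hv) (bc (mklin (@eval_linear _ _ _ _ fst_res_res w)) t).
  elim/btens_ind: {t0} t => [|t t' ht ht'|s b]; first by rewrite !raddf0.
    by rewrite !raddfD /= -ht -ht'.
  have uv : U v by apply: in_fiber; [exact: sple_trans (sub_fst w) (fiber_fst hv)|exact: fiber_snd hv].
  rewrite bmapE.
  apply: etrans (@diag_bcE k X p (\val w) q (sub_fst w) s (to_diag b) v hv uv) _.
  rewrite bcE; apply: etrans (esym (rmorphM (ores (fiber_fst hv)) s (os_val b (I : [set: Y] w)))).
  congr (_ * _).
  have h : sple w (sub_pt (fiber_open_open delta (p, q)) uv).
    by apply: osub_spleV; exact: (fiber_fst hv).
  rewrite -[LHS](@os_res _ _ _ b w _ I I h); exact: ores_irr.
have e : bmap (f := fst_res w) to_diag t = 0.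
  apply: (diag_bc_inj (q := q) (hp := sub_fst w) qcD); rewrite raddf0.
  by apply: msectP => v hv; rewrite E t0 raddf0.
rewrite -(tmap_id t) -(tmap_comp (u := idfun) (v := to_diag) (u' := idfun) (v' := of_diag)) //.
  by rewrite [X in tmap _ _ X]e raddf0.
exact: to_diagK.
Qed.
End IntersectionSpace.

(** * The two implications *)

Lemma finite_subspace (k : comPzRingType) (X : rfspace k) (U : set X) (oU : open U) :
  finite_space X -> finite_space (open_subspace oU).
Proof. by move=> fX p q h; exact: fX. Qed.

Lemma semi_separated_affine (k : comPzRingType) (X : rfspace k) :
  finite_space X -> semi_separated X -> affine_morphism (diagonal_mor X).
Proof.
move=> fX [qcD van] [p q].
(* The resolution may change with [n]; [acyc_sect_exact] removes this dependence. *)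
have res n : exists I : injective_resolution (struct_module X),
    forall y, sect_exact (fiber_open (diagonal_mor X) y) I n.
  by have [I /higher_dimage_sect_exact hI] := van n.+1 (ltn0Sn n); exists I.
set Y := open_subspace _.
have exT n : exists I : injective_resolution (struct_module Y), sect_exact [set: Y] I n.
  have [I hI] := res n; exists (resolution_restr (fiber_open_open (diagonal_mor X) (p, q)) I).
  apply/(@sect_exact_restr _ _ _ _ (fiber_open (diagonal_mor X) (p, q))) => //.
  by move=> w; split=> // _; exact: sub_ptP.
have exM x z n : exists I : injective_resolution (struct_module Y), sect_exact (meet x z) I n.
  have [I hI] := res n; exists (resolution_restr (fiber_open_open (diagonal_mor X) (p, q)) I).
  (* U_x n U_z lies in U and is itself a fibre of the diagonal, over (z, x), so the vanishing of the
     higher direct images applies to it as well. *)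
  apply/(@sect_exact_restr _ _ _ _ (fiber_open (diagonal_mor X) (\val z, \val x))) => //.
    by move=> w; exact: fiber_sub.
  move=> w; split=> [|h]; first exact: meet_fiber.
  by split; apply: osub_spleV; [exact: (fiber_snd h)|exact: (fiber_fst h)].
split=> [[//|n] _|].
  by have [I hI] := exT n; exists I; apply/cohomology_sect_exact.
(* The base ring is O_p, and each O_p -> O_w is a restriction morphism of X, hence flat. *)
apply: (@sections_equivalence _ _ _ (@fst_res _ _ p q) (@fst_res_res _ _ p q)).
- by move=> w; exact: fX.
- exact: finite_subspace.
- move=> x z n; have [I hI] := exM x z n.
  exact/(acyc_sect_exact (@meet_up _ _ x z) _ I n).
- by move=> x z; exact: mu_meet_inj.
- by move=> x z; exact: mu_meet_onto.
- move=> n; have [I hI] := exT n.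
  exact/(acyc_sect_exact (@setT_up _ Y) _ I n).
- by move=> w; exact: diag_eval_inj.
Qed.

(** In degree 0 the coboundaries vanish and the augmentation identifies delta_* O with the cocycles,
    by left exactness of sections; so R^0 delta_* O = delta_* O, whichever resolution is given. *)
Lemma schematic_qc (k : comPzRingType) (X : rfspace k) : schematic X ->
  quasi_coherent (dimage (diagonal_mor X) (struct_module X)).
Proof.
move=> /(_ 0)[I]; set H := ocohomology _ _ => qH.
pose D := dimage (diagonal_mor X) (struct_module X).
pose K y := stalk_complex (dimage_complex (diagonal_mor X) I) y.
pose aug := dimage_map (diagonal_mor X) (ir_aug I).
have aug_coc y (s : mstalk D y) : cocycles (K y) 0 (aug y s).
  by apply: msectP => x hx /=; apply/(@ir_exact0 _ _ _ I); eexists.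
pose u_fun y (s : mstalk D y) : mstalk H y := sq_class _ (aug_coc y s).
have u_linear y : linear (@u_fun y).
  move=> a s t; rewrite [X in _ = X + _]sq_classZ [RHS]sq_classD.
  by apply: sq_class_eq; rewrite linearP.
have u_res y y' (h : sple y y') s :
    mklin (u_linear y') (mres D h s) = mres H h (mklin (u_linear y) s).
  rewrite [RHS]lcohomology_map_class; apply: sq_class_eq; exact: om_res.
apply: (quasi_coherent_iso (u := @OMor _ _ D H (fun y => mklin (u_linear y)) u_res) _ _ qH).
  move=> y s t /sq_classP e; apply: msectP => x hx.
  apply: (@ir_aug_mono _ _ _ I x); apply/eqP; rewrite -subr_eq0; apply/eqP.
  exact: (congr1 (fun r : msect _ _ => r x hx) e).
move=> y; elim/sq_ind => z Zz.
have h x (hx : fiber_open (diagonal_mor X) y x) : exists a, ir_aug I x a = ms_val z hx.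
  by apply/(@ir_exact0 _ _ _ I); exact: (congr1 (fun r : msect _ _ => r x hx) Zz).
pose a x hx := sval (cid (h x hx)).
have aE x hx : ir_aug I x (a x hx) = ms_val z hx := svalP (cid (h x hx)).
have aP x x' hx hx' (xx : sple x x') : mres (struct_module X) xx (a x hx) = a x' hx'.
  by apply: (@ir_aug_mono _ _ _ I x'); rewrite om_res !aE; exact: ms_res.
exists (MSect aP); apply: sq_class_eq; apply: msectP => x hx; exact: aE.
Qed.

Lemma affine_semi_separated (k : comPzRingType) (X : rfspace k) :
  schematic X -> affine_morphism (diagonal_mor X) -> semi_separated X.
Proof.
move=> sX aX; split=> [|[//|n] _]; first exact: schematic_qc.
(* The resolution of O on X supplied by schematicity serves all [y] at once, while affineness yields
   a resolution [J] on each fibre; [acyc] carries the vanishing from [J] to the restriction of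
   [I]. *)
have [I _] := sX n.+1; exists I; apply/higher_dimage_sect_exact => y.
have [van _] := aX y; have [J /cohomology_sect_exact hJ] := van n.+1 (ltn0Sn n).
have Y_up := @setT_up _ (open_subspace (fiber_open_open (diagonal_mor X) y)).
(* The base ring here is k: the comparison of resolutions asks for compatible maps to the stalks. *)
have rho_res (w w' : open_subspace (fiber_open_open (diagonal_mor X) y))
    (_ : [set: open_subspace (fiber_open_open (diagonal_mor X) y)] w)
    (_ : [set: open_subspace (fiber_open_open (diagonal_mor X) y)] w')
    (h : sple w w') a : ores h (ostr w a) = ostr w' a by exact: ores_str.
have /(acyc_sect_exact Y_up rho_res J n) ac := hJ.
have := (acyc_sect_exact Y_up rho_res
  (resolution_restr (fiber_open_open (diagonal_mor X) y) I) n).1 ac.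
move/(@sect_exact_restr _ _ _ _ (fiber_open (diagonal_mor X) y)); apply=> //.
by move=> w; split=> // _; exact: sub_ptP.
Qed.

Theorem proposition5p22 (k : comPzRingType) (X : rfspace k) :
  finite_space X -> schematic X ->
  (semi_separated X <-> affine_morphism (diagonal_mor X)).
Proof.
move=> fX sX; split; first exact: semi_separated_affine.
exact: affine_semi_separated.
Qed.
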